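(* Let $Z$ be a random $n\times n$ Wigner matrix (for each $n\ge 0$, as defined in the context) with arbitrary entry distributions of expected value $0$, with moments $\mu_q,\nu_q,\kappa_q$. For $a_1,a_2,c\in\mathbb{R}$ let $$H_2(t,a_1,a_2,c,c)=\sum_{n=0}^\infty \frac{t^n}{n!}\,\mathbb{E}\big[\det(Z+a_1J+c\,\mathrm{Id})\det(Z+a_2J+c\,\mathrm{Id})\big].$$ Then $$H_2(t,a_1,a_2,c,c)=P(t)\,Q(t),$$ where $$\begin{aligned}P(t)={}&1+(a_1+a_2)\left(\mu_3t^2+\frac{ct}{1+(\mu_2+\nu_2)t}\right)+a_1a_2\Bigg(\mu_3^2t^4+\frac{2c\mu_3t^3}{1+(\mu_2+\nu_2)t}+\frac{c^2t^2}{(1+(\mu_2+\nu_2)t)^2}\\&+\frac{2t^2(\mu_2-\mu_2^2t+\nu_2^2t)}{1-2\mu_2t+(\mu_2^2-\nu_2^2)t^2}+\frac{t}{1-(\mu_2+\nu_2)^2t^2}\Bigg)\end{aligned}$$ and $$Q(t)=\frac{\exp\left(t(c^2+\kappa_2-2\mu_2)+\frac12t^2(\mu_4-3\nu_2^2-3\mu_2^2+\nu_4)-\frac{t^2c^2(\mu_2+\nu_2)}{1+t(\mu_2+\nu_2)}\right)}{\left(1-2\mu_2t+(\mu_2^2-\nu_2^2)t^2\right)\sqrt{1-(\mu_2+\nu_2)^2t^2}}.$$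
   Context: A random $n\times n$ Wigner matrix $Z$ has entries $Z_{jj'}=Z^{\mathrm{Re}}_{jj'}+\mathbf{i}Z^{\mathrm{Im}}_{jj'}$ ($\mathbf{i}=\sqrt{-1}$) with real random variables $Z^{\mathrm{Re}}_{jj'},Z^{\mathrm{Im}}_{jj'}$ such that: $\{Z^{\mathrm{Re}}_{jj'}:j<j'\}$ are i.i.d., $\{Z^{\mathrm{Im}}_{jj'}:j<j'\}$ are i.i.d., $\{Z^{\mathrm{Re}}_{jj}\}$ are i.i.d., $Z^{\mathrm{Im}}_{jj}=0$; these three families are independent of each other; and for $j>j'$, $Z^{\mathrm{Re}}_{jj'}=Z^{\mathrm{Re}}_{j'j}$ and $Z^{\mathrm{Im}}_{jj'}=-Z^{\mathrm{Im}}_{j'j}$. The three distributions do not depend on $n$. For $j<j'$, $\mu_q=\mathbb{E}[(Z^{\mathrm{Re}}_{jj'})^q]$ and $\nu_q=\mathbb{E}[(Z^{\mathrm{Im}}_{jj'})^q]$; $\kappa_q=\mathbb{E}[Z_{jj}^q]$. It is assumed that $\mu_1=\nu_1=\kappa_1=0$, that the off-diagonal real and imaginary parts have finite fourth moments, and that the diagonal entries have finite second moment. $J$ is the $n\times n$ all-ones matrix and $\mathrm{Id}$ is the identity matrix. The determinant of the $0\times0$ matrix is $1$. The identity is one of formal power series in $t$, with $\sqrt{1-x}$ the power series with constant term $1$. *)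

(* Defs.v *)
From HB Require Import structures.
From mathcomp Require Import all_boot all_order all_algebra.
From mathcomp Require Import complex.
From mathcomp Require Import all_classical all_reals all_analysis.

Set Implicit Arguments.
Unset Strict Implicit.
Unset Printing Implicit Defensive.

Import Order.TTheory GRing.Theory Num.Theory.
Local Open Scope classical_set_scope.
Local Open Scope ring_scope.

(* Formal power series. A wrapper around [nat -> K], because the functions     *)
(* [nat -> K] already carry the pointwise ring structure.                      *)
Record fps (K : Type) := FPS { coefs : nat -> K }.

Section FormalPowerSeries.
Context {K : fieldType}.
Implicit Types (f g h : fps K) (c : K) (n : nat).

HB.instance Definition _ := gen_eqMixin (fps K).
HB.instance Definition _ := gen_choiceMixin (fps K).

Lemma fpsP f g : coefs f =1 coefs g -> f = g.
Proof. by case: f g => [f] [g] /= /funext ->. Qed.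

Definition fpsC c : fps K := FPS (fun n => if n == 0%N then c else 0).
Definition fpsX : fps K := FPS (fun n => (n == 1%N)%:R).

Definition fps_add f g : fps K := FPS (fun n => coefs f n + coefs g n).
Definition fps_opp f : fps K := FPS (fun n => - coefs f n).
Definition fps_mul f g : fps K :=
  FPS (fun n => \sum_(i < n.+1) coefs f i * coefs g (n - i)%N).

Fact fps_addA : associative fps_add.
Proof. by move=> f g h; apply: fpsP => n /=; rewrite addrA. Qed.
Fact fps_addC : commutative fps_add.
Proof. by move=> f g; apply: fpsP => n /=; rewrite addrC. Qed.
Fact fps_add0 : left_id (fpsC 0) fps_add.
Proof. by move=> f; apply: fpsP => n /=; rewrite if_same add0r. Qed.
Fact fps_addN : left_inverse (fpsC 0) fps_opp fps_add.
Proof. by move=> f; apply: fpsP => n /=; rewrite if_same addNr. Qed.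

HB.instance Definition _ := GRing.isZmodule.Build (fps K)
  fps_addA fps_addC fps_add0 fps_addN.

Fact fps_mulC : commutative fps_mul.
Proof.
move=> f g; apply: fpsP => n /=; rewrite (reindex_inj rev_ord_inj) /=.
by apply: eq_bigr => i _; rewrite subSS subKn 1?mulrC // -ltnS.
Qed.

Fact fps_mulA : associative fps_mul.
Proof.
pose tr f n := \poly_(i < n.+1) coefs f i.
have trM f g n m : (m <= n)%N -> coefs (fps_mul f g) m = (tr f n * tr g n)`_m.
  move=> le_mn; rewrite coefM /=; apply: eq_bigr => i _.
  have le_im : (i <= m)%N by rewrite -ltnS.
  rewrite !coef_poly !ltnS (leq_trans le_im le_mn).
  by rewrite (leq_trans (leq_subr _ _) le_mn).
have trE f n m : (m <= n)%N -> coefs f m = (tr f n)`_m.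
  by move=> le_mn; rewrite coef_poly ltnS le_mn.
move=> f g h; apply: fpsP => n.
transitivity (tr f n * (tr g n * tr h n))`_n.
  rewrite coefM; apply: eq_bigr => i _.
  by rewrite -(trE f) -?(trM g h n) ?leq_subr // -ltnS.
rewrite mulrA coefM; apply: eq_bigr => i _.
by rewrite -(trE h) ?leq_subr // -(trM f g n) // -ltnS.
Qed.

Fact fps_mul1 : left_id (fpsC 1) fps_mul.
Proof.
move=> f; apply: fpsP => n /=.
by rewrite big_ord_recl /= mul1r subn0 big1 ?addr0 // => i _; rewrite mul0r.
Qed.

Fact fps_mulD : left_distributive fps_mul fps_add.
Proof.
move=> f g h; apply: fpsP => n /=; rewrite -big_split /=.
by apply: eq_bigr => i _; rewrite mulrDl.
Qed.

Fact fps_1_neq0 : fpsC 1 != 0 :> fps K.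
Proof.
by apply/eqP => /(congr1 (fun f => coefs f 0%N)) /eqP /=; rewrite oner_eq0.
Qed.

HB.instance Definition _ := GRing.Zmodule_isComNzRing.Build (fps K)
  fps_mulA fps_mulC fps_mul1 fps_mulD fps_1_neq0.

Lemma coefs_mul f g n :
  coefs (f * g) n = \sum_(i < n.+1) coefs f i * coefs g (n - i)%N.
Proof. by []. Qed.

(* [fps_rec step] is the series whose n-th coefficient is obtained by applying *)
(* [step] to the list of its coefficients of index less than n.                *)
Fixpoint rec_seq (step : seq K -> K) n : seq K :=
  if n is m.+1 then rcons (rec_seq step m) (step (rec_seq step m)) else [::].
Definition fps_rec (step : seq K -> K) : fps K :=
  FPS (fun n => step (rec_seq step n)).

Lemma fps_recE (step : seq K -> K) n :
  coefs (fps_rec step) n = step (mkseq (coefs (fps_rec step)) n).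
Proof.
suff e m : rec_seq step m = mkseq (coefs (fps_rec step)) m by rewrite /= e.
by elim: m => //= m IHm; rewrite mkseqS {1}IHm.
Qed.

Definition fps_unit : pred (fps K) := fun f => coefs f 0 != 0.
Definition fps_inv f : fps K :=
  if fps_unit f then
    fps_rec (fun s =>
      ((size s == 0%N)%:R - \sum_(i < size s) s`_i * coefs f (size s - i)%N)
      / coefs f 0)
  else f.

Fact fps_mulV : {in fps_unit, left_inverse 1 fps_inv *%R}.
Proof.
move=> f uf; rewrite /fps_inv [fps_unit f]uf; set g := fps_rec _.
have gE n : coefs g n =
    ((n == 0%N)%:R - \sum_(i < n) coefs g i * coefs f (n - i)%N) / coefs f 0.
  rewrite {1}/g fps_recE size_mkseq; congr ((_ - _) / _).
  by apply: eq_bigr => i _; rewrite nth_mkseq.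
move: g gE => g gE; apply: fpsP => n; rewrite coefs_mul big_ord_recr /= subnn.
by rewrite gE divfK // addrC subrK; case: n.
Qed.

Fact fps_unitP f g : g * f = 1 -> fps_unit f.
Proof.
move=> /(congr1 (fun h => coefs h 0%N)) /=.
rewrite big_ord1 subnn /fps_unit => e; apply/eqP => f0.
by move/eqP: e; rewrite f0 mulr0 eq_sym oner_eq0.
Qed.

Fact fps_inv_out : {in [predC fps_unit], fps_inv =1 id}.
Proof. by move=> f; rewrite !inE unfold_in /fps_inv /fps_unit => /negbTE ->. Qed.

HB.instance Definition _ := GRing.ComNzRing_hasMulInverse.Build (fps K)
  fps_mulV fps_unitP fps_inv_out.

(* exp(f) = sum_k f^k / k!. When f has no constant term, f^k has no            *)
(* coefficient of degree less than k, which makes the sum below finite;        *)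
(* meaningless when the constant term of f is not 0.                           *)
Definition fps_exp f : fps K :=
  FPS (fun n => \sum_(k < n.+1) coefs (f ^+ k) n / (k`!)%:R).

(* The square root with constant term 1 of a series with constant term 1,      *)
(* obtained by solving g ^+ 2 = f degree by degree (see [fps_sqrtK]).          *)
Definition fps_sqrt f : fps K :=
  fps_rec (fun s =>
    if size s == 0%N then 1
    else (coefs f (size s)
          - \sum_(1 <= i < size s) s`_i * s`_(size s - i)) / 2%:R).

Lemma fps_sqrt0 f : coefs (fps_sqrt f) 0 = 1.
Proof. by []. Qed.

Lemma fps_sqrtK f :
  2%:R != 0 :> K -> coefs f 0 = 1 -> fps_sqrt f ^+ 2 = f.
Proof.
move=> n20 f0; rewrite expr2; apply: fpsP => -[|n].
  by rewrite coefs_mul big_ord1 f0 subnn mulr1.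
have gE : coefs (fps_sqrt f) n.+1 *+ 2 = coefs f n.+1 -
    \sum_(1 <= i < n.+1) coefs (fps_sqrt f) i * coefs (fps_sqrt f) (n.+1 - i)%N.
  rewrite {1}/fps_sqrt fps_recE size_mkseq.
  have ite (a b : K) : (if n.+1 == 0%N then a else b) = b by [].
  rewrite (ite 1) -[LHS]mulr_natr divfK //.
  congr (_ - _); apply: eq_big_nat => i /andP[i0 ilt].
  by rewrite !nth_mkseq // ltn_subrL i0.
move: (fps_sqrt f) (fps_sqrt0 f) gE => g g0 gE; rewrite coefs_mul.
rewrite -(big_mkord xpredT (fun i => coefs g i * coefs g (n.+1 - i)%N)).
rewrite big_nat_recr //= big_ltn // subn0 subnn g0 mul1r mulr1.
by rewrite addrAC -mulr2n gE subrK.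
Qed.

End FormalPowerSeries.

Arguments fpsX {K}.
Notation "c %:S" := (fpsC c) (at level 1, left associativity, format "c %:S")
  : ring_scope.

Definition map_fps (K L : Type) (phi : K -> L) (f : fps K) : fps L :=
  FPS (fun n => phi (coefs f n)).

Section Independence.
Context d (T : measurableType d) (R : realType) (P : probability T R).

Definition independent_family (I : finType) (D : {set I})
    (X : I -> {RV P >-> R}) : Prop :=
  forall (S : {set I}) (A : I -> set R), S \subset D ->
    (forall i, measurable (A i)) ->
    P (\bigcap_(i in [set` S]) X i @^-1` A i)
    = (\prod_(i in S) P (X i @^-1` A i))%E.

Definition sigma_generated (I : finType) (D : {set I}) (X : I -> {RV P >-> R}) :
    set (set T) :=
  <<s \bigcup_(i in [set` D]) preimage_set_system setT (X i) measurable >>.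

Definition independent_sigma3 (F G H : set (set T)) : Prop :=
  forall A B C, F A -> G B -> H C ->
    P (A `&` B `&` C) = (P A * P B * P C)%E.

Definition has_law (X : {RV P >-> R}) (law : probability R R) : Prop :=
  forall A : set R, measurable A -> distribution P X A = law A.

End Independence.

Section Wigner.
Context d (T : measurableType d) (R : realType) (P : probability T R) (n : nat).

Definition upper : {set 'I_n * 'I_n} := [set p : 'I_n * 'I_n | (p.1 < p.2)%N].

(* [law_re] and [law_im] are the laws of the real and imaginary parts of the   *)
(* entries above the diagonal, [law_diag] that of the diagonal entries.        *)
Record wigner (law_re law_im law_diag : probability R R)
    (ZRe ZIm : 'I_n -> 'I_n -> {RV P >-> R}) : Prop := {
  wigner_law_re : forall j k : 'I_n, (j < k)%N -> has_law (ZRe j k) law_re;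
  wigner_law_im : forall j k : 'I_n, (j < k)%N -> has_law (ZIm j k) law_im;
  wigner_law_diag : forall j : 'I_n, has_law (ZRe j j) law_diag;
  wigner_indep_re : independent_family upper (fun p => ZRe p.1 p.2);
  wigner_indep_im : independent_family upper (fun p => ZIm p.1 p.2);
  wigner_indep_diag : independent_family [set: 'I_n]%SET (fun j => ZRe j j);
  wigner_indep : independent_sigma3 P
    (sigma_generated upper (fun p => ZRe p.1 p.2))
    (sigma_generated upper (fun p => ZIm p.1 p.2))
    (sigma_generated [set: 'I_n]%SET (fun j => ZRe j j));
  wigner_im_diag : forall (j : 'I_n) w, ZIm j j w = 0;
  wigner_re_sym : forall (j k : 'I_n) w, (k < j)%N -> ZRe j k w = ZRe k j w;
  wigner_im_sym : forall (j k : 'I_n) w, (k < j)%N -> ZIm j k w = - ZIm k j w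
}.

Definition entries_mx (ZRe ZIm : 'I_n -> 'I_n -> {RV P >-> R}) (w : T) :
    'M[R[i]]_n :=
  \matrix_(j, k) (ZRe j k w +i* ZIm j k w)%C.

Definition det_prod (ZRe ZIm : 'I_n -> 'I_n -> {RV P >-> R})
    (a1 a2 c1 c2 : R) (w : T) : R[i] :=
  let Z := entries_mx ZRe ZIm w in
  let J : 'M[R[i]]_n := const_mx 1 in
  \det (Z + a1%:C%C *: J + c1%:C%C *: 1%:M)
  * \det (Z + a2%:C%C *: J + c2%:C%C *: 1%:M).

Definition complex_integrable (f : T -> R[i]) : Prop :=
  P.-integrable setT (fun w => (complex.Re (f w))%:E) /\
  P.-integrable setT (fun w => (complex.Im (f w))%:E).

Definition complex_expectation (f : T -> R[i]) : R[i] :=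
  (fine 'E_P[fun w => complex.Re (f w)] +i*
   fine 'E_P[fun w => complex.Im (f w)])%C.

End Wigner.

Definition moment (R : realType) (law : probability R R) (q : nat) : R :=
  fine 'E_law[fun x : R => x ^+ q].

Definition finite_moment (R : realType) (law : probability R R) (q : nat) : Prop :=
  law.-integrable setT (fun x : R => (x ^+ q)%:E).

Definition H2 (R : realType) (d : nat -> measure_display)
    (T : forall n, measurableType (d n)) (P : forall n, probability (T n) R)
    (ZRe ZIm : forall n, 'I_n -> 'I_n -> {RV (P n) >-> R})
    (a1 a2 c1 c2 : R) : fps R[i] :=
  FPS (fun n =>
    complex_expectation (P n) (det_prod (ZRe n) (ZIm n) a1 a2 c1 c2)
    / (n`!)%:R).

(* Main.v *)
(* Expand E[det A det B] along the row and column of one index j: their entries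
   are independent of the rest, so only contractions with matching partners
   survive. Writing D_T for the principal minor of Z + c Id on T and D_T(i,j)
   for the (i,j) minor, the quantities E[D_T^2], E[D_T D_{T-j}],
   E[D_{T-j} D_{T-k}], E[D_T(i,j)^2] and E[D_T(i,j) D_T(j,i)] depend only on |T|
   and satisfy a closed system of recurrences. Since J has rank one,
   det (A + a J) = det A + a * (sum of the cofactors of A), which reduces
   general a1, a2 to these quantities together with the mixed ones, where a
   third moment joins a pair of indices. The exponential generating function of
   E[D_T^2] then solves a linear first order ODE, which Q solves too.

   Only moments of order at most 4 enter, so each law may be replaced by a signed
   measure on {0,...,4} with the same moments; the expansion is carried out in the
   resulting finite model, where independence is the factorisation of a finite
   sum. *)
Require Import Defs.
From HB Require Import structures.
From mathcomp Require Import all_boot all_order all_algebra.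
From mathcomp Require Import perm ring.

Set Implicit Arguments.
Unset Strict Implicit.
Unset Printing Implicit Defensive.

Import Order.TTheory GRing.Theory Num.Theory.
Local Open Scope ring_scope.

(** * Minors as determinants with unit rows *)

(** The recurrences are never solved forwards. The sequences are read off the closed forms, the
    closed forms are checked to satisfy the recurrences, and induction on the size of T identifies
    them with the expectations. The shift c is absorbed into the diagonal, whose entries then have
    mean c and second moment c^2 + kappa_2. For an off-diagonal entry z only d = E[z^2], s =
    E[|z|^2], E[z |z|^2] and E[|z|^4] enter. The third moment is mu_3 plus or minus i nu_3 according
    to the side of the diagonal; sums over cofactors pair (i,j) with (j,i), and nu_3 disappears. An
    off-diagonal variable occurs in two rows of each of the two determinants, a diagonal one in a
    single row of each: the degrees 4 and 2 are exactly the moments assumed finite, and five nodes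
    match them. Signed weights reduce the combinatorial side to algebra over a commutative ring;
    measure theory is confined to factorising the expectation of a monomial. *)

Section DeterminantRowReplacement.
Variables (K : comNzRingType) (n : nat).
Implicit Types (A : 'M[K]_n) (r : 'I_n -> option 'I_n).

(** The option-valued map records every deleted row together with the column it deletes, so iterated
    minors are updates by [set_row] and no index has to be re-embedded. *)
Definition replace_rows r A : 'M[K]_n :=
  \matrix_(a, b) if r a is Some k then (b == k)%:R else A a b.

Definition set_row r (i k : 'I_n) : 'I_n -> option 'I_n :=
  fun a => if a == i then Some k else r a.

Lemma eq_replace_rows r r' A :
  r =1 r' -> replace_rows r A = replace_rows r' A.
Proof. by move=> e; apply/matrixP => a b; rewrite !mxE e. Qed.

(** Expanding along the unit row i leaves a single term, the cofactor. *)
Lemma cofactor_replace_rows r A i k :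
  cofactor (replace_rows r A) i k = \det (replace_rows (set_row r i k) A).
Proof.
rewrite (expand_det_row _ i) (bigD1 k) //= big1 ?addr0; last first.
  by move=> j njk; rewrite mxE /set_row eqxx (negbTE njk) mul0r.
rewrite mxE /set_row !eqxx mul1r /cofactor; congr (_ * \det _).
by apply/matrixP => a b; rewrite !mxE eq_sym (negbTE (neq_lift _ _)).
Qed.

Lemma det_expand_row r A i : r i = None ->
  \det (replace_rows r A) =
  \sum_k A i k * \det (replace_rows (set_row r i k) A).
Proof.
move=> ri; rewrite (expand_det_row _ i); apply: eq_bigr => k _.
by rewrite cofactor_replace_rows mxE ri.
Qed.

Lemma det_expand_col r A j : (forall a, r a != Some j) ->
  \det (replace_rows r A) =
  \sum_(k | r k == None) A k j * \det (replace_rows (set_row r k j) A).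
Proof.
move=> rj; rewrite (expand_det_col _ j) (bigID (fun k => r k == None)) /=.
rewrite [X in _ + X]big1 ?addr0 => [|k].
  by apply: eq_bigr => k /eqP rk; rewrite cofactor_replace_rows mxE rk.
case rk: (r k) (rj k) => [l|] // nlj _; rewrite mxE rk.
by case: (eqVneq j l) nlj => [->|]; rewrite ?eqxx ?mul0r.
Qed.

Lemma prod_replace_rows_eq0 r A (s : 'S_n) i k :
  r i = Some k -> s i != k -> \prod_a replace_rows r A a (s a) = 0.
Proof. by move=> ri si; rewrite (bigD1 i) //= mxE ri (negbTE si) mul0r. Qed.

Lemma det_replace_rows_dup r A a b k :
  a != b -> r a = Some k -> r b = Some k -> \det (replace_rows r A) = 0.
Proof.
move=> nab ra rb; apply: (determinant_alternate nab) => l.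
by rewrite !mxE ra rb.
Qed.

Lemma det_replace_rows_swap r A a b x y :
  a != b -> r a = Some x -> r b = Some y ->
  \det (replace_rows r A) = - \det (replace_rows (set_row (set_row r a y) b x) A).
Proof.
move=> nab ra rb.
have -> : replace_rows (set_row (set_row r a y) b x) A
    = xrow a b (replace_rows r A).
  apply/matrixP => i j; rewrite !mxE /set_row; case: tpermP => [->|->|].
  - by rewrite (negbTE nab) eqxx rb.
  - by rewrite eqxx ra.
  - by move=> /eqP/negbTE -> /eqP/negbTE ->.
rewrite xrowE det_mulmx det_perm odd_tperm nab /= expr1 mulN1r.
by rewrite opprK.
Qed.

(** Only permutations compatible with every unit row contribute, and these never use, in another
    row, a column claimed by a unit row. The independence of a minor from a deleted row and column
    rests on this. *)
Lemma eq_det_replace_rows r A (B : 'M[K]_n) :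
  (forall a b, r a = None -> (forall i, r i != Some b) -> A a b = B a b) ->
  \det (replace_rows r A) = \det (replace_rows r B).
Proof.
move=> eqAB; apply: eq_bigr => s _; congr (_ * _).
have [/forallP sr|] := boolP [forall i, if r i is Some k then s i == k else true].
  apply: eq_bigr => a _; rewrite !mxE; case ra: (r a) => [//|].
  apply: eqAB => // i; apply/eqP => ri; move: (sr i); rewrite ri => /eqP.
  by move/perm_inj=> e; move: ri; rewrite e ra.
rewrite negb_forall => /existsP[i]; case ri: (r i) => [k|//] si.
by rewrite !(prod_replace_rows_eq0 _ ri si).
Qed.

(* The permutations through o either fix it or pass k -> o -> j; closing the
   latter to k -> j costs a sign. *)
Lemma det_expand_vertex r A o : r o = None -> (forall a, r a != Some o) ->
  let r' := set_row r o o in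
  \det (replace_rows r A) = A o o * \det (replace_rows r' A)
  - \sum_(j | j != o) \sum_(k | (k != o) && (r k == None))
      A o j * A k o * \det (replace_rows (set_row r' k j) A).
Proof.
move=> ro rNo r'; rewrite (det_expand_row _ ro) (bigD1 o) //=; congr (_ + _).
rewrite -sumrN; apply: eq_bigr => j njo.
have rj a : set_row r o j a != Some o.
  by rewrite /set_row; case: (a == o).
rewrite (det_expand_col A rj) mulr_sumr -sumrN; apply: eq_big => [k|k].
  by rewrite /set_row; case: (k == o).
rewrite {1}/set_row; have [//|nko _] := eqVneq k o.
rewrite -mulrN mulrA; congr (_ * _).
have rk : set_row (set_row r o j) k o k = Some o by rewrite /set_row eqxx.
have ro' : set_row (set_row r o j) k o o = Some j.
  by rewrite /set_row eq_sym (negbTE nko) eqxx.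
rewrite (det_replace_rows_swap A nko rk ro').
congr (- \det _); apply: eq_replace_rows => a; rewrite /r' /set_row.
have [->|nao] := eqVneq a o; first by rewrite eq_sym (negbTE nko).
by case: (a == k).
Qed.

End DeterminantRowReplacement.

(** * A finite product model *)

Section FiniteProductModel.
Variables (K : comNzRingType) (V O : finType) (w : V -> O -> K).
Hypothesis sum_w : forall v, \sum_o w v o = 1.
Implicit Types (f h : {ffun V -> O} -> K) (g : O -> K) (v : V).

(** The weights at each site sum to one but carry no sign condition: this is a linear functional
    with a product rule, not an integral. *)
Definition expect f : K := \sum_(om : {ffun V -> O}) (\prod_v w v (om v)) * f om.

Definition local_expect v g : K := \sum_o w v o * g o.

Definition free_of v h : Prop :=
  forall om om' : {ffun V -> O}, (forall u, u != v -> om u = om' u) -> h om = h om'.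

Lemma eq_expect f h : f =1 h -> expect f = expect h.
Proof. by move=> e; apply: eq_bigr => om _; rewrite e. Qed.

Lemma expectD f h : expect (fun om => f om + h om) = expect f + expect h.
Proof. by rewrite -big_split; apply: eq_bigr => om _; rewrite mulrDr. Qed.

Lemma expectZ a f : expect (fun om => a * f om) = a * expect f.
Proof. by rewrite mulr_sumr; apply: eq_bigr => om _; rewrite mulrCA. Qed.

Lemma expectN f : expect (fun om => - f om) = - expect f.
Proof. by rewrite -mulN1r -expectZ; apply: eq_expect => om; rewrite mulN1r. Qed.

Lemma expectB f h : expect (fun om => f om - h om) = expect f - expect h.
Proof. by rewrite expectD expectN. Qed.

Lemma expect0 : expect (fun=> 0) = 0.
Proof. by rewrite /expect big1 // => om _; rewrite mulr0. Qed.

Lemma expect_sum (I : finType) (Q : pred I) (F : I -> {ffun V -> O} -> K) :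
  expect (fun om => \sum_(i | Q i) F i om) = \sum_(i | Q i) expect (F i).
Proof.
by rewrite exchange_big; apply: eq_bigr => om _; rewrite mulr_sumr.
Qed.

Lemma expect_prod (F : V -> O -> K) :
  expect (fun om => \prod_v F v (om v)) = \prod_v local_expect v (F v).
Proof.
rewrite bigA_distr_bigA /=; apply: eq_bigr => om _.
by rewrite -big_split.
Qed.

Lemma expect1 : expect (fun=> 1) = 1.
Proof.
have := expect_prod (fun _ _ => 1); rewrite (@eq_expect _ (fun=> 1)) => [->|om].
  by rewrite big1 // => v _; rewrite -[RHS](sum_w v); apply: eq_bigr => o _; rewrite mulr1.
by rewrite big1.
Qed.

Definition resample v (p : {ffun V -> O} * O) : {ffun V -> O} * O :=
  ([ffun u => if u == v then p.2 else p.1 u], p.1 v).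

Lemma resampleK v : involutive (resample v).
Proof.
case=> om o; rewrite /resample /= ffunE eqxx; congr (_, _).
by apply/ffunP => u; rewrite !ffunE; case: eqVneq => [->|].
Qed.

(* Resampling the coordinate v exchanges it with an independent copy. *)
Lemma expect_peel v g h : free_of v h ->
  expect (fun om => g (om v) * h om) = local_expect v g * expect h.
Proof.
move=> hv; pose W (om : {ffun V -> O}) := \prod_u w u (om u).
transitivity (\sum_(p : {ffun V -> O} * O) W p.1 * w v p.2 * (g (p.1 v) * h p.1)).
  rewrite -(pair_bigA _ (fun om o => W om * w v o * (g (om v) * h om))) /=.
  by apply: eq_bigr => om _; rewrite -mulr_suml -mulr_sumr sum_w mulr1.
rewrite (reindex_inj (inv_inj (resampleK v))) -(pair_bigA _ (fun om o =>
  W (resample v (om, o)).1 * w v (om v) * (g ((resample v (om, o)).1 v)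
    * h (resample v (om, o)).1))) /=.
rewrite /expect mulr_sumr; apply: eq_bigr => om _; rewrite /local_expect mulr_suml.
apply: eq_bigr => o _; rewrite ffunE eqxx.
rewrite (hv _ om) => [|u /negbTE nuv]; last by rewrite ffunE nuv.
suff -> : W (resample v (om, o)).1 * w v (om v) = W om * w v o.
  by rewrite /W; ring.
rewrite /W (bigD1 v) //= [in RHS](bigD1 v) //= ffunE eqxx.
have -> : \prod_(u | u != v) w u ([ffun u => if u == v then o else om u] u)
    = \prod_(u | u != v) w u (om u).
  by apply: eq_bigr => u /negbTE nuv; rewrite ffunE nuv.
by ring.
Qed.

Lemma free_of_mul v f h : free_of v f -> free_of v h ->
  free_of v (fun om => f om * h om).
Proof. by move=> ff fh om om' e; rewrite (ff _ _ e) (fh _ _ e). Qed.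

End FiniteProductModel.

(** * Principal minors and cofactors under the addition of one index *)

Section MinorExpansion.
Variables (K : comNzRingType) (n : nat).
Implicit Types (A : 'M[K]_n) (S T : {set 'I_n}).

(* Minors keep the size of the full matrix: deleting the index a means replacing
   row a by the unit vector e_a, and the (i,k) cofactor is obtained by replacing
   row i by e_k. *)
Definition unit_outside S : 'I_n -> option 'I_n := fun a => if a \in S then None else Some a.

Definition pminor S A : K := \det (replace_rows (unit_outside S) A).
Definition minor1 S i k A : K := \det (replace_rows (set_row (unit_outside S) i k) A).

Lemma minor1_diag S i A : minor1 S i i A = pminor (S :\ i) A.
Proof.
congr (\det _); apply: eq_replace_rows => a; rewrite /set_row /unit_outside !inE.
by case: eqVneq => [->|].
Qed.

(** Rows i and k are both the unit vector e_k. *)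
Lemma minor1_out S i k A : i \in S -> k \notin S -> minor1 S i k A = 0.
Proof.
move=> iS kS; have nik : i != k by apply: contraNneq kS => <-.
apply: (det_replace_rows_dup A nik); rewrite /set_row ?eqxx //.
by rewrite eq_sym (negbTE nik) /unit_outside (negbTE kS).
Qed.

Lemma pminor_setT A : pminor [set: 'I_n] A = \det A.
Proof. by congr (\det _); apply/matrixP => a b; rewrite mxE /unit_outside inE. Qed.

Lemma pminor_set0 A : pminor set0 A = 1.
Proof.
rewrite -(det1 K n); congr (\det _); apply/matrixP => a b.
by rewrite !mxE /unit_outside inE eq_sym.
Qed.

Section AddVertex.
Variables (T : {set 'I_n}) (j : 'I_n).
Hypothesis jT : j \notin T.

Let neqj i : i \in T -> i != j.
Proof. by move=> iT; apply: contraNneq jT => <-. Qed.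

(** This is [det_expand_vertex] at j: a path l -> j -> k through the new index closes to l -> k,
    hence the (l,k) cofactor of T. Terms with k outside T vanish by [minor1_out]. *)
Lemma pminor_setU1 A : pminor (j |: T) A = A j j * pminor T A
  - \sum_(k in T) \sum_(l in T) A j k * A l j * minor1 T l k A.
Proof.
have r'E : set_row (unit_outside (j |: T)) j j =1 unit_outside T.
  move=> a; rewrite /set_row /unit_outside !inE.
  by case: eqVneq => [->|//]; rewrite (negbTE jT).
rewrite /pminor (@det_expand_vertex _ _ _ _ j) => [||a]; first last.
- by rewrite /unit_outside !inE; case: (eqVneq a j) => //= naj; case: (a \in T).
- by rewrite /unit_outside !inE eqxx.
rewrite (eq_replace_rows _ r'E); congr (_ - _).
rewrite (bigID (fun k => k \in T)) /= [X in _ + X]big1 ?addr0.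
  apply: eq_big => [k|k _].
    by case kT: (k \in T); rewrite ?andbF ?andbT ?(neqj kT).
  apply: eq_big => [l|l _].
    rewrite /unit_outside !inE; case: (eqVneq l j) => //= [->|_]; first by rewrite (negbTE jT).
    by case: (l \in T).
  congr (_ * \det _); apply: eq_replace_rows => a; rewrite /set_row.
  by case: eqP => // _; exact: r'E.
move=> k /andP[nkj nkT]; apply: big1 => l /andP[nlj /eqP rl].
have lT : l \in T.
  by move: rl; rewrite /unit_outside !inE (negbTE nlj) /=; case: (l \in T).
have e : set_row (set_row (unit_outside (j |: T)) j j) l k =1 set_row (unit_outside T) l k.
  by move=> a; rewrite {1 3}/set_row; case: eqP => // _; exact: r'E.
by rewrite (eq_replace_rows _ e) -/(minor1 T l k A) minor1_out ?mulr0.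
Qed.

(** Column j is already taken by row i, so row j is expanded; exchanging rows i and j restores e_j
    at j and produces the sign. *)
Lemma minor1_setU1_row i A : i \in T ->
  minor1 (j |: T) i j A = - \sum_(k in T) A j k * minor1 T i k A.
Proof.
move=> iT; have nij := neqj iT.
rewrite /minor1 (@det_expand_row _ _ _ _ j); last first.
  by rewrite /set_row eq_sym (negbTE nij) /unit_outside !inE eqxx.
have swap k : \det (replace_rows (set_row (set_row (unit_outside (j |: T)) i j) j k) A)
    = - minor1 T i k A.
  rewrite (@det_replace_rows_swap _ _ _ A i j j k) //; first last.
  - by rewrite /set_row eqxx.
  - by rewrite /set_row (negbTE nij) eqxx.
  congr (- \det _); apply: eq_replace_rows => a; rewrite /set_row /unit_outside !inE.
  have [->|naj] := eqVneq a j; first by rewrite eq_sym (negbTE nij) (negbTE jT).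
  by case: (a == i).
rewrite -sumrN (bigID (fun k => k \in T)) /= [X in _ + X]big1 ?addr0 => [|k kT].
  by apply: eq_bigr => k _; rewrite swap mulrN.
by rewrite swap minor1_out // oppr0 mulr0.
Qed.

Lemma minor1_setU1_col i A : i \in T ->
  minor1 (j |: T) j i A = - \sum_(k in T) A k j * minor1 T k i A.
Proof.
move=> iT; have nij := neqj iT.
rewrite /minor1 (@det_expand_col _ _ _ _ j); last first.
  move=> a; rewrite /set_row /unit_outside !inE; case: (eqVneq a j) => //= naj.
  by case: (a \in T).
rewrite -sumrN; apply: eq_big => [k|k].
  rewrite /set_row /unit_outside !inE; case: (eqVneq k j) => //= [->|_].
    by rewrite (negbTE jT).
  by case: (k \in T).
rewrite {1}/set_row /unit_outside !inE; have [//|nkj /= kT] := eqVneq k j.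
have {}kT : k \in T by move: kT; case: (k \in T).
rewrite (@det_replace_rows_swap _ _ _ A k j j i) //; first last.
- by rewrite /set_row eq_sym (negbTE nkj) eqxx.
- by rewrite /set_row eqxx.
rewrite mulrN; congr (- (_ * \det _)); apply: eq_replace_rows => a.
rewrite /set_row /unit_outside !inE.
have [->|naj] := eqVneq a j; first by rewrite eq_sym (negbTE nkj) (negbTE jT).
by case: (a == k).
Qed.

End AddVertex.

End MinorExpansion.

(* Both sides are the determinant of A bordered by a row of -a's and a column
   of 1's. *)
Lemma det_add_const (K : comNzRingType) n (A : 'M[K]_n) a :
  \det (A + a *: const_mx 1) =
  \det A + a * \sum_i \sum_j minor1 [set: 'I_n] i j A.
Proof.
pose row1 : 'M[K]_(1, n) := const_mx (- a).
pose col1 : 'M[K]_(n, 1) := const_mx 1.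
pose B : 'M[K]_(1 + n) := block_mx 1%:M row1 col1 A.
have <- : \det B = \det (A + a *: const_mx 1).
  (* Eliminating the border: B = L W with L unitriangular and A + a J as the lower right block of
     W. *)
  pose L : 'M[K]_(1 + n) := block_mx 1%:M 0 col1 1%:M.
  pose W : 'M[K]_(1 + n) := block_mx 1%:M row1 0 (A + a *: const_mx 1).
  transitivity (\det (L *m W)); last first.
    by rewrite det_mulmx det_lblock det_ublock !det1 !mul1r.
  rewrite mulmx_block !mul1mx !mul0mx !mulmx1 ?mulmx0 !addr0.
  congr (\det (block_mx _ _ _ _)).
  by apply/matrixP => i j; rewrite !mxE big_ord1 !mxE; ring.
have Bdr i j : B (rshift 1 i) (rshift 1 j) = A i j by rewrite block_mxEdr.
have Bur j : B (lshift n ord0) (rshift 1 j) = - a by rewrite block_mxEur mxE.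
have Bdl i : B (rshift 1 i) (lshift n ord0) = 1 by rewrite block_mxEdl mxE.
have Bul : B (lshift n ord0) (lshift n ord0) = 1 by rewrite block_mxEul mxE.
clearbody B.
pose r (_ : 'I_(1 + n)) : option 'I_(1 + n) := None.
pose o : 'I_(1 + n) := lshift n ord0.
have rshiftNo i : rshift 1 i != o by rewrite eq_rlshift.
have -> : B = replace_rows r B by apply/matrixP => i j; rewrite [RHS]mxE.
rewrite (@det_expand_vertex _ _ r B o) //.
have split_o (F : 'I_(1 + n) -> K) : \sum_(i | i != o) F i = \sum_i F (rshift 1 i).
  by rewrite big_split_ord /= big_ord1_cond eqxx add0r.
(* Once the border row is the unit vector e_o the matrix is block lower triangular, and only the
   lower right block matters. *)
have lower (r1 : 'I_(1 + n) -> option 'I_(1 + n)) (r2 : 'I_n -> option 'I_n) :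
    r1 o = Some o -> (forall i, r1 (rshift 1 i) = omap (@rshift 1 n) (r2 i)) ->
    \det (replace_rows r1 B) = \det (replace_rows r2 A).
  move=> r1o r12; rewrite -[RHS]mul1r -(det1 K 1).
  rewrite -(@det_lblock _ 1 n _ (dlsubmx (replace_rows r1 B))).
  rewrite -[LHS]/(\det (_ : 'M_(1 + n))) -{1}[replace_rows r1 B]submxK.
  congr (\det (block_mx _ _ _ _)); apply/matrixP => i j.
  - by rewrite !mxE [i]ord1 [j]ord1 r1o eqxx.
  - by rewrite !mxE [i]ord1 r1o.
  - rewrite !mxE r12; case: (r2 i) => [k|] /=; first by rewrite (inj_eq (@rshift_inj 1 n)).
    by rewrite Bdr.
rewrite (lower _ (unit_outside setT)) => [||i]; first last.
- by rewrite /set_row /unit_outside inE.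
- by rewrite /set_row eqxx.
rewrite -/(pminor _ _) pminor_setT.
rewrite Bul mul1r; congr (_ + _).
rewrite split_o [in RHS]exchange_big mulr_sumr -sumrN; apply: eq_bigr => j _.
rewrite (eq_bigl (fun k => k != o)) => [|k]; last by rewrite /r eqxx andbT.
rewrite split_o mulr_sumr -sumrN; apply: eq_bigr => i _.
rewrite Bur Bdl (lower _ (set_row (unit_outside setT) i j)) => [||k].
- by rewrite -/(minor1 _ _ _ _); ring.
- by rewrite /set_row.
- rewrite /set_row (inj_eq (@rshift_inj 1 n)); case: eqP => // _.
  by rewrite /unit_outside inE.
Qed.

(** * Expected products of minors of a Hermitian model *)

Section HermitianModel.
Variables (K : comNzRingType) (n : nat) (O : finType).
Variables (w : 'I_n * 'I_n -> O -> K) (z : 'I_n -> 'I_n -> O -> K).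
Implicit Types (om : {ffun 'I_n * 'I_n -> O}) (S T : {set 'I_n}).
Implicit Types (X Y : {ffun 'I_n * 'I_n -> O} -> K) (r : 'I_n -> option 'I_n).

(** The positions (j,k) and (k,j) share one coordinate, so mirrored entries are functions of the
    same sample. *)
Definition site (j k : 'I_n) : 'I_n * 'I_n := if (j <= k)%N then (j, k) else (k, j).

Definition model_mx om : 'M[K]_n := \matrix_(j, k) z j k (om (site j k)).

(** With z k j playing the conjugate of z j k, c and q are the mean and second moment of a diagonal
    entry, while d, s, zeta and m4 are the off-diagonal expectations of z^2, z zbar, z^2 zbar and
    z^2 zbar^2. No conjugation on K is required. *)
Variables (c q s d m4 : K) (zeta : 'I_n -> 'I_n -> K).
Hypothesis sum_w : forall v, \sum_o w v o = 1.
Let local j k := local_expect w (site j k).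
Hypothesis loc_diag : forall j, local j j (z j j) = c.
Hypothesis loc_diag2 : forall j, local j j (fun o => z j j o * z j j o) = q.
Hypothesis loc_z : forall j k, j != k -> local j k (z j k) = 0.
Hypothesis loc_zz : forall j k, j != k -> local j k (fun o => z j k o * z j k o) = d.
Hypothesis loc_zc : forall j k, j != k -> local j k (fun o => z j k o * z k j o) = s.
Hypothesis loc_zzc : forall j k, j != k ->
  local j k (fun o => z j k o * z j k o * z k j o) = zeta j k.
Hypothesis loc_zzcc : forall j k, j != k ->
  local j k (fun o => z j k o * z j k o * (z k j o * z k j o)) = m4.

Local Notation Z := model_mx.
Local Notation E := (expect w).

Lemma siteC j k : site j k = site k j.
Proof.
rewrite /site; case: ltngtP => //= jk; congr (_, _); apply/val_inj => //=.
Qed.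

Lemma site_inj j k l : site j k = site j l -> k = l.
Proof.
rewrite /site; case: (leqP j k) => jk; case: (leqP j l) => jl [] //.
- by move=> e1 e2; rewrite e2 -e1.
- by move=> e1 e2; rewrite e1 e2.
Qed.

Lemma site_eq a b j k : site a b = site j k ->
  (a = j /\ b = k) \/ (a = k /\ b = j).
Proof.
by rewrite /site; case: (leqP a b) => _; case: (leqP j k) => _ [-> ->]; auto.
Qed.

(** Independence from the whole row and column j, as insensitivity to each of their coordinates. *)
Definition free_star j X : Prop := forall k, free_of (site j k) X.

Lemma free_starM j X Y : free_star j X -> free_star j Y ->
  free_star j (fun om => X om * Y om).
Proof. by move=> fX fY k; apply: free_of_mul. Qed.

Lemma free_Z j k a b : site a b != site j k -> free_of (site j k) (fun om => Z om a b).
Proof. by move=> nab om om' e; rewrite !mxE e. Qed.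

Lemma free_Zr j k l : k != l -> free_of (site j k) (fun om => Z om j l).
Proof. by move=> nkl; apply: free_Z; apply: contraNneq nkl => /site_inj ->. Qed.

Lemma free_Zl j k l : k != l -> free_of (site j k) (fun om => Z om l j).
Proof.
by move=> nkl; apply: free_Z; rewrite siteC; apply: contraNneq nkl => /site_inj ->.
Qed.

(** Since row j is e_j, no entry of row j or of column j reaches the determinant. *)
Lemma free_star_det r j : r j = Some j ->
  free_star j (fun om => \det (replace_rows r (Z om))).
Proof.
move=> rj k om om' e; apply: eq_det_replace_rows => a b ra rb.
rewrite !mxE e //; apply/eqP => /site_eq[[aj _]|[_ bj]].
  by move: ra; rewrite aj rj.
by move: (rb j); rewrite rj bj eqxx.
Qed.

Lemma free_star_pminor T j : j \notin T -> free_star j (fun om => pminor T (Z om)).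
Proof. by move=> jT; apply: free_star_det; rewrite /unit_outside (negbTE jT). Qed.

Lemma free_star_minor1 T i k j : i \in T -> j \notin T ->
  free_star j (fun om => minor1 T i k (Z om)).
Proof.
move=> iT jT; apply: free_star_det; rewrite /set_row /unit_outside (negbTE jT).
by case: eqVneq => // e; rewrite e iT in jT.
Qed.

Lemma expect_row0 j k Y : j != k -> free_of (site j k) Y ->
  E (fun om => Z om j k * Y om) = 0.
Proof.
move=> njk fY; under eq_expect do rewrite mxE.
by rewrite (expect_peel sum_w (z j k) fY) [X in X * _]loc_z // mul0r.
Qed.

Lemma expect_col0 j k Y : j != k -> free_of (site j k) Y ->
  E (fun om => Z om k j * Y om) = 0.
Proof. by move=> njk; rewrite siteC; apply: expect_row0; rewrite eq_sym. Qed.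

Lemma expect_diag j X : free_star j X -> E (fun om => Z om j j * X om) = c * E X.
Proof.
move=> fX; under eq_expect do rewrite mxE.
by rewrite (expect_peel sum_w (z j j) (fX j)) [X in X * _]loc_diag.
Qed.

Lemma expect_diag2 j X : free_star j X ->
  E (fun om => Z om j j * Z om j j * X om) = q * E X.
Proof.
move=> fX; under eq_expect do rewrite mxE.
by rewrite (expect_peel sum_w (fun o => z j j o * z j j o) (fX j)) [X in X * _]loc_diag2.
Qed.

(** * Contractions of the entries in one row and column *)

Section Star.
Variables (j : 'I_n) (X : {ffun 'I_n * 'I_n -> O} -> K).
Hypothesis fX : free_star j X.

Lemma expect_rr k l : k != j -> l != j ->
  E (fun om => Z om j k * Z om j l * X om) = (k == l)%:R * d * E X.
Proof.
move=> nkj nlj; have [->|nkl] := eqVneq k l.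
  under eq_expect do rewrite mxE.
  rewrite (expect_peel sum_w (fun o => z j l o * z j l o) (@fX l)).
  rewrite [X in X * _]loc_zz ?mul1r //.
  by rewrite eq_sym.
under eq_expect do rewrite -mulrA.
rewrite expect_row0 ?mul0r // 1?eq_sym //.
by apply: free_of_mul => //; exact: free_Zr.
Qed.

Lemma expect_rc k l : k != j -> l != j ->
  E (fun om => Z om j k * Z om l j * X om) = (k == l)%:R * s * E X.
Proof.
move=> nkj nlj; have [->|nkl] := eqVneq k l.
  under eq_expect do rewrite !mxE (siteC l j).
  rewrite (expect_peel sum_w (fun o => z j l o * z l j o) (@fX l)).
  rewrite [X in X * _]loc_zc ?mul1r //.
  by rewrite eq_sym.
under eq_expect do rewrite -mulrA.
rewrite expect_row0 ?mul0r // 1?eq_sym //.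
by apply: free_of_mul => //; exact: free_Zl.
Qed.

Lemma expect_cc k l : k != j -> l != j ->
  E (fun om => Z om k j * Z om l j * X om) = (k == l)%:R * d * E X.
Proof.
move=> nkj nlj; have [->|nkl] := eqVneq k l.
  under eq_expect do rewrite !mxE siteC.
  rewrite (expect_peel sum_w (fun o => z l j o * z l j o) (@fX l)).
  by rewrite siteC [X in X * _]loc_zz ?mul1r.
under eq_expect do rewrite -mulrA.
rewrite expect_col0 ?mul0r // 1?eq_sym //.
by apply: free_of_mul => //; exact: free_Zl.
Qed.

Lemma expect_drc k l : k != j -> l != j ->
  E (fun om => Z om j j * (Z om j k * Z om l j) * X om) = (k == l)%:R * (c * s) * E X.
Proof.
move=> nkj nlj; have [->|nkl] := eqVneq k l.
  rewrite (@eq_expect _ _ _ _ _ (fun om => (fun o => z j l o * z l j o) (om (site j l))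
      * (Z om j j * X om))); last by move=> om; rewrite !mxE (siteC l j); ring.
  rewrite (expect_peel sum_w (fun o => z j l o * z l j o)); last first.
    by apply: free_of_mul => //; apply: free_Zr.
  rewrite [X in X * _]loc_zc 1?eq_sym // expect_diag // mul1r; ring.
rewrite (@eq_expect _ _ _ _ _ (fun om => Z om j k * (Z om j j * (Z om l j * X om))));
  last by move=> om; ring.
rewrite expect_row0 ?mul0r // 1?eq_sym //.
apply: free_of_mul; first exact: free_Zr.
by apply: free_of_mul => //; exact: free_Zl.
Qed.

Lemma expect_dr k : k != j -> E (fun om => Z om j j * Z om j k * X om) = 0.
Proof.
move=> nkj; under eq_expect do rewrite mulrAC mulrC.
by rewrite expect_row0 1?eq_sym //; apply: free_of_mul => //; exact: free_Zr.
Qed.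

Lemma expect_rcr k l p : k != j -> l != j -> p != j ->
  E (fun om => Z om j k * Z om l j * Z om j p * X om)
  = ((k == p) && (l == p))%:R * zeta j p * E X.
Proof.
move=> nkj nlj npj; have [->|nkp] := eqVneq k p.
  have [->|nlp] := eqVneq l p.
    rewrite (@eq_expect _ _ _ _ _ (fun om =>
      (fun o => z j p o * z j p o * z p j o) (om (site j p)) * X om)); last first.
      by move=> om; rewrite !mxE (siteC p j); ring.
    rewrite (expect_peel sum_w (fun o => z j p o * z j p o * z p j o) (@fX p)).
    by rewrite [X in X * _]loc_zzc ?mul1r 1?eq_sym.
  rewrite (@eq_expect _ _ _ _ _ (fun om => Z om l j * (Z om j p * (Z om j p * X om))));
      last by move=> om; ring.
  rewrite expect_col0 ?mul0r // 1?eq_sym //.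
  by do 2![apply: free_of_mul => //; first exact: free_Zr].
have [<-|nkl] := eqVneq k l.
  rewrite (@eq_expect _ _ _ _ _ (fun om => Z om j p * (Z om j k * (Z om k j * X om))));
      last by move=> om; ring.
  rewrite expect_row0 1?eq_sym ?(negbTE nkp) ?mul0r //.
  apply: free_of_mul; first by apply: free_Zr; rewrite eq_sym.
  by apply: free_of_mul => //; apply: free_Zl; rewrite eq_sym.
under eq_expect do rewrite -!mulrA.
rewrite expect_row0 ?mul0r // 1?eq_sym //.
apply: free_of_mul; first exact: free_Zl.
by apply: free_of_mul => //; exact: free_Zr.
Qed.

(** A partner of j occurring exactly once kills the term. What survives is all four partners equal
    (m4) or a pairing into two distinct partners: k = l, p = r and k = r, l = p pair an entry with
    its mirror (s^2), k = p, l = r pairs equal entries (d^2). *)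
Lemma expect_rcrc k l p (r : 'I_n) : k != j -> l != j -> p != j -> r != j ->
  E (fun om => Z om j k * Z om l j * (Z om j p * Z om r j) * X om)
  = (if k == l then (p == r)%:R * (if k == p then m4 else s ^+ 2)
     else ((k == p) && (l == r))%:R * d ^+ 2 + ((k == r) && (l == p))%:R * s ^+ 2) * E X.
Proof.
move=> nkj nlj npj nrj; have njk : j != k by rewrite eq_sym.
have fr x y : x != y -> free_of (site j x) (fun om => Z om j y) by exact: free_Zr.
have fc x y : x != y -> free_of (site j x) (fun om => Z om y j) by exact: free_Zl.
have [<-{l nlj}|nkl] := eqVneq k l.
  have [<-{p npj}|nkp] := eqVneq k p.
    have [<-{r nrj}|nkr] := eqVneq k r.
      rewrite (@eq_expect _ _ _ _ _ (fun om => (fun o => z j k o * z j k o *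
          (z k j o * z k j o)) (om (site j k)) * X om)); last first.
        by move=> om; rewrite !mxE (siteC k j) mulrACA.
      rewrite (expect_peel sum_w (fun o => z j k o * z j k o * (z k j o * z k j o)) (@fX k)).
      by rewrite [X in X * _]loc_zzcc ?mul1r.
    rewrite (@eq_expect _ _ _ _ _ (fun om =>
      Z om r j * (Z om j k * (Z om k j * (Z om j k * X om))))); last by move=> om; ring.
    rewrite expect_col0 ?mul0r // 1?eq_sym //.
    have nrk : r != k by rewrite eq_sym.
    by do ![apply: free_of_mul; first by (exact: fr || exact: fc)].
  have npk : p != k by rewrite eq_sym.
  have [<-{r nrj}|npr] := eqVneq p r.
    rewrite (@eq_expect _ _ _ _ _ (fun om => (fun o => z j k o * z k j o) (om (site j k))
        * (Z om j p * Z om p j * X om))); last first.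
      by move=> om; rewrite !mxE (siteC k j); ring.
    rewrite (expect_peel sum_w (fun o => z j k o * z k j o)); last first.
      apply: free_of_mul => //.
      by apply: free_of_mul; [exact: fr|exact: fc].
    by rewrite [X in X * _]loc_zc // expect_rc // eqxx !mul1r; ring.
  rewrite (@eq_expect _ _ _ _ _ (fun om =>
      Z om j p * (Z om j k * (Z om k j * (Z om r j * X om))))); last by move=> om; ring.
  rewrite expect_row0 ?mul0r // 1?eq_sym //.
  by do ![apply: free_of_mul; first by (exact: fr || exact: fc)].
have nlk : l != k by rewrite eq_sym.
have [<-{p npj}|nkp] := eqVneq k p.
  rewrite (negbTE nlk) andbF.
  have [<-{r nrj}|nlr] := eqVneq l r.
    rewrite (@eq_expect _ _ _ _ _ (fun om => (fun o => z j k o * z j k o) (om (site j k))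
        * (Z om l j * Z om l j * X om))); last first.
      by move=> om; rewrite !mxE; ring.
    rewrite (expect_peel sum_w (fun o => z j k o * z j k o)); last first.
      apply: free_of_mul => //.
      by apply: free_of_mul; exact: fc.
    by rewrite [X in X * _]loc_zz // expect_cc // eqxx /= ?mul0r ?mul1r; ring.
  rewrite (@eq_expect _ _ _ _ _ (fun om =>
      Z om l j * (Z om j k * (Z om r j * (Z om j k * X om))))); last by move=> om; ring.
  rewrite expect_col0 /= ?mul0r ?addr0 ?mul0r // 1?eq_sym //.
  by do ![apply: free_of_mul; first by (exact: fr || exact: fc)].
have [<-{r nrj}|nkr] := eqVneq k r.
  have [<-{p npj nkp}|nlp] := eqVneq l p.
    rewrite (@eq_expect _ _ _ _ _ (fun om => (fun o => z j k o * z k j o) (om (site j k))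
        * (Z om j l * Z om l j * X om))); last first.
      by move=> om; rewrite !mxE (siteC k j); ring.
    rewrite (expect_peel sum_w (fun o => z j k o * z k j o)); last first.
      apply: free_of_mul => //.
      by apply: free_of_mul; [exact: fr|exact: fc].
    by rewrite [X in X * _]loc_zc // expect_rc // eqxx /= ?mul0r ?mul1r; ring.
  rewrite (@eq_expect _ _ _ _ _ (fun om =>
      Z om l j * (Z om j k * (Z om k j * (Z om j p * X om))))); last by move=> om; ring.
  rewrite expect_col0 /= ?mul0r ?addr0 ?mul0r // 1?eq_sym //.
  by do ![apply: free_of_mul; first by (exact: fr || exact: fc)].
rewrite (@eq_expect _ _ _ _ _ (fun om =>
      Z om j k * (Z om l j * (Z om j p * (Z om r j * X om))))); last by move=> om; ring.
rewrite expect_row0 /= ?mul0r ?addr0 ?mul0r //.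
by do ![apply: free_of_mul; first by (exact: fr || exact: fc)].
Qed.

End Star.

Lemma expect_suml (I : finType) (A : {set I}) (F : I -> {ffun 'I_n * 'I_n -> O} -> K) Y :
  E (fun om => (\sum_(k in A) F k om) * Y om) = \sum_(k in A) E (fun om => F k om * Y om).
Proof. by rewrite -expect_sum; apply: eq_expect => om; rewrite mulr_suml. Qed.

Lemma expect_dsuml (A : {set 'I_n}) (F : 'I_n -> 'I_n -> {ffun 'I_n * 'I_n -> O} -> K) Y :
  E (fun om => (\sum_(k in A) \sum_(l in A) F k l om) * Y om)
  = \sum_(k in A) \sum_(l in A) E (fun om => F k l om * Y om).
Proof.
by rewrite expect_suml; apply: eq_bigr => k _; rewrite expect_suml.
Qed.

Lemma expectC X Y : E (fun om => X om * Y om) = E (fun om => Y om * X om).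
Proof. by apply: eq_expect => om; rewrite mulrC. Qed.

Let neqj T j i : j \notin T -> i \in T -> i != j.
Proof. by move=> jT iT; apply: contraNneq jT => <-. Qed.

Local Notation P T := (fun om => pminor T (Z om)).

(** Y and the minors on T ignore the star of j, so a path l -> j -> k survives only for l = k, with
    weight s, and leaves the minor on T without k. *)
Lemma expect_vertex T j Y : j \notin T -> free_star j Y ->
  E (fun om => pminor (j |: T) (Z om) * Y om) =
  c * E (fun om => pminor T (Z om) * Y om)
  - s * \sum_(k in T) E (fun om => pminor (T :\ k) (Z om) * Y om).
Proof.
move=> jT fY.
under eq_expect do rewrite pminor_setU1 // mulrBl -mulrA.
have fPY : free_star j (fun om => pminor T (Z om) * Y om).
  by apply: free_starM => //; exact: free_star_pminor.
rewrite expectB (expect_diag fPY) expect_dsuml; congr (_ - _).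
rewrite mulr_sumr; apply: eq_bigr => k kT.
rewrite (big_setD1 k) //= big1 ?addr0 => [|l].
  under eq_expect do rewrite -mulrA minor1_diag.
  rewrite (@expect_rc j (fun om => pminor (T :\ k) (Z om) * Y om)) ?(neqj jT) //.
    by rewrite eqxx mul1r.
  apply: free_starM => //; apply: free_star_pminor.
  by rewrite !inE negb_and jT orbT.
rewrite !inE => /andP[nlk lT].
under eq_expect do rewrite -mulrA.
rewrite (@expect_rc j (fun om => minor1 T l k (Z om) * Y om)) ?(neqj jT) //.
  by rewrite eq_sym (negbTE nlk) !mul0r.
by apply: free_starM => //; exact: free_star_minor1.
Qed.

(** Both cofactors are linear in row j, and two entries of one row contract only in the same column,
    with weight d. *)
Lemma expect_row_row T j i k : j \notin T -> i \in T -> k \in T ->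
  E (fun om => minor1 (j |: T) i j (Z om) * minor1 (j |: T) k j (Z om))
  = d * \sum_(p in T) E (fun om => minor1 T i p (Z om) * minor1 T k p (Z om)).
Proof.
move=> jT iT kT.
under eq_expect do rewrite !minor1_setU1_row // mulrNN.
rewrite expect_suml mulr_sumr; apply: eq_bigr => p pT.
rewrite expectC expect_suml (big_setD1 p) //= big1 ?addr0 => [|r].
  under eq_expect do rewrite mulrACA.
  rewrite (@expect_rr j (fun om => _ * _)) ?(neqj jT) //.
    by rewrite eqxx mul1r expectC.
  by apply: free_starM; apply: free_star_minor1.
rewrite !inE => /andP[nrp rT].
under eq_expect do rewrite mulrACA.
rewrite (@expect_rr j (fun om => _ * _)) ?(neqj jT) //.
  by rewrite (negbTE nrp) !mul0r.
by apply: free_starM; apply: free_star_minor1.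
Qed.

(** One factor is linear in row j and the other in column j, hence s in place of d. *)
Lemma expect_row_col T j i : j \notin T -> i \in T ->
  E (fun om => minor1 (j |: T) i j (Z om) * minor1 (j |: T) j i (Z om))
  = s * \sum_(p in T) E (fun om => minor1 T i p (Z om) * minor1 T p i (Z om)).
Proof.
move=> jT iT.
under eq_expect do rewrite minor1_setU1_row // minor1_setU1_col // mulrNN.
rewrite expect_suml mulr_sumr; apply: eq_bigr => p pT.
rewrite expectC expect_suml (big_setD1 p) //= big1 ?addr0 => [|r].
  under eq_expect do rewrite mulrC mulrACA.
  rewrite (@expect_rc j (fun om => _ * _)) ?(neqj jT) //.
    by rewrite eqxx mul1r.
  by apply: free_starM; apply: free_star_minor1.
rewrite !inE => /andP[nrp rT].
under eq_expect do rewrite mulrC mulrACA.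
rewrite (@expect_rc j (fun om => _ * _)) ?(neqj jT) //.
  by rewrite eq_sym (negbTE nrp) !mul0r.
by apply: free_starM; apply: free_star_minor1.
Qed.

(** Squaring the vertex expansion: the squared diagonal entry gives q, the two cross terms give c s,
    and the four-entry terms are the contractions of [expect_rcrc]. *)
Lemma expect_square T j : j \notin T ->
  E (fun om => pminor (j |: T) (Z om) * pminor (j |: T) (Z om)) =
  q * E (fun om => pminor T (Z om) * pminor T (Z om))
  - (c * s * \sum_(k in T) E (fun om => pminor T (Z om) * pminor (T :\ k) (Z om))) *+ 2
  + \sum_(k in T) (m4 * E (fun om => pminor (T :\ k) (Z om) * pminor (T :\ k) (Z om))
      + s ^+ 2 * \sum_(p in T :\ k)
          E (fun om => pminor (T :\ k) (Z om) * pminor (T :\ p) (Z om))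
      + \sum_(l in T :\ k)
        (d ^+ 2 * E (fun om => minor1 T l k (Z om) * minor1 T l k (Z om))
        + s ^+ 2 * E (fun om => minor1 T l k (Z om) * minor1 T k l (Z om)))).
Proof.
move=> jT; have nj := neqj jT; have fP := free_star_pminor jT.
have fm i k : i \in T -> free_star j (fun om => minor1 T i k (Z om)).
  by move=> iT; apply: free_star_minor1.
pose B om := \sum_(k in T) \sum_(l in T) Z om j k * Z om l j * minor1 T l k (Z om).
rewrite (@eq_expect _ _ _ _ _ (fun om =>
    Z om j j * Z om j j * (pminor T (Z om) * pminor T (Z om))
    - B om * (Z om j j * pminor T (Z om))
    - B om * (Z om j j * pminor T (Z om)) + B om * B om)); last first.
  by move=> om; rewrite pminor_setU1 // -/(B om); ring.
rewrite expectD !expectB expect_diag2; last exact: free_starM.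
have -> : E (fun om => B om * (Z om j j * pminor T (Z om)))
  = c * s * \sum_(k in T) E (fun om => pminor T (Z om) * pminor (T :\ k) (Z om)).
  rewrite expect_dsuml mulr_sumr; apply: eq_bigr => k kT.
  have e l :
      E (fun om => Z om j k * Z om l j * minor1 T l k (Z om) * (Z om j j * pminor T (Z om)))
      = E (fun om => Z om j j * (Z om j k * Z om l j)
          * (pminor T (Z om) * minor1 T l k (Z om))).
    by apply: eq_expect => om; ring.
  rewrite (big_setD1 k) //= big1 ?addr0 => [|l].
    rewrite e expect_drc ?nj ?eqxx ?mul1r //; last by apply: free_starM => //; exact: fm.
    by under eq_expect do rewrite minor1_diag.
  rewrite !inE => /andP[nlk lT].
  rewrite e expect_drc ?nj // 1?eq_sym ?(negbTE nlk) ?mul0r //.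
  by apply: free_starM => //; exact: fm.
rewrite mulr2n opprD !addrA; congr (_ + _).
rewrite expect_dsuml; apply: eq_bigr => k kT.
have e l : l \in T ->
    E (fun om => Z om j k * Z om l j * minor1 T l k (Z om) * B om)
  = \sum_(p in T) \sum_(r in T)
   ((if k == l then (p == r)%:R * (if k == p then m4 else s ^+ 2)
     else ((k == p) && (l == r))%:R * d ^+ 2 + ((k == r) && (l == p))%:R * s ^+ 2)
     * E (fun om => minor1 T l k (Z om) * minor1 T r p (Z om))).
  move=> lT; rewrite expectC expect_dsuml; apply: eq_bigr => p pT; apply: eq_bigr => r rT.
  rewrite -(@expect_rcrc j) ?nj //; last by apply: free_starM; apply: fm.
  by apply: eq_expect => om; ring.
(* The case l = k forces p = r; p = k gives m4 and every other p gives s^2. *)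
rewrite (big_setD1 k) //= e // eqxx; congr (_ + _).
  rewrite (big_setD1 k) //= (big_setD1 k) //= big1 => [|r]; last first.
    by rewrite !inE => /andP[nrk _]; rewrite eq_sym (negbTE nrk) !mul0r.
  rewrite addr0 !eqxx mul1r; congr (_ + _).
    by congr (_ * _); apply: eq_expect => om; rewrite minor1_diag.
  rewrite mulr_sumr; apply: eq_bigr => p; rewrite !inE => /andP[npk pT].
  rewrite (big_setD1 p) //= big1 => [|r]; last first.
    by rewrite !inE => /andP[nrp _]; rewrite eq_sym (negbTE nrp) !mul0r.
  rewrite addr0 eqxx mul1r eq_sym (negbTE npk).
  by congr (_ * _); apply: eq_expect => om; rewrite !minor1_diag.
apply: eq_bigr => l; rewrite !inE => /andP[nlk lT]; rewrite e // eq_sym (negbTE nlk).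
have nkl : k != l by rewrite eq_sym.
(* Kronecker deltas isolate the two survivors, (p,r) = (k,l) and (p,r) = (l,k). *)
have del (x y : 'I_n) (F : 'I_n -> 'I_n -> K) : x \in T -> y \in T ->
    \sum_(p in T) \sum_(r in T) ((x == p) && (y == r))%:R * F p r = F x y.
  move=> xT yT; rewrite (big_setD1 x) //= [X in _ + X]big1 ?addr0; last first.
    move=> p; rewrite !inE => /andP[npx _]; apply: big1 => r _.
    by rewrite eq_sym (negbTE npx) mul0r.
  rewrite (big_setD1 y) //= !eqxx mul1r big1 ?addr0 // => r.
  by rewrite !inE => /andP[nry _]; rewrite (eq_sym y) (negbTE nry) mul0r.
rewrite -(del k l (fun p (r : 'I_n) =>
  d ^+ 2 * E (fun om => minor1 T l k (Z om) * minor1 T r p (Z om)))) //.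
rewrite -(del l k (fun p (r : 'I_n) =>
  s ^+ 2 * E (fun om => minor1 T l k (Z om) * minor1 T r p (Z om)))) //.
rewrite -big_split; apply: eq_bigr => p _; rewrite -big_split; apply: eq_bigr => r _ /=.
by rewrite mulrDl !mulrA [(k == r) && _]andbC.
Qed.

(** Column k is deleted but row k is not: the cofactor is linear in row k, no other factor sees the
    star of k, and each term contains a lone entry of mean zero. *)
Lemma expect_minor1_isolated T k i Y : i \in T -> k \in T -> i != k -> free_star k Y ->
  E (fun om => Y om * minor1 T i k (Z om)) = 0.
Proof.
move=> iT kT nik fY; have kT' : k \notin T :\ k by rewrite !inE eqxx.
have iT' : i \in T :\ k by rewrite !inE nik.
have e om : Y om * minor1 T i k (Z om)
    = - ((\sum_(p in T :\ k) Z om k p * minor1 (T :\ k) i p (Z om)) * Y om).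
  by rewrite -{1}(setD1K kT) minor1_setU1_row // mulrN mulrC.
rewrite (eq_expect _ e).
rewrite expectN expect_suml big1 ?oppr0 // => p pT'.
under eq_expect do rewrite -mulrA.
rewrite expect_row0 //; first by rewrite eq_sym (neqj kT').
exact: free_starM (free_star_minor1 _ iT' kT') fY p.
Qed.

(** The cofactor supplies one entry of row j, the other determinant either the diagonal entry or one
    entry of row j and one of column j. Three entries survive only on a common partner p, with
    weight [zeta j p]; unless p = i, the index p is then isolated in [minor1 T i p]. *)
Lemma expect_triple T j i r : j \notin T -> i \in T ->
    r j = None -> (forall a, r a != Some j) ->
  E (fun om => \det (replace_rows r (Z om)) * minor1 (j |: T) i j (Z om))
  = if r i == None then zeta j i *
      E (fun om => \det (replace_rows (set_row (set_row r j j) i i) (Z om))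
        * pminor (T :\ i) (Z om)) else 0.
Proof.
move=> jT iT rj rNj; have nj := neqj jT.
have fm p : free_star j (fun om => minor1 T i p (Z om)) by exact: free_star_minor1.
pose r' := set_row r j j.
have fr' : free_star j (fun om => \det (replace_rows r' (Z om))).
  by apply: free_star_det; rewrite /r' /set_row eqxx.
have fr k l : k != j -> free_star j (fun om => \det (replace_rows (set_row r' k l) (Z om))).
  by move=> nkj; apply: free_star_det; rewrite /r' /set_row eqxx eq_sym (negbTE nkj).
pose B om := \sum_(p in T) Z om j p * minor1 T i p (Z om).
pose A om := \sum_(k | k != j) \sum_(l | (l != j) && (r l == None))
      Z om j k * Z om l j * \det (replace_rows (set_row r' l k) (Z om)).
rewrite (@eq_expect _ _ _ _ _ (fun om =>
  B om * A om - B om * (Z om j j * \det (replace_rows r' (Z om))))); last first.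
  move=> om; rewrite (det_expand_vertex _ rj rNj) minor1_setU1_row // -/(A om) -/(B om).
  by rewrite /r'; ring.
rewrite expectB [X in _ - X]expect_suml [X in _ - X]big1 => [|p pT]; last first.
  rewrite (@eq_expect _ _ _ _ _ (fun om => Z om j j * Z om j p *
    (minor1 T i p (Z om) * \det (replace_rows r' (Z om))))); last by move=> om; ring.
  by rewrite expect_dr ?nj //; apply: free_starM.
rewrite subr0 expect_suml.
have term p : p \in T -> E (fun om => Z om j p * minor1 T i p (Z om) * A om)
   = if r p == None then zeta j p *
       E (fun om => \det (replace_rows (set_row r' p p) (Z om)) * minor1 T i p (Z om)) else 0.
  move=> pT; rewrite expectC /A.
  under eq_expect do rewrite mulr_suml.
  rewrite expect_sum.
  have t k l : k != j -> l != j -> E (fun om => Z om j k * Z om l j *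
        \det (replace_rows (set_row r' l k) (Z om)) * (Z om j p * minor1 T i p (Z om)))
      = ((k == p) && (l == p))%:R * zeta j p * E (fun om =>
        \det (replace_rows (set_row r' l k) (Z om)) * minor1 T i p (Z om)).
    move=> nkj nlj; rewrite -(@expect_rcr j) ?(nj _ pT) //; last first.
      by apply: free_starM; [exact: fr|exact: fm].
    by apply: eq_expect => om; ring.
  rewrite (bigD1 p) ?(nj _ pT) //= [X in _ + X]big1 ?addr0; last first.
    move=> k /andP[nkj nkp]; under eq_expect do rewrite mulr_suml.
    rewrite expect_sum big1 // => l /andP[nlj _].
    by rewrite t // (negbTE nkp) !mul0r.
  under eq_expect do rewrite mulr_suml.
  rewrite expect_sum; case: ifP => rp; last first.
    apply: big1 => l /andP[nlj rl]; rewrite t ?(nj _ pT) // eqxx.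
    by case: (eqVneq l p) rl => [->|_ _]; rewrite ?rp // !mul0r.
  rewrite (bigD1 p) ?(nj _ pT) ?rp //= [X in _ + X]big1 ?addr0; last first.
    by move=> l /andP[/andP[nlj _] nlp]; rewrite t ?(nj _ pT) // (negbTE nlp) andbF !mul0r.
  by rewrite t ?(nj _ pT) // eqxx mul1r.
rewrite (big_setD1 i) //= big1 ?addr0 => [|p].
  rewrite term //; case: ifP => // _; congr (_ * _).
  by apply: eq_expect => om; rewrite minor1_diag.
rewrite !inE => /andP[npi pT]; rewrite term //; case: ifP => // _.
rewrite expect_minor1_isolated ?mulr0 // 1?eq_sym //.
by apply: free_star_det; rewrite /set_row eqxx.
Qed.

(** * Closed recurrences in the size of the minor *)

Section Recursion.
(* Values for |T| = m of E[D_T^2], E[D_T D_{T-j}], E[D_T(i,j)^2],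
   E[D_T(i,j) D_T(j,i)] and E[D_{T-j} D_{T-k}]; the values for m too small to
   choose the indices are always multiplied by 0. *)
Variables f U M N R : nat -> K.
Hypothesis f0 : f 0 = 1.
Hypothesis fS : forall m, f m.+1 = q * f m - (c * s * (m%:R * U m)) *+ 2
  + m%:R * (m4 * f m.-1 + s ^+ 2 * (m.-1%:R * R m)
            + m.-1%:R * (d ^+ 2 * M m + s ^+ 2 * N m)).
Hypothesis US : forall m, U m.+1 = c * f m - s * (m%:R * U m).
Hypothesis MS : forall m, M m.+2 = d * (f m + m%:R * M m.+1).
Hypothesis NS : forall m, N m.+2 = s * (f m + m%:R * N m.+1).
Hypothesis RS : forall m, R m.+2 =
  c * U m.+1 - s * (m%:R * (c * U m - s * (f m.-1 + m.-1%:R * R m))).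

Lemma sum_in_const T (x : K) (F : 'I_n -> K) :
  (forall k, k \in T -> F k = x) -> \sum_(k in T) F k = #|T|%:R * x.
Proof. by move=> e; rewrite (eq_bigr _ e) sumr_const mulr_natl. Qed.

Lemma cardsD1E T k : k \in T -> #|T :\ k| = #|T|.-1.
Proof. by move=> kT; rewrite (cardsD1 k T) kT. Qed.

Let cardT T k : k \in T -> #|T :\ k|.+1 = #|T|.
Proof. by move=> kT; rewrite (cardsD1 k T) kT. Qed.

(** The auxiliary families depend on squares of minors of bounded size only. Keeping the bound
    explicit lets them be used inside the induction that evaluates these squares, and again after
    it. *)
Section BoundedSize.
Variable b : nat.
Hypothesis fE : forall T, (#|T| <= b)%N ->
  E (fun om => pminor T (Z om) * pminor T (Z om)) = f #|T|.

Lemma expect_U T j : j \notin T -> (#|T| <= b)%N ->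
  E (fun om => pminor (j |: T) (Z om) * pminor T (Z om)) = U #|T|.+1.
Proof.
have [m] := ubnP #|T|; elim: m => // m IH in T j * => /ltnSE Tm jT Tb.
rewrite expect_vertex //; last exact: free_star_pminor.
rewrite fE // US (@sum_in_const T (U #|T|)) // => k kT.
have kT' : k \notin T :\ k by rewrite !inE eqxx.
have Tk : (#|T :\ k| <= b)%N by apply: leq_trans Tb; rewrite cardsD1E ?leq_pred.
by rewrite expectC -{1}(setD1K kT) IH ?cardT.
Qed.

Lemma expect_U' T k : k \in T -> (#|T| <= b.+1)%N ->
  E (fun om => pminor T (Z om) * pminor (T :\ k) (Z om)) = U #|T|.
Proof.
move=> kT Tb; have := @expect_U (T :\ k) k; rewrite setD1K // cardT // => -> //.
  by rewrite !inE eqxx.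
by rewrite -ltnS cardT.
Qed.

Lemma expect_M T i j : i \in T -> j \in T -> i != j -> (#|T| <= b.+2)%N ->
  E (fun om => minor1 T i j (Z om) * minor1 T i j (Z om)) = M #|T|.
Proof.
have [m] := ubnP #|T|; elim: m => // m IH in T i j * => /ltnSE Tm iT jT nij Tb.
have iT' : i \in T :\ j by rewrite !inE nij.
have jT' : j \notin T :\ j by rewrite !inE eqxx.
rewrite -{1 2}(setD1K jT) expect_row_row //.
rewrite (big_setD1 i) //= (@sum_in_const _ (M #|T :\ j|)) => [|k].
  rewrite -(cardT jT) -(cardT iT') MS.
  under eq_expect do rewrite !minor1_diag.
  rewrite fE //.
  by rewrite -ltnS cardT // -ltnS cardT.
rewrite [k \in _]inE [k \in [set _]]inE => /andP[nki kT]; apply: IH; rewrite // 1?eq_sym //.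
  by rewrite cardT.
by rewrite -ltnS cardT // (leq_trans Tb).
Qed.

Lemma expect_N T i j : i \in T -> j \in T -> i != j -> (#|T| <= b.+2)%N ->
  E (fun om => minor1 T i j (Z om) * minor1 T j i (Z om)) = N #|T|.
Proof.
have [m] := ubnP #|T|; elim: m => // m IH in T i j * => /ltnSE Tm iT jT nij Tb.
have iT' : i \in T :\ j by rewrite !inE nij.
have jT' : j \notin T :\ j by rewrite !inE eqxx.
rewrite -{1 2}(setD1K jT) expect_row_col //.
rewrite (big_setD1 i) //= (@sum_in_const _ (N #|T :\ j|)) => [|k].
  rewrite -(cardT jT) -(cardT iT') NS.
  under eq_expect do rewrite !minor1_diag.
  rewrite fE //.
  by rewrite -ltnS cardT // -ltnS cardT.
rewrite [k \in _]inE [k \in [set _]]inE => /andP[nki kT]; apply: IH; rewrite // 1?eq_sym //.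
  by rewrite cardT.
by rewrite -ltnS cardT // (leq_trans Tb).
Qed.

(** Both minors contain W, which is T without j and k. Expanding k in one factor and then j in the
    other returns to pairs of minors inside W. *)
Lemma expect_R T j k : j \in T -> k \in T -> j != k -> (#|T| <= b.+2)%N ->
  E (fun om => pminor (T :\ j) (Z om) * pminor (T :\ k) (Z om)) = R #|T|.
Proof.
have [m] := ubnP #|T|; elim: m => // m IH in T j k * => /ltnSE Tm jT kT njk Tb.
have kT' : k \in T :\ j by rewrite !inE eq_sym njk.
have jT' : j \in T :\ k by rewrite !inE njk.
pose W := T :\ j :\ k.
have WE : T :\ k :\ j = W by rewrite /W setDDl setUC -setDDl.
have Wcard : #|T| = #|W|.+2 by rewrite /W !cardT.
have Wb : (#|W| <= b)%N by rewrite -2!ltnS -Wcard.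
have kW : k \notin W by rewrite !inE eqxx.
have jW : j \notin W by rewrite !inE eqxx andbF.
rewrite -(setD1K kT') -(setD1K jT') -/W WE Wcard RS.
have fk : free_star k (fun om => pminor (j |: W) (Z om)).
  by apply: free_star_pminor; rewrite -WE setD1K // !inE eqxx.
rewrite expect_vertex // expectC expect_U //; congr (_ - _ * _).
apply: sum_in_const => l lW; rewrite expectC.
have jWl : j \notin W :\ l by rewrite in_setD1 negb_and jW orbT.
rewrite expect_vertex //; last exact: free_star_pminor.
rewrite expect_U' // ?(leq_trans Wb) //; congr (_ - _ * _).
rewrite (big_setD1 l) //= fE; last by rewrite (cardsD1E lW) (leq_trans (leq_pred _)).
rewrite (cardsD1E lW) (@sum_in_const _ (R #|W|)) ?(cardsD1E lW) // => r.
rewrite in_setD1 => /andP[nrl rW]; apply: IH => //; last by rewrite (leq_trans Wb) // ltnW.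
by rewrite (leq_trans _ Tm) // Wcard.
Qed.

End BoundedSize.

(** Strong induction: at size m+1 the recurrence calls the auxiliary families at size m, which rest
    on squares of minors of size at most m. *)
Lemma expect_pminor_sqr T :
  E (fun om => pminor T (Z om) * pminor T (Z om)) = f #|T|.
Proof.
have [m] := ubnP #|T|; elim: m => // m IH in T * => /ltnSE Tm.
have [->|[j jT]] := set_0Vmem T.
  rewrite cards0 f0; under eq_expect do rewrite !pminor_set0 mulr1.
  exact: expect1.
case: m => [|m] in IH Tm.
  by move: Tm; rewrite leqn0 cards_eq0 => /eqP T0; rewrite T0 inE in jT.
have {}IH (V : {set 'I_n}) : (#|V| <= m)%N ->
    E (fun om => pminor V (Z om) * pminor V (Z om)) = f #|V|.
  by move=> Vm; apply: IH.
pose V := T :\ j; have jV : j \notin V by rewrite !inE eqxx.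
have Vm : (#|V| <= m)%N by rewrite -ltnS cardT.
have m1 : (m <= m.+1)%N by []. have m2 : (m <= m.+2)%N by apply: leq_trans m1 _.
have <- : j |: V = T by exact: setD1K.
clearbody V; rewrite expect_square // cardsU1 jV fS IH //; congr (_ - _ *+ 2 + _).
  by congr (_ * _); apply: sum_in_const => k kV; rewrite (expect_U' IH) // (leq_trans Vm).
apply: sum_in_const => k kV.
rewrite IH (cardsD1E kV) ?(leq_trans (leq_pred _)) //; congr (_ + _ * _ + _).
  rewrite -(cardsD1E kV); apply: sum_in_const => p; rewrite !inE => /andP[npk pV].
  by rewrite (expect_R IH) // 1?eq_sym // (leq_trans Vm).
rewrite -(cardsD1E kV); apply: sum_in_const => l; rewrite !inE => /andP[nlk lV].
by rewrite (expect_M IH) ?(expect_N IH) ?(leq_trans Vm).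
Qed.

(** The hypothesis of the bounded section, now available for every bound. *)
Let fE b (V : {set 'I_n}) (_ : (#|V| <= b)%N) := expect_pminor_sqr V.

(** Expanding row j in both factors gives a common new column p. If p is i or k, one factor becomes
    principal and p is isolated in the other; otherwise the same pattern recurs on a smaller set. *)
Lemma expect_same_col T i k j : i \in T -> k \in T -> j \in T ->
    i != j -> k != j -> i != k ->
  E (fun om => minor1 T i j (Z om) * minor1 T k j (Z om)) = 0.
Proof.
have [m] := ubnP #|T|; elim: m => // m IH in T j * => /ltnSE Tm iT kT jT nij nkj nik.
have iT' : i \in T :\ j by rewrite !inE nij.
have kT' : k \in T :\ j by rewrite !inE nkj.
have jT' : j \notin T :\ j by rewrite !inE eqxx.
have nki : k != i by rewrite eq_sym.
rewrite -(setD1K jT) expect_row_row // big1 ?mulr0 // => p pT'.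
have [->|npi] := eqVneq p i.
  under eq_expect do rewrite minor1_diag.
  by apply: expect_minor1_isolated => //; apply: free_star_pminor; rewrite !inE eqxx.
have [->|npk] := eqVneq p k.
  rewrite expectC; under eq_expect do rewrite minor1_diag.
  by apply: expect_minor1_isolated => //; apply: free_star_pminor; rewrite !inE eqxx.
by apply: IH; rewrite // 1?eq_sym // cardT.
Qed.

(** The column j is deleted in one factor only, so by [expect_triple] a third moment must join j to
    i; this fails when i is already a deleted row or column of the other factor. *)
Lemma expect_two_minors T i j k l : i \in T -> j \in T -> k \in T -> l \in T ->
    i != j -> k != l -> j != k -> j != l ->
  E (fun om => minor1 T k l (Z om) * minor1 T i j (Z om)) =
  if (i == k) || (i == l) then 0 else
  zeta j i * E (fun om => minor1 (T :\ j :\ i) k l (Z om) * pminor (T :\ j :\ i) (Z om)).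
Proof.
move=> iT jT kT lT nij nkl njk njl.
have iT' : i \in T :\ j by rewrite !inE nij.
have jT' : j \notin T :\ j by rewrite !inE eqxx.
rewrite -{1 2}(setD1K jT) expect_triple //; first last.
- move=> a; rewrite /set_row; case: (a == k).
    by rewrite eq_sym; apply/eqP => -[/eqP]; rewrite (negbTE njl).
  rewrite /unit_outside setD1K //; case: ifP => // aT; apply/eqP => -[aj].
  by rewrite aj jT in aT.
- by rewrite /set_row (negbTE njk) /unit_outside setD1K // jT.
have [->|nik] /= := eqVneq i k; first by rewrite /set_row eqxx.
rewrite {1}/set_row (negbTE nik) /unit_outside setD1K // iT /=.
have [->|nil] /= := eqVneq i l.
  rewrite (@eq_expect _ _ _ _ _ (fun=> 0)) ?expect0 ?mulr0 // => om.
  rewrite (@det_replace_rows_dup _ _ _ _ k l l) ?mul0r // /set_row ?eqxx //.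
  by rewrite (negbTE nkl) eq_sym (negbTE njk).
congr (_ * _); apply: eq_expect => om; congr (\det _ * _); apply: eq_replace_rows => a.
rewrite /set_row /unit_outside !inE.
have [->|nai] := eqVneq a i; first by rewrite (negbTE nik).
by have [->|naj] := eqVneq a j; first rewrite (negbTE njk).
Qed.

Lemma expect_W T i j : i \in T -> j \in T -> i != j ->
  E (fun om => pminor T (Z om) * minor1 T i j (Z om)) = zeta j i * f #|T|.-2.
Proof.
move=> iT jT nij.
have iT' : i \in T :\ j by rewrite !inE nij.
have jT' : j \notin T :\ j by rewrite !inE eqxx.
rewrite -{1 2}(setD1K jT) expect_triple // /unit_outside ?setD1K ?jT // => [|a]; last first.
  by case: ifP => // aT; apply/eqP => -[aj]; rewrite aj jT in aT.
rewrite iT eqxx -(cardsD1E jT) -(cardsD1E iT') -expect_pminor_sqr.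
congr (_ * _); apply: eq_expect => om; congr (\det _ * _); apply: eq_replace_rows => a.
rewrite /set_row /unit_outside !inE.
have [->|nai] := eqVneq a i => //.
by have [->|naj] := eqVneq a j.
Qed.

(** If a = j, the index j is isolated. Otherwise [expect_triple] joins j to i, which requires i to
    be present in T without a, and both indices are removed from both factors. *)
Lemma expect_Y T a i j : a \in T -> i \in T -> j \in T -> i != j ->
  E (fun om => pminor (T :\ a) (Z om) * minor1 T i j (Z om)) =
  if (a == i) || (a == j) then 0 else zeta j i * U #|T|.-2.
Proof.
move=> aT iT jT nij.
have iT' : i \in T :\ j by rewrite !inE nij.
have jT' : j \notin T :\ j by rewrite !inE eqxx.
have [->|naj] := eqVneq a j.
  rewrite orbT expect_minor1_isolated //.
  by apply: free_star_pminor; rewrite !inE eqxx.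
have jTa : j \in T :\ a by rewrite !inE eq_sym naj.
rewrite orbF -{2}(setD1K jT) expect_triple //; first last.
- move=> b; rewrite /unit_outside; case: (eqVneq b j) => [->|nbj]; first by rewrite jTa.
  by case: ifP => // _; apply/eqP => -[] /eqP; rewrite (negbTE nbj).
- by rewrite /unit_outside jTa.
rewrite {1}/unit_outside in_setD1 iT andbT [i == a]eq_sym; have [->//|nai] := eqVneq a i.
have aT' : a \in T :\ j :\ i by rewrite !inE nai naj.
rewrite /= -(cardsD1E jT) -(cardsD1E iT') -(expect_U' (b := #|T|) (@fE _) aT').
  rewrite expectC; congr (_ * _); apply: eq_expect => om; congr (\det _ * _).
  apply: eq_replace_rows => b.
  rewrite /set_row /unit_outside !inE.
  have [->|nbi] := eqVneq b i; first by rewrite andbF.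
  have [->|nbj] := eqVneq b j; first by rewrite andbF.
  by [].
by rewrite (leq_trans _ (leqnSn _)) // subset_leq_card // !(subset_trans (subD1set _ _)).
Qed.

(** * Sums over all cofactors and pairs of cofactors *)

Section Totals.
Variable mu3 : K.
Hypothesis double_inj : injective (fun x : K => x *+ 2).
Hypothesis zeta_sym : forall i j, i != j -> zeta i j + zeta j i = mu3 *+ 2.

Lemma exchange_offdiag (A : {set 'I_n}) (F : 'I_n -> 'I_n -> K) :
  \sum_(i in A) \sum_(j in A :\ i) F i j = \sum_(j in A) \sum_(i in A :\ j) F i j.
Proof.
rewrite (exchange_big_dep (mem A)) /= => [|i j _]; last by rewrite inE => /andP[].
apply: eq_bigr => j jA; apply: eq_bigl => i.
by rewrite !inE jA andbT eq_sym andbC.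
Qed.

(* Swapping i and j kills the antisymmetric part of zeta, that is nu_3. *)
Lemma sum_zeta (A : {set 'I_n}) :
  \sum_(i in A) \sum_(j in A :\ i) zeta j i = (#|A| * #|A|.-1)%:R * mu3.
Proof.
apply: double_inj; rewrite mulr2n {1}exchange_offdiag -big_split /=.
rewrite (@sum_in_const _ (#|A|.-1%:R * (mu3 *+ 2))) => [|i iA].
  by rewrite mulrA -natrM mulrnAr.
rewrite -big_split /= (@sum_in_const _ (mu3 *+ 2)) ?cardsD1E // => j.
by rewrite !inE => /andP[nji _]; rewrite zeta_sym // eq_sym.
Qed.

Lemma sum_diag_offdiag (A : {set 'I_n}) (F : 'I_n -> 'I_n -> K) :
  \sum_(i in A) \sum_(j in A) F i j
  = \sum_(i in A) F i i + \sum_(i in A) \sum_(j in A :\ i) F i j.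
Proof. by rewrite -big_split; apply: eq_bigr => i iA; rewrite (big_setD1 i). Qed.

Local Notation sub2 m := (m.-1.-1).

(** Diagonal cofactors are principal minors and give U; off-diagonal ones contribute through the
    third moment alone. *)
Lemma total_linear T :
  \sum_(i in T) \sum_(j in T) E (fun om => pminor T (Z om) * minor1 T i j (Z om))
  = #|T|%:R * U #|T| + (#|T| * #|T|.-1)%:R * (mu3 * f (sub2 #|T|)).
Proof.
rewrite sum_diag_offdiag; congr (_ + _).
  apply: sum_in_const => i iT; under eq_expect do rewrite minor1_diag.
  by rewrite (expect_U' (b := #|T|) (@fE _)).
rewrite mulrA -sum_zeta mulr_suml; apply: eq_bigr => i iT.
rewrite mulr_suml; apply: eq_bigr => j; rewrite !inE => /andP[nji jT].
by rewrite expect_W // eq_sym.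
Qed.

Lemma total_cross T :
  \sum_(a in T) \sum_(i in T) \sum_(j in T :\ i)
     E (fun om => pminor (T :\ a) (Z om) * minor1 T i j (Z om))
  = (#|T| * #|T|.-1)%:R * (mu3 * ((sub2 #|T|)%:R * U (sub2 #|T|))).
Proof.
rewrite exchange_big /= mulrA -sum_zeta mulr_suml; apply: eq_bigr => i iT.
rewrite exchange_big /= mulr_suml; apply: eq_bigr => j; rewrite inE => /andP[nji jT].
have nij : i != j by rewrite eq_sym; move: nji; rewrite inE.
have jT' : j \in T :\ i by rewrite inE nji.
rewrite (big_setD1 i) //= (big_setD1 j) //= !expect_Y // !eqxx orbT !add0r.
rewrite (@sum_in_const _ (zeta j i * U (sub2 #|T|))) => [|a].
  by rewrite cardsD1E // cardsD1E // mulrCA.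
rewrite !in_setD1 => /and3P[naj nai aT].
by rewrite expect_Y // (negbTE naj) (negbTE nai).
Qed.

(** Against a fixed off-diagonal cofactor (i,j), the survivors are (i,j) itself, giving M, its
    mirror (j,i), giving N, and the pairs disjoint from i and j, each of which carries two third
    moments. *)
Lemma total_offdiag T i j : i \in T -> j \in T -> i != j ->
  \sum_(k in T) \sum_(l in T :\ k)
     E (fun om => minor1 T i j (Z om) * minor1 T k l (Z om))
  = M #|T| + N #|T| + zeta j i *
    ((sub2 #|T| * (sub2 #|T|).-1)%:R * (mu3 * f (sub2 (sub2 #|T|)))).
Proof.
move=> iT jT nij; have nji : j != i by rewrite eq_sym.
have iT' : i \in T :\ j by rewrite !inE nij.
have jT' : j \in T :\ i by rewrite !inE nji.
pose W := T :\ i :\ j.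
have WE : T :\ j :\ i = W by rewrite /W !setDDl setUC.
have Wcard : #|W| = sub2 #|T| by rewrite /W !cardsD1E.
(* A tuple of facts, serving as a rewriting multirule. *)
have WT k : k \in W -> ((k != j) * (j != k) * (k != i) * (i != k)) * (k \in T).
  by rewrite !in_setD1 => /and3P[nkj nki ->]; rewrite nkj nki eq_sym nkj eq_sym nki.
rewrite (big_setD1 i) //= (big_setD1 j jT') /= (expect_M (@fE #|T|)) //; last exact: ltnW.
rewrite big1 ?addr0 => [|l lW]; last first.
  by rewrite expectC expect_two_minors ?(WT _ lW) // eqxx.
rewrite -addrA; congr (_ + _).
rewrite (big_setD1 j) //= (big_setD1 i iT') /= (expect_N (@fE #|T|)) //; last exact: ltnW.
rewrite WE big1 ?addr0 => [|l lW]; last first.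
  by rewrite expect_two_minors ?(WT _ lW) // eqxx orbT.
congr (_ + _); rewrite -Wcard (mulrA _%:R) -sum_zeta mulr_suml mulr_sumr.
apply: eq_bigr => k kW.
have ik : i \in T :\ k by rewrite !inE (WT _ kW).
have jk : j \in T :\ k :\ i by rewrite !inE nji (WT _ kW).
rewrite (big_setD1 i) //= (big_setD1 j) //=.
rewrite expectC expect_two_minors ?(WT _ kW) // eqxx orbT add0r.
rewrite expect_same_col ?(WT _ kW) // add0r.
rewrite mulr_suml mulr_sumr; apply: eq_big => [l|l].
  by rewrite !in_setD1; case: (l == k); case: (l == i); case: (l == j).
rewrite !in_setD1 => /and4P[nlj nli nlk lT].
have lW : l \in W by rewrite !in_setD1 nlj nli.
have nkl : k != l by rewrite eq_sym.
rewrite expectC expect_two_minors ?(WT _ kW) ?(WT _ lW) //.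
rewrite !(negbTE (WT _ kW).1.2) (negbTE (WT _ lW).1.2) /= WE.
by rewrite expectC expect_W // mulrA.
Qed.

(** Pairs of diagonal cofactors give f or R as the indices agree or not, a diagonal with an
    off-diagonal one gives the single mu3 term twice, and pairs of off-diagonal ones give
    [total_offdiag]. *)
Lemma total_quadratic T (m := #|T|) :
  \sum_(i in T) \sum_(j in T) \sum_(k in T) \sum_(l in T)
     E (fun om => minor1 T i j (Z om) * minor1 T k l (Z om))
  = m%:R * f m.-1 + (m * m.-1)%:R * R m
    + (m * m.-1)%:R * (mu3 * ((sub2 m)%:R * U (sub2 m))) *+ 2
    + (m * m.-1)%:R * (M m + N m)
    + (m * m.-1)%:R * (mu3 * ((sub2 m * (sub2 m).-1)%:R * (mu3 * f (sub2 (sub2 m))))).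
Proof.
rewrite sum_diag_offdiag.
have -> : \sum_(i in T) \sum_(k in T) \sum_(l in T)
     E (fun om => minor1 T i i (Z om) * minor1 T k l (Z om))
  = m%:R * f m.-1 + (m * m.-1)%:R * R m
    + (m * m.-1)%:R * (mu3 * ((sub2 m)%:R * U (sub2 m))).
  rewrite -total_cross natrM -mulrA -mulrDr.
  rewrite -(@sum_in_const T _ (fun i => f m.-1 + m.-1%:R * R m)) // -big_split.
  apply: eq_bigr => i iT; rewrite sum_diag_offdiag /=; congr (_ + _).
    rewrite (big_setD1 i) //=; congr (_ + _).
      under eq_expect do rewrite !minor1_diag.
      by rewrite (@fE #|T|) cardsD1E // leq_pred.
    rewrite /m -(cardsD1E iT); apply: sum_in_const => k; rewrite !inE => /andP[nki kT].
    under eq_expect do rewrite !minor1_diag.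
    by rewrite (expect_R (@fE #|T|)) // 1?eq_sym // ltnW.
  apply: eq_bigr => k kT; apply: eq_bigr => l lT.
  by under eq_expect do rewrite minor1_diag.
have -> : \sum_(i in T) \sum_(j in T :\ i) \sum_(k in T) \sum_(l in T)
     E (fun om => minor1 T i j (Z om) * minor1 T k l (Z om))
  = (m * m.-1)%:R * (mu3 * ((sub2 m)%:R * U (sub2 m)))
    + (m * m.-1)%:R * (M m + N m)
    + (m * m.-1)%:R * (mu3 * ((sub2 m * (sub2 m).-1)%:R * (mu3 * f (sub2 (sub2 m))))).
  set C := (_ * (mu3 * f _)).
  pose Y i j a := E (fun om => pminor (T :\ a) (Z om) * minor1 T i j (Z om)).
  transitivity (\sum_(i in T) \sum_(j in T :\ i)
      (\sum_(a in T) Y i j a + (M m + N m + zeta j i * C))).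
    apply: eq_bigr => i iT; apply: eq_bigr => j; rewrite in_setD1 => /andP[nji jT].
    rewrite sum_diag_offdiag total_offdiag // 1?eq_sym //; congr (_ + _).
    by apply: eq_bigr => a aT; rewrite /Y expectC; under eq_expect do rewrite minor1_diag.
  under eq_bigr do rewrite big_split /= big_split /=.
  rewrite big_split big_split /= !addrA; congr (_ + _ + _).
  - rewrite -total_cross [RHS]exchange_big /=; apply: eq_bigr => i iT.
    by rewrite exchange_big.
  - rewrite natrM -mulrA; apply: sum_in_const => i iT.
    by rewrite /m -(cardsD1E iT); apply: sum_in_const.
  - rewrite [in RHS]mulrA -sum_zeta mulr_suml; apply: eq_bigr => i _.
    by rewrite mulr_suml.
by rewrite mulr2n !addrA.
Qed.

Lemma expect_det_prod a1 a2 :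
  E (fun om => \det (Z om + a1 *: const_mx 1) * \det (Z om + a2 *: const_mx 1))
  = f n + (a1 + a2) * (n%:R * U n + (n * n.-1)%:R * (mu3 * f (sub2 n)))
  + a1 * a2 * (n%:R * f n.-1 + (n * n.-1)%:R * R n
    + (n * n.-1)%:R * (mu3 * ((sub2 n)%:R * U (sub2 n))) *+ 2
    + (n * n.-1)%:R * (M n + N n)
    + (n * n.-1)%:R * (mu3 * ((sub2 n * (sub2 n).-1)%:R * (mu3 * f (sub2 (sub2 n)))))).
Proof.
pose T := [set: 'I_n]; have Tn : #|T| = n by rewrite cardsT card_ord.
pose S1 om := \sum_(i in T) \sum_(j in T) minor1 T i j (Z om).
rewrite (@eq_expect _ _ _ _ _ (fun om => pminor T (Z om) * pminor T (Z om)
    + (a1 + a2) * (S1 om * pminor T (Z om)) + a1 * a2 * (S1 om * S1 om))); last first.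
  move=> om; rewrite !det_add_const -!pminor_setT -/T.
  have -> : \sum_i \sum_j minor1 T i j (Z om) = S1 om.
    by apply: eq_big => [i|i _]; [|apply: eq_bigl => j]; rewrite inE.
  by ring.
rewrite !expectD !expectZ expect_pminor_sqr Tn.
have := total_linear T; have := total_quadratic T; rewrite Tn => <- <-.
congr (_ + _ * _ + _ * _).
  rewrite expect_dsuml; apply: eq_bigr => i _; apply: eq_bigr => j _.
  by rewrite expectC.
rewrite expect_dsuml; apply: eq_bigr => i _; apply: eq_bigr => j _.
rewrite expectC expect_dsuml; apply: eq_bigr => k _; apply: eq_bigr => l _.
by rewrite expectC.
Qed.

End Totals.
End Recursion.
End HermitianModel.

From mathcomp Require Import complex.
From mathcomp Require Import all_classical all_reals all_analysis.
From mathcomp Require Import measurable_realfun.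

(** * Formal power series *)

Section FormalPowerSeriesCalculus.
Variable K : numFieldType.
Implicit Types (f g h : fps K) (c : K).

Lemma coefsD f g n : coefs (f + g) n = coefs f n + coefs g n.
Proof. by []. Qed.

Lemma coefsN f n : coefs (- f) n = - coefs f n.
Proof. by []. Qed.

Lemma coefsB f g n : coefs (f - g) n = coefs f n - coefs g n.
Proof. by []. Qed.

Lemma coefsCM c f n : coefs (c%:S * f) n = c * coefs f n.
Proof.
rewrite coefs_mul big_ord_recl /= subn0 big1 ?addr0 // => i _.
by rewrite mul0r.
Qed.

Lemma coefsXM f n : coefs (fpsX * f) n.+1 = coefs f n.
Proof.
rewrite coefs_mul big_ord_recl mul0r add0r big_ord_recl /= mul1r subn1 /=.
by rewrite big1 ?addr0 // => i _; rewrite mul0r.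
Qed.

Lemma coefsXM0 f : coefs (fpsX * f) 0 = 0.
Proof. by rewrite coefs_mul big_ord1 mul0r. Qed.

Lemma coefs0M f g : coefs (f * g) 0 = coefs f 0 * coefs g 0.
Proof. by rewrite coefs_mul big_ord1. Qed.

Lemma fpsC_is_zmod_morphism : zmod_morphism (@fpsC K).
Proof. by move=> c1 c2; apply: fpsP => -[|n] //=; rewrite subr0. Qed.

Lemma fpsC_is_monoid_morphism : monoid_morphism (@fpsC K).
Proof.
split=> // c1 c2; apply: fpsP => n; rewrite coefsCM /=.
by case: n => //=; rewrite mulr0.
Qed.

HB.instance Definition _ :=
  GRing.isZmodMorphism.Build K (fps K) (@fpsC K) fpsC_is_zmod_morphism.
HB.instance Definition _ :=
  GRing.isMonoidMorphism.Build K (fps K) (@fpsC K) fpsC_is_monoid_morphism.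

Lemma fps_unitE f : coefs f 0 = 1 -> f \is a GRing.unit.
Proof. by move=> f0; rewrite unfold_in /= /fps_unit f0 oner_eq0. Qed.

Definition fps_deriv f : fps K := FPS (fun n => n.+1%:R * coefs f n.+1).

Lemma fps_derivD f g : fps_deriv (f + g) = fps_deriv f + fps_deriv g.
Proof. by apply: fpsP => n /=; rewrite mulrDr. Qed.

Lemma fps_derivN f : fps_deriv (- f) = - fps_deriv f.
Proof. by apply: fpsP => n /=; rewrite mulrN. Qed.

Lemma fps_derivC c : fps_deriv c%:S = 0.
Proof. by apply: fpsP => n /=; rewrite mulr0 if_same. Qed.

Lemma fps_derivX : fps_deriv fpsX = 1.
Proof. by apply: fpsP => -[|n] /=; rewrite ?mulr1 ?mulr0. Qed.

Lemma fps_derivM f g : fps_deriv (f * g) = fps_deriv f * g + f * fps_deriv g.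
Proof.
apply: fpsP => n; rewrite coefsD 2!coefs_mul [LHS]/= mulr_sumr.
rewrite (eq_bigr (fun i : 'I_n.+2 => i%:R * coefs f i * coefs g (n.+1 - i)%N
    + coefs f i * ((n.+1 - i)%:R * coefs g (n.+1 - i)%N))) => [|i _]; last first.
  have -> : n.+1%:R = i%:R + (n.+1 - i)%:R :> K by rewrite -natrD subnKC // -ltnS.
  by ring.
rewrite big_split /=; congr (_ + _).
  by rewrite big_ord_recl !mul0r add0r.
rewrite big_ord_recr /= subnn mul0r mulr0 addr0; apply: eq_bigr => i _.
by rewrite subSn // -ltnS.
Qed.

Lemma fps_derivXS f n : fps_deriv (f ^+ n.+1) = n.+1%:R * (fps_deriv f * f ^+ n).
Proof.
elim: n => [|n IH]; first by rewrite !expr1 mulr1 mul1r.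
rewrite exprS fps_derivM IH mulrCA [f * _]mulrCA -exprS -[X in X + _]mul1r -mulrDl.
by rewrite -[n.+2]add1n natrD.
Qed.

Lemma coefs_exp_small f k n : coefs f 0 = 0 -> (n < k)%N -> coefs (f ^+ k) n = 0.
Proof.
move=> f0; elim: k n => // k IH n nk; rewrite exprS coefs_mul big_ord_recl f0 mul0r add0r.
apply: big1 => i _; rewrite IH ?mulr0 //=.
by rewrite -ltnS (leq_trans _ nk) // ltnS ltn_subrL /= (leq_trans _ (ltn_ord i)).
Qed.

Lemma coefs_natM (m : nat) f n : coefs (m%:R * f) n = m%:R * coefs f n.
Proof. by rewrite -(rmorph_nat (@fpsC K)) coefsCM. Qed.

(** Termwise, (g^(k+1))' / (k+1)! = g' g^k / k!. *)
Lemma fps_deriv_exp g : coefs g 0 = 0 ->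
  fps_deriv (fps_exp g) = fps_deriv g * fps_exp g.
Proof.
move=> g0; apply: fpsP => n; rewrite coefs_mul.
transitivity (\sum_(k < n.+1) coefs (fps_deriv g * g ^+ k) n / k`!%:R).
  rewrite [LHS]/= big_ord_recl mulrDr /= mul0r mulr0 add0r mulr_sumr.
  apply: eq_bigr => k _; rewrite mulrA /bump leq0n add1n.
  rewrite -[X in X / _]/(coefs (fps_deriv (g ^+ k.+1)) n) fps_derivXS coefs_natM.
  by rewrite factS natrM invfM mulrACA divff ?mul1r // pnatr_eq0.
under eq_bigr do rewrite coefs_mul mulr_suml.
rewrite exchange_big /=; apply: eq_bigr => i _.
(* In degree n - i the exponential is cut at k = n - i; extending the sum to k = n adds nothing,
   because g^k starts in degree k. *)
have le : ((n - i).+1 <= n.+1)%N by rewrite ltnS leq_subr.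
rewrite mulr_sumr (big_ord_widen _ (fun k => (i.+1%:R * coefs g i.+1) *
   (coefs (g ^+ k) (n - i) / k`!%:R)) le) [RHS]big_mkcond /=.
apply: eq_bigr => k _; case: ltnP => [_|lk]; first by rewrite mulrA.
by rewrite coefs_exp_small // mulr0 mul0r.
Qed.

End FormalPowerSeriesCalculus.

(** * The generating functions *)

Section GeneratingFunction.
Variable K : numFieldType.
Variables (c ka mu2 nu2 mu3 mu4 nu4 : K).
Local Notation t := (fpsX : fps K).
(** For an off-diagonal entry z with real and imaginary parts x and y: s = E[x^2 + y^2], d = E[z^2],
    and [m4] is the expectation of (x^2 + y^2)^2. *)
Let s := mu2 + nu2.
Let d := mu2 - nu2.
Let m4 := mu4 + nu4 + 2 * mu2 * nu2.

Definition gf_exponent : fps K :=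
  t * (c ^+ 2 + ka - 2 * mu2)%:S
  + (2^-1)%:S * t ^+ 2 * (mu4 - 3 * nu2 ^+ 2 - 3 * mu2 ^+ 2 + nu4)%:S
  - t ^+ 2 * (c ^+ 2 * (mu2 + nu2))%:S / (1 + t * s%:S).

Definition gf_quad : fps K :=
  1 - (2 * mu2)%:S * t + (mu2 ^+ 2 - nu2 ^+ 2)%:S * t ^+ 2.

Definition gf_sqr : fps K :=
  fps_exp gf_exponent / (gf_quad * fps_sqrt (1 - s%:S ^+ 2 * t ^+ 2)).

Local Notation Q := gf_sqr.
Let p : fps K := 1 + s%:S * t.
Let q : fps K := 1 - s%:S * t.
Let l : fps K := 1 - d%:S * t.

(* Exponential generating functions of n U_n, n(n-1) M_n, n(n-1) N_n and
   n(n-1) R_n, solved from the recurrences in terms of Q. *)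
Definition gf_U : fps K := c%:S * t * Q / p.
Definition gf_M : fps K := d%:S * t ^+ 2 * Q / l.
Definition gf_N : fps K := s%:S * t ^+ 2 * Q / q.
Definition gf_R : fps K :=
  t ^+ 2 * Q * ((c%:S) ^+ 2 / p ^+ 2 + s%:S ^+ 2 * t / (p * q)).

Lemma gf_p_unit : p \is a GRing.unit.
Proof. by apply: fps_unitE; rewrite coefsD coefs0M /= mulr0 addr0. Qed.
Lemma gf_q_unit : q \is a GRing.unit.
Proof. by apply: fps_unitE; rewrite coefsB coefs0M /= mulr0 subr0. Qed.
Lemma gf_l_unit : l \is a GRing.unit.
Proof. by apply: fps_unitE; rewrite coefsB coefs0M /= mulr0 subr0. Qed.

Lemma gf_quadE : gf_quad = q * l.
Proof.
rewrite /gf_quad /q /l /s /d.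
by rewrite !(rmorphD, rmorphN, rmorphM, rmorphXn, rmorph_nat); ring.
Qed.

Lemma gf_pqE : 1 - s%:S ^+ 2 * t ^+ 2 = p * q.
Proof. by rewrite /p /q; ring. Qed.

Lemma gf_UE : gf_U * p = c%:S * t * Q.
Proof. by rewrite divrK ?gf_p_unit. Qed.
Lemma gf_ME : gf_M * l = d%:S * t ^+ 2 * Q.
Proof. by rewrite divrK ?gf_l_unit. Qed.
Lemma gf_NE : gf_N * q = s%:S * t ^+ 2 * Q.
Proof. by rewrite divrK ?gf_q_unit. Qed.
Lemma gf_RE : gf_R * (p ^+ 2 * q) = t ^+ 2 * Q * (c%:S ^+ 2 * q + s%:S ^+ 2 * t * p).
Proof.
rewrite /gf_R -mulrA mulrDl; congr (_ * (_ + _)).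
  by rewrite mulrA divrK // unitrX // gf_p_unit.
have -> : p ^+ 2 * q = p * q * p by ring.
rewrite mulrA divrK //.
by rewrite unitrM gf_p_unit gf_q_unit.
Qed.

Lemma coefs0_exponent : coefs gf_exponent 0 = 0.
Proof.
rewrite /gf_exponent coefsB coefsD !expr2 -!mulrA !coefs0M /=.
by rewrite !(mul0r, mulr0) addr0 subr0.
Qed.

Lemma coefs0_gf : coefs Q 0 = 1.
Proof.
set X := gf_quad * fps_sqrt (1 - s%:S ^+ 2 * t ^+ 2).
have X0 : coefs X 0 = 1.
  rewrite coefs0M fps_sqrt0 gf_quadE coefs0M coefsB coefsB !coefs0M /=.
  by rewrite !mulr0 !subr0 !mulr1.
have := divrK (fps_unitE X0) (fps_exp gf_exponent).
rewrite -/Q => /(congr1 (fun f => coefs f 0)).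
rewrite [LHS]coefs0M X0 mulr1 => ->.
by rewrite [LHS]big_ord1 expr0 /= divr1.
Qed.

Lemma deriv_p_inv : fps_deriv p^-1 = - (s%:S * p^-1 ^+ 2).
Proof.
have e : fps_deriv p = s%:S.
  by rewrite /p fps_derivD fps_derivM -(rmorph1 (@fpsC K)) !fps_derivC fps_derivX; ring.
have h := divrr gf_p_unit.
have : fps_deriv (p / p) = 0 by rewrite h -(rmorph1 (@fpsC K)) fps_derivC.
rewrite fps_derivM e => /eqP; rewrite addrC addr_eq0 => /eqP h2.
by rewrite -[LHS](mulKr gf_p_unit) h2; ring.
Qed.

(** The logarithmic derivative of Q is rational: the derivative of the exponent, plus s/q and d/l
    from [gf_quad], plus s^2 t / (p q) from the square root. Inserting the closed forms of the other
    series leaves a polynomial identity. *)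
Lemma gf_ODE : fps_deriv Q =
  (c ^+ 2 + ka)%:S * Q - (2 * (c * s))%:S * gf_U + m4%:S * (t * Q)
  + (s ^+ 2)%:S * gf_R + (d ^+ 2)%:S * gf_M + (s ^+ 2)%:S * gf_N.
Proof.
set W := fps_sqrt (1 - s%:S ^+ 2 * t ^+ 2).
have W2 : W ^+ 2 = p * q.
  rewrite fps_sqrtK ?gf_pqE ?pnatr_eq0 // coefs0M coefsD coefsB !coefs0M /=.
  by rewrite !mulr0 addr0 subr0 mulr1.
have WU : W \is a GRing.unit by apply: fps_unitE.
have two : (2 : fps K) \is a GRing.unit.
  by rewrite unfold_in /= /fps_unit -(rmorph_nat (@fpsC K)) /= pnatr_eq0.
have dC := @fps_derivC K.
have d1 : fps_deriv (1 : fps K) = 0 by rewrite -(rmorph1 (@fpsC K)) dC.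
have dp : fps_deriv p = s%:S by rewrite /p fps_derivD fps_derivM d1 dC fps_derivX; ring.
have dq : fps_deriv q = - s%:S.
  by rewrite /q fps_derivD fps_derivN fps_derivM d1 dC fps_derivX; ring.
have dl : fps_deriv l = - d%:S.
  by rewrite /l fps_derivD fps_derivN fps_derivM d1 dC fps_derivX; ring.
have dW : W * fps_deriv W = - (s%:S ^+ 2 * t).
  (* W W' is half the derivative of the polynomial p q, so the square root itself drops out. *)
  apply: (mulrI two); transitivity (fps_deriv (W ^+ 2)).
    by rewrite expr2 fps_derivM; ring.
  by rewrite W2 fps_derivM dp dq /p /q; ring.
have QE : Q * (q * l * W) = fps_exp gf_exponent.
  by rewrite -gf_quadE divrK // unitrM WU gf_quadE unitrM gf_q_unit gf_l_unit.
have := fps_deriv_exp coefs0_exponent; rewrite -QE.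
have -> : fps_deriv gf_exponent = (c ^+ 2 + ka - 2 * mu2)%:S
   + t * (mu4 - 3 * nu2 ^+ 2 - 3 * mu2 ^+ 2 + nu4)%:S
   - (c ^+ 2 * s)%:S * (2 * t * p^-1 - s%:S * (t * p^-1) ^+ 2).
  have hp : (1 + t * s%:S) = p by rewrite /p mulrC.
  have h2 : (2^-1)%:S * 2 = 1 :> fps K.
    by rewrite -(rmorph_nat (@fpsC K)) -rmorphM mulVf ?rmorph1 // pnatr_eq0.
  rewrite /gf_exponent hp -/s fps_derivD fps_derivN fps_derivD !fps_derivM deriv_p_inv.
  rewrite !dC fps_derivX.
  set B := (mu4 - _ - _ + _)%:S.
  (* The 2 produced by differentiating t^2 cancels the constant 2^-1. *)
  have -> : t * B = (2^-1)%:S * 2 * (t * B) by rewrite h2 mul1r.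
  by ring.
rewrite (fps_derivM Q) (fps_derivM (q * l)) (fps_derivM q) dq dl => dQ.
(* A unit that clears every denominator on both sides. *)
apply: (mulIr (_ : q * l * (p * q) * p ^+ 2 \is a GRing.unit)).
  by rewrite !(unitrM, unitrX) ?gf_p_unit ?gf_q_unit ?gf_l_unit.
have pV := divrr gf_p_unit; move: dQ; set v := p^-1 in pV *.
set A := (c ^+ 2 + ka - 2 * mu2)%:S.
set B := (mu4 - _ - _ + _)%:S; set C := (c ^+ 2 * s)%:S => dQ.
have {}dQ : fps_deriv Q * (q * l * (p * q)) * p ^+ 2 =
    ((A + t * B) * p ^+ 2 - C * (2 * t * p * (p * v) - s%:S * t ^+ 2 * (p * v) ^+ 2))
      * Q * (q * l) * (p * q)
    + Q * ((s%:S * l + q * d%:S) * (p * q) + q * l * (s%:S ^+ 2 * t)) * p ^+ 2.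
  (* With s^2 t turned back into - W W', the claim is the differentiated exponential identity
     multiplied by W p^2. *)
  have -> : q * l * (s%:S ^+ 2 * t) = - (q * l * (W * fps_deriv W)) by rewrite dW; ring.
  rewrite -W2; apply/eqP; rewrite -subr_eq0; apply/eqP.
  move/(congr1 (fun x => x * W * p ^+ 2)): dQ => /eqP; rewrite -subr_eq0 => /eqP <-.
  by ring.
rewrite [LHS]mulrA dQ pV.
transitivity (((c ^+ 2 + ka)%:S * Q + m4%:S * (t * Q)) * (q * l * (p * q) * p ^+ 2)
   - (2 * (c * s))%:S * (gf_U * p) * (q * l * q * p ^+ 2)
   + (s ^+ 2)%:S * (gf_R * (p ^+ 2 * q)) * (l * (p * q))
   + (d ^+ 2)%:S * (gf_M * l) * (q * p * q * p ^+ 2)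
   + (s ^+ 2)%:S * (gf_N * q) * (l * (p * q) * p ^+ 2)); last by ring.
rewrite gf_UE gf_RE gf_ME gf_NE /A /B /C /p /q /l /s /d /m4.
rewrite !(rmorphD, rmorphN, rmorphM, rmorphXn, rmorph_nat).
by ring.
Qed.

Lemma gf_U_rec : gf_U = c%:S * (t * Q) - s%:S * (t * gf_U).
Proof.
have -> : c%:S * (t * Q) = gf_U * p by rewrite gf_UE; ring.
by rewrite /p; ring.
Qed.

Lemma gf_M_rec : gf_M = d%:S * (t * (t * Q)) + d%:S * (t * gf_M).
Proof.
have -> : d%:S * (t * (t * Q)) = gf_M * l by rewrite gf_ME; ring.
by rewrite /l; ring.
Qed.

Lemma gf_N_rec : gf_N = s%:S * (t * (t * Q)) + s%:S * (t * gf_N).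
Proof.
have -> : s%:S * (t * (t * Q)) = gf_N * q by rewrite gf_NE; ring.
by rewrite /q; ring.
Qed.

Lemma gf_R_rec : gf_R = c%:S * (t * gf_U)
  - s%:S * (t * (t * (c%:S * gf_U - s%:S * (t * Q + gf_R)))).
Proof.
apply: (mulIr (_ : p ^+ 2 * q \is a GRing.unit)).
  by rewrite unitrM unitrX ?gf_p_unit ?gf_q_unit.
transitivity (c%:S * t * (gf_U * p) * (p * q) - s%:S * c%:S * t ^+ 2 * (gf_U * p) * (p * q)
  + s%:S ^+ 2 * t ^+ 3 * Q * p ^+ 2 * q + s%:S ^+ 2 * t ^+ 2 * (gf_R * (p ^+ 2 * q)));
  last by ring.
by rewrite gf_RE gf_UE /p /q; ring.
Qed.

(** The factorials undo the weights n and n(n-1) carried by the series: n! / n is (n-1)! and n! /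
    (n(n-1)) is (n-2)!. Below the range where this makes sense the coefficient is 0. *)
Definition seq_f n := n`!%:R * coefs Q n.
Definition seq_U n := n.-1`!%:R * coefs gf_U n.
Definition seq_M n := n.-2`!%:R * coefs gf_M n.
Definition seq_N n := n.-2`!%:R * coefs gf_N n.
Definition seq_R n := n.-2`!%:R * coefs gf_R n.

Let coefsE := (coefsD, coefsB, coefsN, coefsCM, coefsXM, coefsXM0).

Lemma gf_U0 : coefs gf_U 0 = 0.
Proof. by rewrite gf_U_rec !coefsE; ring. Qed.

Lemma gf_M0 : coefs gf_M 0 = 0. Proof. by rewrite gf_M_rec !coefsE; ring. Qed.
Lemma gf_M1 : coefs gf_M 1 = 0. Proof. by rewrite gf_M_rec !coefsE gf_M0; ring. Qed.
Lemma gf_N0 : coefs gf_N 0 = 0. Proof. by rewrite gf_N_rec !coefsE; ring. Qed.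
Lemma gf_N1 : coefs gf_N 1 = 0. Proof. by rewrite gf_N_rec !coefsE gf_N0; ring. Qed.
Lemma gf_R0 : coefs gf_R 0 = 0. Proof. by rewrite gf_R_rec !coefsE; ring. Qed.
Lemma gf_R1 : coefs gf_R 1 = 0. Proof. by rewrite gf_R_rec !coefsE gf_U0; ring. Qed.

Lemma seq_UE n : n`!%:R * coefs gf_U n = n%:R * seq_U n.
Proof. by case: n => [|n]; rewrite /seq_U ?gf_U0 ?mul0r ?mulr0 // factS natrM mulrA. Qed.

Lemma fact2 (x : fps K) n : coefs x 0 = 0 -> coefs x 1 = 0 ->
  n`!%:R * coefs x n = (n * n.-1)%:R * (n.-2`!%:R * coefs x n).
Proof.
by case: n => [|[|n]] x0 x1; rewrite ?x0 ?x1 ?mulr0 // !factS !natrM !mulrA.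
Qed.

Lemma seq_ME n : n`!%:R * coefs gf_M n = (n * n.-1)%:R * seq_M n.
Proof. by apply: fact2; rewrite ?gf_M0 ?gf_M1. Qed.
Lemma seq_NE n : n`!%:R * coefs gf_N n = (n * n.-1)%:R * seq_N n.
Proof. by apply: fact2; rewrite ?gf_N0 ?gf_N1. Qed.
Lemma seq_RE n : n`!%:R * coefs gf_R n = (n * n.-1)%:R * seq_R n.
Proof. by apply: fact2; rewrite ?gf_R0 ?gf_R1. Qed.

Lemma seq_tE n : n`!%:R * coefs (t * Q) n = n%:R * seq_f n.-1.
Proof.
by case: n => [|n]; rewrite ?coefsXM0 ?mulr0 ?mul0r // coefsXM /seq_f factS natrM mulrA.
Qed.

Lemma seq_ttE (x : fps K) n :
  n`!%:R * coefs (t * (t * x)) n = (n * n.-1)%:R * (n.-2`!%:R * coefs x n.-2).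
Proof.
case: n => [|[|n]]; rewrite ?coefsXM0 ?mul0r ?mulr0 //.
  by rewrite coefsXM coefsXM0 mulr0.
by rewrite !coefsXM !factS !natrM !mulrA.
Qed.

Lemma seq_f0 : seq_f 0 = 1.
Proof. by rewrite /seq_f coefs0_gf mulr1. Qed.

Lemma seq_US n : seq_U n.+1 = c * seq_f n - s * (n%:R * seq_U n).
Proof. by rewrite -seq_UE /seq_U {1}gf_U_rec !coefsE /seq_f /=; ring. Qed.

Lemma seq_MS n : seq_M n.+2 = d * (seq_f n + n%:R * seq_M n.+1).
Proof.
have -> : n%:R * seq_M n.+1 = n`!%:R * coefs gf_M n.+1.
  by case: n => [|n]; rewrite /seq_M ?gf_M1 ?mul0r ?mulr0 // factS natrM mulrA.
by rewrite /seq_M {1}gf_M_rec !coefsE /seq_f /=; ring.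
Qed.

Lemma seq_NS n : seq_N n.+2 = s * (seq_f n + n%:R * seq_N n.+1).
Proof.
have -> : n%:R * seq_N n.+1 = n`!%:R * coefs gf_N n.+1.
  by case: n => [|n]; rewrite /seq_N ?gf_N1 ?mul0r ?mulr0 // factS natrM mulrA.
by rewrite /seq_N {1}gf_N_rec !coefsE /seq_f /=; ring.
Qed.

Lemma seq_RS n : seq_R n.+2 = c * seq_U n.+1
  - s * (n%:R * (c * seq_U n - s * (seq_f n.-1 + n.-1%:R * seq_R n))).
Proof.
have e : n%:R * (c * seq_U n - s * (seq_f n.-1 + n.-1%:R * seq_R n))
   = n`!%:R * (c * coefs gf_U n - s * (coefs (t * Q) n + coefs gf_R n)).
  transitivity (c * (n%:R * seq_U n) - s * (n%:R * seq_f n.-1 + (n * n.-1)%:R * seq_R n)).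
    by rewrite natrM; ring.
  by rewrite -seq_UE -seq_tE -seq_RE; ring.
by rewrite e /seq_R {1}gf_R_rec !coefsE /seq_U /=; ring.
Qed.

(** The coefficient of degree n in [gf_ODE], scaled by n!. *)
Lemma seq_fS n : seq_f n.+1 = (c ^+ 2 + ka) * seq_f n - (c * s * (n%:R * seq_U n)) *+ 2
  + n%:R * (m4 * seq_f n.-1 + s ^+ 2 * (n.-1%:R * seq_R n)
            + n.-1%:R * (d ^+ 2 * seq_M n + s ^+ 2 * seq_N n)).
Proof.
have := congr1 (fun x => n`!%:R * coefs x n) gf_ODE.
rewrite [X in X = _ -> _]/= mulrA -natrM mulnC -factS -/(seq_f n.+1) => ->.
rewrite !(coefsD, coefsN, coefsCM) -seq_UE.
transitivity ((c ^+ 2 + ka) * seq_f n - c * s * (n`!%:R * coefs gf_U n) *+ 2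
  + m4 * (n`!%:R * coefs (t * Q) n) + s ^+ 2 * (n`!%:R * coefs gf_R n)
  + d ^+ 2 * (n`!%:R * coefs gf_M n) + s ^+ 2 * (n`!%:R * coefs gf_N n)).
  by rewrite /seq_f; ring.
by rewrite seq_tE seq_ME seq_NE seq_RE natrM; ring.
Qed.

(** * The prefactor coming from the rank one shifts *)

Section Prefactor.
Variables a1 a2 : K.

Definition gf_prefactor : fps K :=
  1 + (a1 + a2)%:S * (mu3%:S * t ^+ 2 + c%:S * t / (1 + s%:S * t))
  + (a1 * a2)%:S *
    ((mu3 ^+ 2)%:S * t ^+ 4
     + (2 * c * mu3)%:S * t ^+ 3 / (1 + s%:S * t)
     + (c ^+ 2)%:S * t ^+ 2 / (1 + s%:S * t) ^+ 2
     + 2 * t ^+ 2 * (mu2%:S - (mu2 ^+ 2)%:S * t + (nu2 ^+ 2)%:S * t) / gf_quad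
     + t / (1 - s%:S ^+ 2 * t ^+ 2)).

(** The origin of the terms of P: c t / p is U; the fraction over [gf_quad] is d t^2 / l + s t^2 /
    q, that is M and N; and t / (p q) = t + s^2 t^3 / (p q) merges the diagonal squares with the
    part of R free of c. *)
Lemma gf_prefactorE : gf_prefactor * Q =
  Q + (a1 + a2)%:S * (gf_U + mu3%:S * (t * (t * Q)))
  + (a1 * a2)%:S * (t * Q + gf_R + (2 * mu3)%:S * (t * (t * gf_U))
      + (gf_M + gf_N) + (mu3 ^+ 2)%:S * (t * (t * (t * (t * Q))))).
Proof.
apply: (mulIr (_ : p ^+ 2 * q * l \is a GRing.unit)).
  by rewrite !(unitrM, unitrX) ?gf_p_unit ?gf_q_unit ?gf_l_unit.
rewrite /gf_prefactor -/p gf_pqE gf_quadE.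
set ip := p^-1; set ip2 := (p ^+ 2)^-1; set iql := (q * l)^-1; set ipq := (p * q)^-1.
have h1 : ip * p = 1 by rewrite mulVr ?gf_p_unit.
have h2 : ip2 * p ^+ 2 = 1 by rewrite mulVr ?unitrX ?gf_p_unit.
have h3 : iql * (q * l) = 1 by rewrite mulVr ?unitrM ?gf_l_unit ?gf_q_unit.
have h4 : ipq * (p * q) = 1 by rewrite mulVr ?unitrM ?gf_p_unit ?gf_q_unit.
transitivity (((1 + (a1 + a2)%:S * (mu3%:S * t ^+ 2)) * (p ^+ 2 * q * l)
   + (a1 + a2)%:S * (c%:S * t * (ip * p) * (p * q * l))
   + (a1 * a2)%:S *
    ((mu3 ^+ 2)%:S * t ^+ 4 * (p ^+ 2 * q * l)
     + (2 * c * mu3)%:S * t ^+ 3 * (ip * p) * (p * q * l)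
     + (c ^+ 2)%:S * t ^+ 2 * (ip2 * p ^+ 2) * (q * l)
     + 2 * t ^+ 2 * (mu2%:S - (mu2 ^+ 2)%:S * t + (nu2 ^+ 2)%:S * t)
       * (iql * (q * l)) * p ^+ 2
     + t * (ipq * (p * q)) * (p * l))) * Q); first by ring.
rewrite h1 h2 h3 h4.
transitivity ((Q + (a1 + a2)%:S * (mu3%:S * (t * (t * Q))) + (a1 * a2)%:S *
     (t * Q + (mu3 ^+ 2)%:S * (t * (t * (t * (t * Q)))))) * (p ^+ 2 * q * l)
   + (a1 + a2)%:S * (gf_U * p) * (p * q * l)
   + (a1 * a2)%:S * ((gf_R * (p ^+ 2 * q)) * l
      + (2 * mu3)%:S * t ^+ 2 * (gf_U * p) * (p * q * l)
      + (gf_M * l) * (p ^+ 2 * q) + (gf_N * q) * (p ^+ 2 * l))); last by ring.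
rewrite gf_UE gf_RE gf_ME gf_NE /p /q /l /s /d.
rewrite !(rmorphD, rmorphN, rmorphM, rmorphXn, rmorph_nat).
by ring.
Qed.

Local Notation sub2 m := (m.-1.-1).

(** The right-hand side has the exact shape of the value in [expect_det_prod]. *)
Lemma coefs_gf_prefactor n : n`!%:R * coefs (gf_prefactor * Q) n =
  seq_f n + (a1 + a2) * (n%:R * seq_U n + (n * n.-1)%:R * (mu3 * seq_f (sub2 n)))
  + a1 * a2 * (n%:R * seq_f n.-1 + (n * n.-1)%:R * seq_R n
    + (n * n.-1)%:R * (mu3 * ((sub2 n)%:R * seq_U (sub2 n))) *+ 2
    + (n * n.-1)%:R * (seq_M n + seq_N n)
    + (n * n.-1)%:R * (mu3 * ((sub2 n * (sub2 n).-1)%:R * (mu3 * seq_f (sub2 (sub2 n)))))).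
Proof.
rewrite gf_prefactorE !(coefsD, coefsCM).
transitivity (seq_f n + (a1 + a2) * (n`!%:R * coefs gf_U n
     + mu3 * (n`!%:R * coefs (t * (t * Q)) n))
  + a1 * a2 * (n`!%:R * coefs (t * Q) n + n`!%:R * coefs gf_R n
    + mu3 * (n`!%:R * coefs (t * (t * gf_U)) n) *+ 2
    + (n`!%:R * coefs gf_M n + n`!%:R * coefs gf_N n)
    + mu3 ^+ 2 * (n`!%:R * coefs (t * (t * (t * (t * Q)))) n))).
  by rewrite /seq_f; ring.
rewrite seq_UE !seq_ttE seq_tE seq_RE seq_ME seq_NE seq_UE -/(seq_f _) -/(seq_f _).
by ring.
Qed.

End Prefactor.
End GeneratingFunction.

(** * Expectations of products of independent variables *)

Section ProductExpectation.
Local Open Scope classical_set_scope.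
Context d (T : measurableType d) (R : realType) (P : probability T R).
Local Open Scope ereal_scope.
Import HBNNSimple.

(* Both sides are measures in the set A, hence agree on nonnegative functions
   as soon as they agree on indicators. *)
Lemma ge0_integral_factor (X : {RV P >-> R}) (G : T -> R) (c : R) :
  measurable_fun setT G -> (forall x, (0 <= G x)%R) ->
  (forall A, measurable A ->
     \int[P]_x ((\1_A (X x) : R) * G x)%:E = (\int[P]_x (\1_A (X x) : R)%:E) * c%:E) ->
  forall phi : R -> R, measurable_fun setT phi -> (forall y, (0 <= phi y)%R) ->
  \int[P]_x (phi (X x) * G x)%:E = (\int[P]_x (phi (X x))%:E) * c%:E.
Proof.
move=> mG G0 GC phi mphi phi0.
have mX : measurable_fun setT X by [].
have mphiE : measurable_fun [set: R] (EFin \o phi : R -> \bar R) by exact/measurable_EFinP.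
pose f_ := nnsfun_approx measurableT mphiE.
have f_cvg y : (EFin \o f_^~ y) @ \oo --> (phi y)%:E.
  by apply: (cvg_nnsfun_approx measurableT mphiE) => // x _ /=; rewrite lee_fin.
have mfX n : measurable_fun setT (f_ n \o X).
  by apply: measurableT_comp => //; exact: measurable_funP.
have indicX (A : set R) : measurable A -> measurable_fun setT (fun x => \1_A (X x) : R).
  by move=> mA; apply: (measurableT_comp (measurable_indic mA)).
have sumE n (H : T -> R) : measurable_fun setT H -> (forall x, (0 <= H x)%R) ->
    \int[P]_x (f_ n (X x) * H x)%:E
    = \sum_(k \in range (f_ n))
        k%:E * \int[P]_x ((\1_(f_ n @^-1` [set k]) (X x) : R) * H x)%:E.
  move=> mH H0; transitivity (\int[P]_x (\sum_(k \in range (f_ n))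
        (k * ((\1_(f_ n @^-1` [set k]) (X x) : R) * H x))%:E)).
    apply: eq_integral => x _; rewrite fsumEFin // (fimfunE (f_ n)).
    by rewrite mulr_fsuml; congr EFin; apply: eq_fsbigr => k _; rewrite mulrA.
  rewrite ge0_integral_fsum //; last 2 first.
  - move=> k; apply/measurable_EFinP; apply: measurable_funM => //.
    by apply: measurable_funM => //; exact: indicX.
  - move=> k x _; rewrite lee_fin mulrA mulr_ge0 //.
    by have := nnfun_muleindic_ge0 (f_ n) k (X x); rewrite lee_fin.
  apply: eq_fsbigr => k; rewrite inE => -[y _ <-].
  under eq_integral do rewrite EFinM.
  rewrite ge0_integralZl_EFin //.
  - by move=> x _; rewrite lee_fin mulr_ge0.
  - by apply/measurable_EFinP; apply: measurable_funM => //; exact: indicX.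
have ind n : \int[P]_x (f_ n (X x) * G x)%:E = (\int[P]_x (f_ n (X x))%:E) * c%:E.
  rewrite sumE //.
  have -> : \int[P]_x (f_ n (X x))%:E = \int[P]_x (f_ n (X x) * cst 1%R x)%:E.
    by apply: eq_integral => x _; rewrite mulr1.
  rewrite sumE // ge0_mule_fsuml => [|k]; last first.
    have [k0|k0] := leP 0%R k.
      rewrite mule_ge0 ?lee_fin //.
      by apply: integral_ge0 => x _; rewrite lee_fin mulr_ge0.
    rewrite preimage_nnfun0 // (@eq_integral _ _ _ _ _ (fun=> 0)) => [|x _].
      by rewrite integral0 mule0.
    by rewrite indic0 mul0r.
  apply: eq_fsbigr => k _; rewrite GC // muleA.
  by under [in RHS]eq_integral do rewrite mulr1.
have lim (H : T -> R) : measurable_fun setT H -> (forall x, (0 <= H x)%R) ->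
    \int[P]_x (f_ n (X x) * H x)%:E @[n --> \oo] --> \int[P]_x (phi (X x) * H x)%:E.
  move=> mH H0.
  have -> : \int[P]_x (phi (X x) * H x)%:E
      = \int[P]_x limn (fun n => (f_ n (X x) * H x)%:E).
    apply: eq_integral => x _; apply/esym/cvg_lim => //.
    under eq_fun do rewrite EFinM.
    rewrite EFinM; apply: cvgeZr => //; exact: f_cvg.
  apply: cvg_monotone_convergence => //.
  - by move=> n; apply/measurable_EFinP; apply: measurable_funM => //; exact: mfX.
  - by move=> n x _; rewrite lee_fin mulr_ge0.
  - move=> x _ m n mn; rewrite lee_fin ler_wpM2r //.
    exact/lefP/nd_nnsfun_approx.
have l1 := lim G mG G0; have l2 := lim (cst 1%R) (measurable_cst _) (fun=> ler01).
have -> : \int[P]_x (phi (X x))%:E = \int[P]_x (phi (X x) * cst 1%R x)%:E.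
  by apply: eq_integral => x _; rewrite mulr1.
rewrite -(cvg_lim _ l1) // -(cvg_lim _ (cvgeZr (y := c%:E) _ l2)) //.
congr (limn _); apply/funext => n; rewrite ind; congr (_ * _).
by apply: eq_integral => x _; rewrite mulr1.
Qed.

Section IndependentFamily.
Variables (I : finType) (D : {set I}) (X : I -> {RV P >-> R}).
Hypothesis indepX : independent_family D X.
Implicit Types (S A : {set I}) (g h : I -> R -> R).

Lemma indic_bigcap S (F : I -> set T) x :
  \1_(\bigcap_(i in [set` S]) F i) x = (\prod_(i in S) \1_(F i) x)%R :> R.
Proof.
have [/forall_inP Fx|] := boolP [forall i in S, x \in F i].
  rewrite big1 => [|i iS]; last by rewrite indicE Fx.
  by rewrite indicE mem_set // => i /= iS; apply/set_mem/Fx.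
rewrite negb_forall_in => /exists_inP[i iS xF].
rewrite (bigD1 i) //= !indicE (negbTE xF) mul0r memNset // => /(_ i iS) Fx.
by rewrite mem_set in xF.
Qed.

Let measurable_gX g i : (forall i, measurable_fun setT (g i)) ->
  measurable_fun setT (fun x => g i (X i x)).
Proof. by move=> mg; apply: measurableT_comp => //; exact: measurable_funP. Qed.

Lemma measurable_prod_cond (Q : pred I) (f : I -> T -> R) :
  (forall i, measurable_fun setT (f i)) ->
  measurable_fun setT (fun x => (\prod_(i | Q i) f i x)%R).
Proof.
by move=> mf; under eq_fun do rewrite -big_filter; apply: measurable_prod.
Qed.

(** Independence is the case of indicators. The general case follows by releasing one factor at a
    time through [ge0_integral_factor]; finite integrals make the product over the other factors a
    real constant. *)
Lemma ge0_integral_prod_independent S g : S \subset D ->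
  (forall i, measurable_fun setT (g i)) -> (forall i y, (0 <= g i y)%R) ->
  (forall i, i \in S -> \int[P]_x (g i (X i x))%:E < +oo) ->
  \int[P]_x (\prod_(i in S) g i (X i x))%:E = \prod_(i in S) \int[P]_x (g i (X i x))%:E.
Proof.
move=> SD.
(* A collects the indices whose function is not known to be an indicator. *)
suff main A : A \subset S -> forall g, (forall i, measurable_fun setT (g i)) ->
    (forall i y, (0 <= g i y)%R) ->
    (forall i, i \in S -> \int[P]_x (g i (X i x))%:E < +oo) ->
    (forall i, i \in S :\: A -> exists2 B, measurable B & g i = \1_B) ->
    \int[P]_x (\prod_(i in S) g i (X i x))%:E
    = \prod_(i in S) \int[P]_x (g i (X i x))%:E.
  by move=> mg g0 gfin; apply: (main S) => // i; rewrite finset.setDv inE.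
have [m] := ubnP #|A|; elim: m A => // m IH A /ltnSE Am AS {}g mg g0 gfin gA.
have [A0|[j jA]] := set_0Vmem A.
  pose B i := g i @^-1` [set 1%R].
  have gB i y : i \in S -> g i y = \1_(B i) y.
    move=> iS; have [|C mC gC] := gA i; first by rewrite A0 finset.setD0.
    rewrite /B gC !indicE; congr (_%:R); congr nat_of_bool.
    apply/idP/idP => [yC|/set_mem /=]; first by apply/mem_set; rewrite /= indicE yC.
    by rewrite indicE; case: (y \in C) => //= /esym/eqP; rewrite oner_eq0.
  have mB i : measurable (B i).
    by rewrite /B -[X in measurable X]setTI; apply: mg.
  have mXB i : measurable (X i @^-1` B i).
    by rewrite -[X in measurable X]setTI; apply: (measurable_funP (X i)).
  transitivity (P (\bigcap_(i in [set` S]) X i @^-1` B i)).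
    rewrite -[X in P X]setIT -[RHS]integral_indic //; last first.
      by apply: fin_bigcap_measurable => //; exact: finite_finset.
    apply: eq_integral => x _; rewrite indic_bigcap; congr EFin.
    by apply: eq_bigr => i iS; rewrite gB.
  rewrite indepX //; apply: eq_bigr => i iS.
  rewrite -[X in P X]setIT -[LHS]integral_indic //.
  by apply: eq_integral => x _; rewrite gB.
have jS : j \in S by exact: (fintype.subsetP AS).
pose G x := (\prod_(i in S | i != j) g i (X i x))%R.
have fin_i i : i \in S -> \int[P]_x (g i (X i x))%:E \is a fin_num.
  by move=> iS; rewrite ge0_fin_numE ?gfin //; apply: integral_ge0 => x _; rewrite lee_fin.
have finC : \prod_(i in S | i != j) \int[P]_x (g i (X i x))%:E \is a fin_num.
  by elim/big_ind : _ => // [x y|i /andP[iS _]]; [exact: fin_numM|exact: fin_i].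
have mG : measurable_fun setT G.
  by apply: measurable_prod_cond => i; apply: measurable_gX.
rewrite (bigD1 j) //= -(fineK finC).
under eq_integral do rewrite (bigD1 j) //= -/(G _).
apply: ge0_integral_factor => //.
- by move=> x; apply: prodr_ge0.
(* With an indicator placed at j, one index fewer is left in A and the induction applies. *)
move=> B mB; pose g' i := if i == j then \1_B : R -> R else g i.
have g'E i : i != j -> g' i = g i by rewrite /g' => /negbTE ->.
have g'j : g' j = \1_B by rewrite /g' eqxx.
have mg' i : measurable_fun setT (g' i).
  by have [->|nij] := eqVneq i j; [rewrite g'j; exact: measurable_indic|rewrite g'E].
have g'0 i y : (0 <= g' i y)%R.
  by have [->|nij] := eqVneq i j; [rewrite g'j indicE|rewrite g'E].
have mXB : measurable (X j @^-1` B).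
  by rewrite -[X in measurable X]setTI; apply: (measurable_funP (X j)).
have : \int[P]_x (\prod_(i in S) g' i (X i x))%:E
    = \prod_(i in S) \int[P]_x (g' i (X i x))%:E.
  apply: (IH (A :\ j)%SET) => // [||i iS|i].
  - by apply: leq_trans Am; rewrite [X in (_ < X)%N](cardsD1 j) jA.
  - exact: fintype.subset_trans (subD1set _ _) AS.
  - have [->|nij] := eqVneq i j; last by rewrite g'E // gfin.
    rewrite g'j -[X in X < _]/(\int[P]_x (\1_(X j @^-1` B) x)%:E) integral_indic //.
    by rewrite (le_lt_trans (probability_le1 _ _)) ?ltry // setIT.
  - rewrite finset.in_setD finset.in_setD1 negb_and negbK => /andP[/orP[/eqP ->|iA] iS].
      by exists B.
    rewrite g'E; last by apply: contraNneq iA => ->.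
    by apply: gA; rewrite finset.in_setD iA.
rewrite (bigD1 j) //= g'j => H.
rewrite (fineK finC) -(@eq_bigr _ _ _ _ _ _ (fun i => \int[P]_x (g' i (X i x))%:E));
  last by move=> i /andP[_ nij]; rewrite g'E.
rewrite -H; apply: eq_integral => x _; rewrite [in RHS](bigD1 j) //= g'j; congr EFin.
by congr (_ * _)%R; apply: eq_bigr => i /andP[_ nij]; rewrite g'E.
Qed.

(** Integrability is the nonnegative case applied to absolute values. The product formula then
    follows by splitting one function at a time into its positive and negative parts. *)
Lemma integral_prod_independent S h : S \subset D ->
  (forall i, measurable_fun setT (h i)) ->
  (forall i, i \in S -> P.-integrable setT (fun x => (h i (X i x))%:E)) ->
  P.-integrable setT (fun x => (\prod_(i in S) h i (X i x))%:E) /\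
  \int[P]_x (\prod_(i in S) h i (X i x))%:E
  = (\prod_(i in S) fine (\int[P]_x (h i (X i x))%:E))%:E.
Proof.
move=> SD mh ih.
have int_prod g : (forall i, measurable_fun setT (g i)) ->
    (forall i, i \in S -> P.-integrable setT (fun x => (g i (X i x))%:E)) ->
    P.-integrable setT (fun x => (\prod_(i in S) g i (X i x))%:E).
  move=> mg ig; apply/integrableP; split.
    by apply/measurable_EFinP/measurable_prod_cond => i; exact: measurable_gX.
  pose ag i y : R := `|g i y|%R.
  have mag i : measurable_fun setT (ag i) by apply: measurableT_comp.
  have agfin i : i \in S -> \int[P]_x (ag i (X i x))%:E < +oo.
    by move=> iS; have /integrableP[_] := ig i iS.
  under eq_integral do rewrite abse_EFin normr_prod.
  have ag0 i y : (0 <= ag i y)%R by exact: normr_ge0.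
  rewrite (@ge0_integral_prod_independent S ag) //.
  have agE i : i \in S ->
      \int[P]_x (ag i (X i x))%:E = (fine (\int[P]_x (ag i (X i x))%:E))%:E.
    move=> iS; rewrite fineK // ge0_fin_numE ?agfin //.
    by apply: integral_ge0 => x _; rewrite lee_fin /ag normr_ge0.
  by rewrite (eq_bigr _ agE) prodEFin ltry.
split; first exact: int_prod.
(* A collects the indices whose function is not known to be nonnegative. *)
suff main A : A \subset S -> forall h, (forall i, measurable_fun setT (h i)) ->
    (forall i, i \in S -> P.-integrable setT (fun x => (h i (X i x))%:E)) ->
    (forall i y, i \in S :\: A -> (0 <= h i y)%R) ->
    \int[P]_x (\prod_(i in S) h i (X i x))%:E
    = (\prod_(i in S) fine (\int[P]_x (h i (X i x))%:E))%:E.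
  by apply: (main S) => // i y; rewrite finset.setDv inE.
have [m] := ubnP #|A|; elim: m A => // m IH A /ltnSE Am AS {}h {}mh {}ih hA.
have [A0|[j jA]] := set_0Vmem A.
  pose ah i y : R := `|h i y|%R.
  have ah0 i y : (0 <= ah i y)%R by exact: normr_ge0.
  have ahE i y : i \in S -> h i y = ah i y.
    by move=> iS; rewrite /ah ger0_norm // hA // A0 finset.setD0.
  transitivity (\int[P]_x (\prod_(i in S) ah i (X i x))%:E).
    by apply: eq_integral => x _; congr EFin; apply: eq_bigr => i iS; rewrite ahE.
  rewrite ge0_integral_prod_independent //.
  - rewrite -prodEFin; apply: eq_bigr => i iS.
    under [in RHS]eq_integral do rewrite ahE //.
    rewrite fineK //; under eq_integral do rewrite -ahE //.
    by apply: integrable_fin_num => //; exact: ih.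
  - by move=> i; apply: measurableT_comp.
  - by move=> i iS; have /integrableP[_] := ih i iS.
have jS : j \in S by exact: (fintype.subsetP AS).
pose hp i := if i == j then (h j)^\+%R else h i.
pose hn i := if i == j then (h j)^\-%R else h i.
have hpj : hp j = (h j)^\+%R by rewrite /hp eqxx.
have hnj : hn j = (h j)^\-%R by rewrite /hn eqxx.
have hpE i : i != j -> hp i = h i by rewrite /hp => /negbTE ->.
have hnE i : i != j -> hn i = h i by rewrite /hn => /negbTE ->.
have mhp i : measurable_fun setT (hp i).
  by have [->|nij] := eqVneq i j; [rewrite hpj; exact: measurable_funrpos|rewrite hpE].
have mhn i : measurable_fun setT (hn i).
  by have [->|nij] := eqVneq i j; [rewrite hnj; exact: measurable_funrneg|rewrite hnE].
have ihp i : i \in S -> P.-integrable setT (fun x => (hp i (X i x))%:E).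
  have [-> _|nij iS] := eqVneq i j; last by rewrite hpE //; exact: ih.
  by rewrite hpj; apply: (@integrable_funrpos _ _ _ P setT (h j \o X j)) => //; exact: ih.
have ihn i : i \in S -> P.-integrable setT (fun x => (hn i (X i x))%:E).
  have [-> _|nij iS] := eqVneq i j; last by rewrite hnE //; exact: ih.
  by rewrite hnj; apply: (@integrable_funrneg _ _ _ P setT (h j \o X j)) => //; exact: ih.
have cA : (#|(A :\ j)%SET| < m)%N.
  by apply: leq_trans Am; rewrite [X in (_ < X)%N](cardsD1 j) jA.
have sA : (A :\ j)%SET \subset S by exact: fintype.subset_trans (subD1set _ _) AS.
have pos f i y : (forall y, 0 <= f j y)%R -> (forall i, i != j -> f i = h i) ->
    i \in S :\: (A :\ j)%SET -> (0 <= f i y)%R.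
  move=> fj fE; rewrite finset.in_setD finset.in_setD1 negb_and negbK => /andP[iA iS].
  have [->//|nij] := eqVneq i j; rewrite fE // hA // finset.in_setD iS andbT.
  by move: iA; rewrite (negbTE nij).
have Ep := IH _ cA sA hp mhp ihp (fun i y => pos hp i y _ hpE).
have En := IH _ cA sA hn mhn ihn (fun i y => pos hn i y _ hnE).
have hjE y : h j y = (hp j y - hn j y)%R.
  by rewrite hpj hnj -[in LHS](funrposBneg (h j)).
transitivity (\int[P]_x ((\prod_(i in S) hp i (X i x))%:E
    - (\prod_(i in S) hn i (X i x))%:E)).
  apply: eq_integral => x _; rewrite -EFinB; congr EFin.
  rewrite !(bigD1 j jS) /= hjE mulrBl.
  congr (_ * _ - _ * _)%R; apply: eq_bigr => i /andP[_ nij]; by rewrite ?hpE ?hnE.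
rewrite integralB_EFin //; [|exact: int_prod|exact: int_prod].
rewrite Ep ?En; last 2 first.
- by move=> y; rewrite hnj funrneg_ge0.
- by move=> y; rewrite hpj funrpos_ge0.
rewrite -EFinB; congr EFin; rewrite !(bigD1 j jS) /=.
have -> : \int[P]_x (h j (X j x))%:E
    = \int[P]_x (hp j (X j x))%:E - \int[P]_x (hn j (X j x))%:E.
  rewrite -integralB_EFin //; [|exact: ihp|exact: ihn].
  by apply: eq_integral => x _; rewrite -EFinB hjE.
have fp := integrable_fin_num measurableT (ihp j jS).
have fn := integrable_fin_num measurableT (ihn j jS).
rewrite (fineB fp fn) [RHS]mulrBl.
congr (_ * _ - _ * _)%R; apply: eq_bigr => i /andP[_ nij].
- by rewrite hpE.
- by rewrite hnE.
Qed.

End IndependentFamily.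
End ProductExpectation.

(** * The entries of a Wigner matrix *)

Section WignerVariables.
Local Open Scope classical_set_scope.
Context d (T : measurableType d) (R : realType) (P : probability T R) (n : nat).
Variables (law_re law_im law_diag : probability R R).
Variables (ZRe ZIm : 'I_n -> 'I_n -> {RV P >-> R}).
Hypothesis wZ : wigner law_re law_im law_diag ZRe ZIm.

(** Real parts, imaginary parts and diagonal entries in one index type. All ordered pairs are
    indexed; [free_vars] keeps those above the diagonal. *)
Definition wigner_index : Type := ('I_n * 'I_n) + ('I_n * 'I_n) + 'I_n.
HB.instance Definition _ := Finite.on wigner_index.

Definition wigner_var (v : wigner_index) : {RV P >-> R} :=
  match v with
  | inl (inl p) => ZRe p.1 p.2
  | inl (inr p) => ZIm p.1 p.2
  | inr j => ZRe j j
  end.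

Definition wigner_law (v : wigner_index) : probability R R :=
  match v with inl (inl _) => law_re | inl (inr _) => law_im | inr _ => law_diag end.

Definition is_free_var (v : wigner_index) : bool :=
  match v with inl (inl p) | inl (inr p) => (p.1 < p.2)%N | inr _ => true end.

Definition free_vars : {set wigner_index} := [set v | is_free_var v]%SET.

Lemma sigma_generated_bigcap (I : finType) (D S : {set I})
    (X : I -> {RV P >-> R}) (A : I -> set R) :
  S \subset D -> (forall i, measurable (A i)) ->
  sigma_generated D X (\bigcap_(i in [set` S]) X i @^-1` A i).
Proof.
move=> SD mA; set G := \bigcup_(i in [set` D]) preimage_set_system setT (X i) measurable.
apply: (@fin_bigcap_measurable _ (g_sigma_algebraType G)) => // i /= iS.
apply: sub_gen_smallest; exists i; first exact: (fintype.subsetP SD).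
by exists (A i) => //; rewrite setTI.
Qed.

Lemma wigner_var_law v : v \in free_vars -> has_law (wigner_var v) (wigner_law v).
Proof.
rewrite finset.inE; case: v => [[p|p]|j] /=.
- exact: (wigner_law_re wZ).
- exact: (wigner_law_im wZ).
- by move=> _; exact: (wigner_law_diag wZ).
Qed.

(** A joint event is the intersection of one event from each sigma-algebra; it is split by the
    independence of the three families and then inside each of them. *)
Lemma wigner_independent : independent_family free_vars wigner_var.
Proof.
move=> S A SD mA.
pose S1 := [set p | inl (inl p) \in S]%SET.
pose S2 := [set p | inl (inr p) \in S]%SET.
pose S3 := [set j | inr j \in S]%SET.
have S1u : S1 \subset upper n.
  apply/fintype.subsetP => p; rewrite !finset.inE => /(fintype.subsetP SD).
  by rewrite finset.inE.
have S2u : S2 \subset upper n.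
  apply/fintype.subsetP => p; rewrite !finset.inE => /(fintype.subsetP SD).
  by rewrite finset.inE.
have S3T : S3 \subset [set: 'I_n]%SET.
  by apply/fintype.subsetP => j _; rewrite finset.inE.
have -> : \bigcap_(v in [set` S]) wigner_var v @^-1` A v =
    \bigcap_(p in [set` S1]) (ZRe p.1 p.2) @^-1` A (inl (inl p))
    `&` \bigcap_(p in [set` S2]) (ZIm p.1 p.2) @^-1` A (inl (inr p))
    `&` \bigcap_(j in [set` S3]) (ZRe j j) @^-1` A (inr j).
  apply/seteqP; split => [w H|w [[H1 H2] H3] [[p|p]|j] /= vS].
  - split; [split|] => p /=; rewrite finset.inE => pS; exact: (H _ pS).
  - by apply: H1; rewrite /= finset.inE.
  - by apply: H2; rewrite /= finset.inE.
  - by apply: H3; rewrite /= finset.inE.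
rewrite (wigner_indep wZ); last 3 first.
- by apply: (@sigma_generated_bigcap _ _ _ (fun p => ZRe p.1 p.2) (fun p => A (inl (inl p)))).
- by apply: (@sigma_generated_bigcap _ _ _ (fun p => ZIm p.1 p.2) (fun p => A (inl (inr p)))).
- by apply: (@sigma_generated_bigcap _ _ _ (fun j => ZRe j j) (fun j => A (inr j))).
rewrite (wigner_indep_re wZ (A := fun p => A (inl (inl p)))) //.
rewrite (wigner_indep_im wZ (A := fun p => A (inl (inr p)))) //.
rewrite (wigner_indep_diag wZ (A := fun j => A (inr j))) //.
rewrite big_sumType big_sumType /=.
by congr (_ * _ * _)%E; apply: eq_bigl => x; rewrite finset.inE.
Qed.

End WignerVariables.

(** * Moments under a prescribed law *)

Section Moments.
Local Open Scope classical_set_scope.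
Context (R : realType).
Local Open Scope ereal_scope.

Lemma measurable_EFin_pow (q : nat) :
  measurable_fun [set: R] (fun x : R => (x ^+ q)%:E).
Proof. by apply/measurable_EFinP; exact: exprn_measurable. Qed.

(** Domination of |x|^q by 1 + x^(2r), which is nonnegative because the exponent is even. *)
Lemma finite_moment_le (law : probability R R) (q r : nat) :
  (q <= r.*2)%N -> finite_moment law r.*2 -> finite_moment law q.
Proof.
move=> qr fr; have i1 : law.-integrable setT (fun x : R => (1 + x ^+ r.*2)%:E).
  under eq_fun do rewrite EFinD; apply: integrableD => //.
  exact: finite_measure_integrable_cst.
apply: (le_integrable _ _ _ i1) => //; first exact: measurable_EFin_pow.
move=> x _; rewrite !abse_EFin lee_fin normrX.
have x2 : (0 <= x ^+ r.*2)%R by rewrite -mul2n exprM exprn_ge0 // sqr_ge0.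
rewrite [leRHS]ger0_norm ?addr_ge0 //.
have [x1|x1] := leP `|x|%R 1%R.
  by rewrite (@le_trans _ _ 1%R) ?lerDl ?exprn_ile1.
rewrite (le_trans (ler_weXn2l (ltW x1) qr)) // -normrX ger0_norm // lerDr //.
Qed.

Lemma moment0 (law : probability R R) : moment law 0 = 1%R.
Proof.
rewrite /moment (_ : (fun x : R => x ^+ 0)%R = cst 1%R) ?expectation_cst //.
Qed.

Context d (T : measurableType d) (P : probability T R).

Lemma has_law_moment (X : {RV P >-> R}) (law : probability R R) q :
  has_law X law -> finite_moment law q ->
  P.-integrable setT (fun x => (X x ^+ q)%:E) /\
  fine (\int[P]_x (X x ^+ q)%:E) = moment law q.
Proof.
move=> lawX fq; have mq := measurable_EFin_pow q.
have eqI (f : R -> \bar R) : \int[distribution P X]_x f x = \int[law]_x f x.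
  by apply: eq_measure_integral => A mA _; exact: lawX.
have int : P.-integrable setT (fun x => (X x ^+ q)%:E).
  apply/integrableP; split.
    by apply: (measurableT_comp mq); exact: measurable_funP.
  have /integrableP[_] := fq; rewrite -eqI ge0_integral_distribution //.
  by apply: measurableT_comp.
split=> //; rewrite /moment unlock -eqI.
by rewrite (@integral_distribution _ _ _ _ _ P X (fun x : R => (x ^+ q)%:E)).
Qed.

End Moments.

(** * Transfer to the finite model *)

(** The weights solve a linear system whose Vandermonde matrix at the distinct nodes 0, ..., n-1 is
    invertible; nothing forces them to be nonnegative. *)
Lemma quadrature_exists (R : numFieldType) (mom : nat -> R) n :
  exists q : 'I_n -> R, forall k, (k < n)%N -> \sum_(i < n) q i * i%:R ^+ k = mom k.
Proof.
pose a : 'rV[R]_n := \row_j j%:R.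
have Vu : Vandermonde n a \in unitmx.
  rewrite unitmxE det_Vandermonde unitfE; apply/prodf_neq0 => i _.
  apply/prodf_neq0 => j ij; rewrite !mxE subr_eq0 eqr_nat.
  by rewrite eq_sym neq_ltn ij.
pose q := invmx (Vandermonde n a) *m \col_(i < n) mom i.
exists (fun i => q i 0) => k kn.
have := congr1 (fun M : 'cV_n => M (Ordinal kn) 0) (mulKVmx Vu (\col_(i < n) mom i)).
rewrite -/q !mxE => <-; apply: eq_bigr => i _.
by rewrite !mxE mulrC.
Qed.

(** * Polynomial functions of bounded degree in each variable *)

Section BoundedDegree.
Variables (R : rcfType) (V : finType) (A : {set V}).
Implicit Types (e m : V -> nat) (f g : (V -> R) -> R[i]).

Definition monomial m (x : V -> R) : R := \prod_(v in A) x v ^+ m v.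

(** Finite complex combinations of real monomials, built one term at a time: a statement linear in f
    follows by induction from its case on monomials. *)
Inductive bounded_degree e : ((V -> R) -> R[i]) -> Prop :=
| bounded_degree0 : bounded_degree e (fun=> 0)
| bounded_degreeS c m f : (forall v, m v <= e v)%N -> bounded_degree e f ->
    bounded_degree e (fun x => c * (monomial m x)%:C%C + f x).

Lemma bounded_degree_ext e f g : bounded_degree e f -> f =1 g -> bounded_degree e g.
Proof. by move=> ef /funext <-. Qed.

Lemma bounded_degreeD e f g : bounded_degree e f -> bounded_degree e g ->
  bounded_degree e (fun x => f x + g x).
Proof.
move=> ef eg; elim: ef => [|c m {}f me _ IH].
  by apply: bounded_degree_ext eg _ => x; rewrite add0r.
by apply: bounded_degree_ext (bounded_degreeS c me IH) _ => x; rewrite addrA.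
Qed.

Lemma bounded_degree_weaken e e' f : (forall v, e v <= e' v)%N ->
  bounded_degree e f -> bounded_degree e' f.
Proof.
move=> ee'; elim=> [|c m {}f me _ IH]; first exact: bounded_degree0.
by apply: bounded_degreeS => // v; apply: leq_trans (ee' v).
Qed.

Lemma bounded_degree_monomial e c m : (forall v, m v <= e v)%N ->
  bounded_degree e (fun x => c * (monomial m x)%:C%C).
Proof.
move=> me; apply: bounded_degree_ext (bounded_degreeS c me (bounded_degree0 e)) _.
by move=> x; rewrite addr0.
Qed.

Lemma bounded_degree_cst e c : bounded_degree e (fun=> c).
Proof.
apply: bounded_degree_ext (@bounded_degree_monomial e c (fun=> 0%N) _) _ => // x.
by rewrite /monomial big1 ?mulr1 // => v _; rewrite expr0.
Qed.

Lemma bounded_degree_var e v : v \in A -> (0 < e v)%N ->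
  bounded_degree e (fun x => (x v)%:C%C).
Proof.
move=> vA ev.
apply: bounded_degree_ext (@bounded_degree_monomial e 1 (fun u => (u == v) : nat) _) _.
  by move=> u; case: eqVneq => [->|].
move=> x; rewrite mul1r /monomial (bigD1 v) //= eqxx expr1 big1 ?mulr1 // => u.
by case/andP=> _ /negbTE ->; rewrite expr0.
Qed.

Lemma bounded_degreeM e e' f g : bounded_degree e f -> bounded_degree e' g ->
  bounded_degree (fun v => e v + e' v)%N (fun x => f x * g x).
Proof.
move=> ef eg; elim: ef => [|c m {}f me _ IH].
  by apply: bounded_degree_ext (bounded_degree0 _) _ => x; rewrite mul0r.
have mg : bounded_degree (fun v => e v + e' v)%N (fun x => c * (monomial m x)%:C%C * g x).
  elim: eg {IH} => [|c' m' {}g me' _ IH].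
    by apply: bounded_degree_ext (bounded_degree0 _) _ => x; rewrite mulr0.
  apply: bounded_degree_ext (@bounded_degreeS _ (c * c') (fun v => m v + m' v)%N _ _ IH) _.
    by move=> v; rewrite leq_add.
  move=> x; rewrite mulrDr; congr (_ + _).
  have -> : monomial (fun v => m v + m' v)%N x = monomial m x * monomial m' x.
    by rewrite -big_split; apply: eq_bigr => v _; rewrite exprD.
  by rewrite rmorphM; ring.
by apply: bounded_degree_ext (bounded_degreeD mg IH) _ => x; rewrite mulrDl.
Qed.

Lemma bounded_degree_sum e (I : Type) (r : seq I) (F : I -> (V -> R) -> R[i]) :
  (forall i, bounded_degree e (F i)) -> bounded_degree e (fun x => \sum_(i <- r) F i x).
Proof.
move=> eF; elim: r => [|i r IH].
  by apply: bounded_degree_ext (bounded_degree0 _) _ => x; rewrite big_nil.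
by apply: bounded_degree_ext (bounded_degreeD (eF i) IH) _ => x; rewrite big_cons.
Qed.

Lemma bounded_degree_prod (I : Type) (r : seq I) (e : I -> V -> nat)
    (F : I -> (V -> R) -> R[i]) : (forall i, bounded_degree (e i) (F i)) ->
  bounded_degree (fun v => \sum_(i <- r) e i v)%N (fun x => \prod_(i <- r) F i x).
Proof.
move=> eF; elim: r => [|i r IH].
  by apply: bounded_degree_ext (bounded_degree_cst _ 1) _ => x; rewrite big_nil.
rewrite (_ : (fun v => _) = (fun v => e i v + \sum_(i <- r) e i v)%N); last first.
  by apply/funext => v; rewrite big_cons.
by apply: bounded_degree_ext (bounded_degreeM (eF i) IH) _ => x; rewrite big_cons.
Qed.

(** Each permutation takes one entry from every row, so the degrees of the rows add up. *)
Lemma bounded_degree_det n (e : 'I_n -> V -> nat) (M : (V -> R) -> 'M[R[i]]_n) :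
  (forall i j, bounded_degree (e i) (fun x => M x i j)) ->
  bounded_degree (fun v => \sum_(i < n) e i v)%N (fun x => \det (M x)).
Proof.
move=> eM; apply: bounded_degree_sum => s.
apply: (bounded_degreeM (bounded_degree_cst (fun=> 0%N) ((-1) ^+ s))).
by apply: (@bounded_degree_prod _ _ e (fun i x => M x i (s i))) => i; exact: eM.
Qed.

End BoundedDegree.

(** * Linearity of the complex expectation *)

Section ComplexExpectation.
Context d (T : measurableType d) (R : realType) (P : probability T R).
Local Notation Rec := complex.Re.
Local Notation Imc := complex.Im.

(** The summand has the shape built by [bounded_degreeS]. *)
Lemma complex_expectation_linear (c : R[i]) (g : T -> R) (f : T -> R[i]) :
  P.-integrable setT (EFin \o g) -> complex_integrable P f ->
  let h := fun w => c * (g w)%:C%C + f w in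
  complex_integrable P h /\
  complex_expectation P h
  = c * (fine (\int[P]_w (g w)%:E))%:C%C + complex_expectation P f.
Proof.
move=> ig [iRe iIm] h.
have key (a : R) (k : T -> R) : P.-integrable setT (EFin \o k) ->
   P.-integrable setT (fun w => (a * g w + k w)%:E) /\
   fine 'E_P[fun w => a * g w + k w] = a * fine (\int[P]_w (g w)%:E) + fine 'E_P[k].
  move=> ik; have iag : P.-integrable setT (fun w => (a * g w)%:E).
    have -> : (fun w => (a * g w)%:E) = (fun w => a%:E * (EFin \o g) w)%E by [].
    exact: integrableZl.
  have e : (fun w => (a * g w + k w)%:E) = (EFin \o (fun w => a * g w)) \+ (EFin \o k) by [].
  split; first by rewrite e; apply: integrableD.
  rewrite unlock; under eq_integral do rewrite EFinD.
  rewrite integralD_EFin // fineD; last 2 first.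
  - exact: integrable_fin_num.
  - exact: integrable_fin_num.
  congr (_ + _); transitivity (fine (\int[P]_w (a%:E * (EFin \o g) w)%E)); first by [].
  by rewrite integralZl // fineM // integrable_fin_num.
have hRe w : Rec (h w) = Rec c * g w + Rec (f w).
  by rewrite /h; case: (c) => a b; case: (f w) => x y /=; rewrite mulr0 subr0.
have hIm w : Imc (h w) = Imc c * g w + Imc (f w).
  by rewrite /h; case: (c) => a b; case: (f w) => x y /=; rewrite mulr0 add0r.
have [i1 E1] := key (Rec c) _ iRe; have [i2 E2] := key (Imc c) _ iIm.
split.
  split.
    by have -> : (fun w => (Rec (h w))%:E) = (fun w => (Rec c * g w + Rec (f w))%:E)
      by apply/funext => w; rewrite hRe.
  by have -> : (fun w => (Imc (h w))%:E) = (fun w => (Imc c * g w + Imc (f w))%:E)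
    by apply/funext => w; rewrite hIm.
rewrite /complex_expectation.
have -> : (fun w => Rec (h w)) = (fun w => Rec c * g w + Rec (f w)) by apply/funext.
have -> : (fun w => Imc (h w)) = (fun w => Imc c * g w + Imc (f w)) by apply/funext.
rewrite E1 E2; clear; case: c => a b.
by apply/eqP; rewrite eq_complex /= !mulr0 subr0 add0r !eqxx.
Qed.

Lemma complex_expectation0 :
  complex_integrable P (fun=> 0) /\ complex_expectation P (fun=> 0) = 0.
Proof.
split; first by split; exact: integrable0.
by rewrite /complex_expectation /= !expectation_cst.
Qed.

End ComplexExpectation.

(** * The discrete model with matching moments *)

Section DiscreteModel.
Variables (R : realType) (n : nat).

(** One formula serves the random matrix and the discrete model, which differ only in the values fed
    to x. *)
Definition entry (x : wigner_index n -> R) (j k : 'I_n) : R[i] :=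
  (if (j < k)%N then x (inl (inl (j, k))) +i* x (inl (inr (j, k)))
   else if j == k then (x (inr j))%:C
   else x (inl (inl (k, j))) -i* x (inl (inr (k, j))))%C.

Definition shifted_mx (a c : R) (x : wigner_index n -> R) : 'M[R[i]]_n :=
  \matrix_(j, k) entry x j k + a%:C%C *: const_mx 1 + c%:C%C *: 1%:M.

(** A variable above the diagonal meets two rows and a diagonal one meets one; over two determinants
    this gives the 4 and 2 of [max_degree]. *)
Definition row_degree (i : 'I_n) (v : wigner_index n) : nat :=
  match v with
  | inl (inl p) | inl (inr p) => (i == p.1) + (i == p.2)
  | inr j => i == j
  end.

Definition max_degree (v : wigner_index n) : nat :=
  match v with inl _ => 4 | inr _ => 2 end.

Lemma bounded_degree_entry j k :
  bounded_degree (free_vars n) (row_degree j) (fun x => entry x j k).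
Proof.
have imE (x y : R) : (x +i* y)%C = x%:C%C + 'i%C * y%:C%C.
  by apply/eqP; rewrite eq_complex /= !(mul0r, mul1r, addr0, add0r, subrr, subr0) !eqxx.
have bd (u v : wigner_index n) (b : R[i]) : u \in free_vars n -> v \in free_vars n ->
    (0 < row_degree j u)%N -> (0 < row_degree j v)%N ->
    bounded_degree (free_vars n) (row_degree j)
      (fun x => (x u)%:C%C + b * (x v)%:C%C).
  move=> uF vF ju jv; apply: bounded_degreeD; first exact: bounded_degree_var.
  have := bounded_degreeM (bounded_degree_cst _ (fun=> 0%N) b) (bounded_degree_var R vF jv).
  by apply: bounded_degree_weaken => u'; rewrite add0n.
rewrite /entry; case: ltnP => jk.
  apply: bounded_degree_ext (bd (inl (inl (j, k))) (inl (inr (j, k))) 'i%C _ _ _ _) _.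
  - by rewrite inE.
  - by rewrite inE.
  - by rewrite /= eqxx.
  - by rewrite /= eqxx.
  - by move=> x; rewrite imE.
case: eqVneq => [jk'|njk].
  by apply: bounded_degree_var; rewrite ?inE //= eqxx.
have kj : (k < j)%N by rewrite ltn_neqAle jk andbT eq_sym.
apply: bounded_degree_ext (bd (inl (inl (k, j))) (inl (inr (k, j))) (- 'i%C) _ _ _ _) _.
- by rewrite inE.
- by rewrite inE.
- by rewrite /= eqxx addn1.
- by rewrite /= eqxx addn1.
- by move=> x; rewrite imE rmorphN mulrN mulNr.
Qed.

Lemma bounded_degree_det_shifted a1 a2 c :
  bounded_degree (free_vars n) max_degree
    (fun x => \det (shifted_mx a1 c x) * \det (shifted_mx a2 c x)).
Proof.
have bd a : bounded_degree (free_vars n) (fun v => \sum_(i < n) row_degree i v)%N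
    (fun x => \det (shifted_mx a c x)).
  apply: bounded_degree_det => i j.
  apply: bounded_degree_ext (bounded_degreeD (bounded_degree_entry i j)
    (bounded_degree_cst _ _ (a%:C%C + c%:C%C * (i == j)%:R))) _.
  by move=> x; rewrite !mxE mulr1 addrA.
apply: bounded_degree_weaken (bounded_degreeM (bd a1) (bd a2)) => v.
have sum1 (j : 'I_n) : (\sum_(i < n) (i == j) = 1)%N.
  by rewrite (bigD1 j) //= eqxx big1 // => i /negbTE ->.
by case: v => [[p|p]|j]; rewrite /= ?big_split /= !sum1.
Qed.

Variables (law_re law_im law_diag : probability R R).
Let mu := moment law_re.
Let nu := moment law_im.
Let kappa := moment law_diag.
Variables qre qim qdg : 'I_5 -> R.
Hypothesis qreE : forall k, (k < 5)%N -> \sum_(i < 5) qre i * i%:R ^+ k = mu k.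
Hypothesis qimE : forall k, (k < 5)%N -> \sum_(i < 5) qim i * i%:R ^+ k = nu k.
Hypothesis qdgE : forall k, (k < 5)%N -> \sum_(i < 5) qdg i * i%:R ^+ k = kappa k.

(* The weights are signed: only their moments match those of the laws. *)
Definition model_weight (p : 'I_n * 'I_n) (o : 'I_5 * 'I_5) : R[i] :=
  (if p.1 == p.2 then qdg o.1 * (o.2 == ord0)%:R else qre o.1 * qim o.2)%:C%C.

Definition model_var (om : {ffun 'I_n * 'I_n -> 'I_5 * 'I_5}) (v : wigner_index n) : R :=
  match v with
  | inl (inl p) => (om p).1%:R
  | inl (inr p) => (om p).2%:R
  | inr j => (om (j, j)).1%:R
  end.

Let nodeX (o : 'I_5 * 'I_5) : R[i] := (o.1%:R)%:C%C.
Let nodeY (o : 'I_5 * 'I_5) : R[i] := (o.2%:R)%:C%C.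

Lemma local_offdiag p a b : p.1 != p.2 -> (a < 5)%N -> (b < 5)%N ->
  local_expect model_weight p (fun o => nodeX o ^+ a * nodeY o ^+ b) = (mu a * nu b)%:C%C.
Proof.
move=> np a5 b5; rewrite -qreE // -qimE // big_distrlr /= pair_bigA rmorph_sum.
apply: eq_bigr => o _; rewrite /model_weight (negbTE np) /nodeX /nodeY /=.
by rewrite -!rmorphXn -!rmorphM; congr (real_complex R _); ring.
Qed.

Lemma local_diag j a : (a < 5)%N ->
  local_expect model_weight (j, j) (fun o => nodeX o ^+ a) = (kappa a)%:C%C.
Proof.
move=> a5; rewrite -qdgE // rmorph_sum /local_expect.
rewrite -(pair_bigA _ (fun o1 o2 => model_weight (j, j) (o1, o2) * nodeX (o1, o2) ^+ a)) /=.
(* On a diagonal site the weight pins the second coordinate to 0. *)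
apply: eq_bigr => o1 _; rewrite (bigD1 ord0) //= big1 ?addr0 => [|o2 /negbTE no2].
  by rewrite /model_weight /nodeX /= eqxx /= ?eqxx mulr1 -rmorphXn -rmorphM.
by rewrite /model_weight /= eqxx no2 mulr0 mul0r.
Qed.

Lemma sum_model_weight p : \sum_o model_weight p o = 1.
Proof.
have one : (1 : R[i]) = 1%:C%C by [].
have [e|np] := eqVneq p.1 p.2.
  have pE : p = (p.1, p.1) by case: p e => a b /= ->.
  rewrite one -(moment0 law_diag) -/(kappa 0) -(@local_diag p.1 0) // -pE.
  by apply: eq_bigr => o _; rewrite expr0 mulr1.
rewrite one -[1]mulr1 -{1}(moment0 law_re) -(moment0 law_im) -/(mu 0) -/(nu 0).
rewrite -(local_offdiag np) //; apply: eq_bigr => o _.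
by rewrite !expr0 !mulr1.
Qed.

(** The product over variables is regrouped by site: a site above the diagonal holds a real and an
    imaginary part, a diagonal site one variable, and a site below the diagonal contributes its
    total weight 1. *)
Lemma expect_monomial m : (forall v, m v <= max_degree v)%N ->
  expect model_weight (fun om => (monomial (free_vars n) m (model_var om))%:C%C)
  = (\prod_(v in free_vars n) moment (wigner_law law_re law_im law_diag v) (m v))%:C%C.
Proof.
move=> mle.
have m5 v : (m v < 5)%N by apply: leq_ltn_trans (mle v) _; case: v.
pose g (p : 'I_n * 'I_n) o : R[i] :=
  if (p.1 < p.2)%N then nodeX o ^+ m (inl (inl p)) * nodeY o ^+ m (inl (inr p))
  else if p.1 == p.2 then nodeX o ^+ m (inr p.1) else 1.
have split_prod (F1 F2 : 'I_n * 'I_n -> R[i]) (F3 : 'I_n -> R[i]) :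
    \prod_(p : 'I_n * 'I_n)
      (if (p.1 < p.2)%N then F1 p * F2 p else if p.1 == p.2 then F3 p.1 else 1)
    = (\prod_(p : 'I_n * 'I_n | (p.1 < p.2)%N) F1 p)
      * (\prod_(p : 'I_n * 'I_n | (p.1 < p.2)%N) F2 p) * \prod_j F3 j.
  rewrite (bigID (fun p : 'I_n * 'I_n => p.1 < p.2)%N) /= -big_split /=; congr (_ * _).
    by apply: eq_bigr => p ->.
  rewrite (bigID (fun p : 'I_n * 'I_n => p.1 == p.2)) /= [X in _ * X]big1 ?mulr1; last first.
    by move=> p /andP[/negbTE -> /negbTE ->].
  rewrite (reindex_onto (fun j => (j, j)) (fun p => p.1)) /=; last first.
    by move=> [a b] /= /andP[_ /eqP ->].
  by apply: eq_big => [j|j]; rewrite /= ltnn ?eqxx.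
have split_free (F : wigner_index n -> R[i]) : \prod_(v in free_vars n) F v =
    (\prod_(p : 'I_n * 'I_n | (p.1 < p.2)%N) F (inl (inl p)))
    * (\prod_(p : 'I_n * 'I_n | (p.1 < p.2)%N) F (inl (inr p))) * \prod_j F (inr j).
  rewrite big_sumType big_sumType /=.
  by congr (_ * _ * _); apply: eq_bigl => x; rewrite inE.
transitivity (expect model_weight (fun om => \prod_p g p (om p))).
  apply: eq_expect => om; rewrite rmorph_prod split_free -split_prod.
  apply: eq_bigr => p _; rewrite /g /= !rmorphXn; case: ifP => // _.
  by case: ifP => // /eqP e; have -> : (p.1, p.1) = p by case: (p) e => a b /= ->.
rewrite expect_prod rmorph_prod split_free -split_prod; apply: eq_bigr => p _.
rewrite /g; case: ifP => p12.
  rewrite local_offdiag // ?rmorphM //.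
  by apply: contraTneq p12 => ->; rewrite ltnn.
case: ifP => [/eqP e|_].
  by case: p e {p12} => a b /= <-; rewrite local_diag.
rewrite -[RHS](sum_model_weight p); apply: eq_bigr => o _.
by rewrite mulr1.
Qed.

Section Transfer.
Context d (T : measurableType d) (P : probability T R).
Variables (ZRe ZIm : 'I_n -> 'I_n -> {RV P >-> R}).
Hypothesis wZ : wigner law_re law_im law_diag ZRe ZIm.
Hypothesis fin_re : finite_moment law_re 4.
Hypothesis fin_im : finite_moment law_im 4.
Hypothesis fin_diag : finite_moment law_diag 2.

Lemma entries_mxE w :
  entries_mx ZRe ZIm w = \matrix_(j, k) entry (fun v => wigner_var ZRe ZIm v w) j k.
Proof.
apply/matrixP => j k; rewrite !mxE /entry /=; case: ltngtP => jk.
- by [].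
- by rewrite (wigner_re_sym wZ) // (wigner_im_sym wZ) //; case: eqVneq jk => [->|//]; rewrite ltnn.
- by move/val_inj: jk => <-; rewrite eqxx (wigner_im_diag wZ).
Qed.

Lemma expectation_monomial m : (forall v, m v <= max_degree v)%N ->
  let g w := monomial (free_vars n) m (fun v => wigner_var ZRe ZIm v w) in
  P.-integrable setT (EFin \o g) /\
  fine (\int[P]_w (g w)%:E)
  = \prod_(v in free_vars n) moment (wigner_law law_re law_im law_diag v) (m v).
Proof.
move=> mle g.
have fin v : finite_moment (wigner_law law_re law_im law_diag v) (m v).
  (* The 2 and 1 below are halves of the degrees 4 and 2. *)
  case: v (mle v) => [[p|p]|j] /= mv.
  - exact: (@finite_moment_le _ _ _ 2).
  - exact: (@finite_moment_le _ _ _ 2).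
  - exact: (@finite_moment_le _ _ _ 1).
have [||i1 i2] := @integral_prod_independent _ _ _ P _ _ _ (wigner_independent wZ)
    (free_vars n) (fun v y => y ^+ m v) (fintype.subxx _).
- by move=> v; exact: exprn_measurable.
- by move=> v vF; have [] := has_law_moment (wigner_var_law wZ vF) (fin v).
split=> //; rewrite i2 /=; apply: eq_bigr => v vF.
by have [] := has_law_moment (wigner_var_law wZ vF) (fin v).
Qed.

(** Both expectations are linear and agree on monomials within the degree bound. *)
Lemma bounded_degree_expectation f : bounded_degree (free_vars n) max_degree f ->
  let h w := f (fun v => wigner_var ZRe ZIm v w) in
  complex_integrable P h /\
  complex_expectation P h = expect model_weight (fun om => f (model_var om)).
Proof.
elim=> [|c m {}f mle _ [IH1 IH2]] h.
  by have [? ->] := complex_expectation0 P; rewrite expect0.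
have [gi gE] := expectation_monomial mle.
have [hi hE] := complex_expectation_linear c gi IH1.
split=> //; rewrite /h hE gE IH2 expectD expectZ; congr (_ * _ + _).
by rewrite -expect_monomial.
Qed.

End Transfer.
End DiscreteModel.

(** * Local moments of the model and its determinants *)

Section ModelDeterminants.
Variables (R : realType) (n : nat).
Variables (law_re law_im law_diag : probability R R).
Variables qre qim qdg : 'I_5 -> R.
Let mu := moment law_re.
Let nu := moment law_im.
Let kappa := moment law_diag.
Hypothesis qreE : forall k, (k < 5)%N -> \sum_(i < 5) qre i * i%:R ^+ k = mu k.
Hypothesis qimE : forall k, (k < 5)%N -> \sum_(i < 5) qim i * i%:R ^+ k = nu k.
Hypothesis qdgE : forall k, (k < 5)%N -> \sum_(i < 5) qdg i * i%:R ^+ k = kappa k.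
Hypothesis mu1 : mu 1 = 0.
Hypothesis nu1 : nu 1 = 0.
Hypothesis kappa1 : kappa 1 = 0.
Variable c : R.
Implicit Types (j k : 'I_n) (o : 'I_5 * 'I_5).
Local Notation wt := (@model_weight R n qre qim qdg).
Local Notation X o := ((o.1%:R : R)%:C%C).
Local Notation Y o := ((o.2%:R : R)%:C%C).

(** The sign of the imaginary part at (j,k): a site stores the entry above the diagonal, and its
    mirror is the conjugate. *)
Definition orientation j k : R[i] := if (j < k)%N then 1 else if (k < j)%N then -1 else 0.

Definition model_entry j k o : R[i] :=
  X o + 'i%C * orientation j k * Y o + (if j == k then c%:C%C else 0).

Lemma orientationC j k : orientation k j = - orientation j k.
Proof. by rewrite /orientation; case: ltngtP; rewrite ?opprK ?oppr0. Qed.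

Lemma orientation_sqr j k : j != k -> orientation j k ^+ 2 = 1.
Proof. by rewrite /orientation -val_eqE; case: ltngtP => // _ _; rewrite ?sqrrN expr1n. Qed.

Lemma shifted_model a om :
  shifted_mx a c (@model_var R n om)
  = model_mx model_entry om + a%:C%C *: const_mx 1.
Proof.
apply/matrixP => j k; rewrite !mxE addrAC; congr (_ + _).
rewrite /entry /model_entry /orientation /site.
case: ltngtP => jk.
- have -> : (j == k) = false by apply/negbTE; rewrite -val_eqE neq_ltn jk.
  by apply/eqP; rewrite eq_complex /=; apply/andP; split; apply/eqP; ring.
- have -> : (j == k) = false by apply/negbTE; rewrite -val_eqE neq_ltn jk orbT.
  by apply/eqP; rewrite eq_complex /=; apply/andP; split; apply/eqP; ring.
- move/val_inj: jk => <-; rewrite eqxx mulr0 mul0r addr0 mulr1.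
  by [].
Qed.

Lemma local_expectD p (f g : 'I_5 * 'I_5 -> R[i]) :
  local_expect wt p (fun o => f o + g o) = local_expect wt p f + local_expect wt p g.
Proof. by rewrite -big_split; apply: eq_bigr => o _; rewrite mulrDr. Qed.

Lemma local_expectZ p a (f : 'I_5 * 'I_5 -> R[i]) :
  local_expect wt p (fun o => a * f o) = a * local_expect wt p f.
Proof. by rewrite /local_expect mulr_sumr; apply: eq_bigr => o _; rewrite mulrCA. Qed.

Lemma eq_local_expect p (f g : 'I_5 * 'I_5 -> R[i]) : f =1 g ->
  local_expect wt p f = local_expect wt p g.
Proof. by move=> e; apply: eq_bigr => o _; rewrite e. Qed.

Lemma site_offdiag j k : j != k -> (site j k).1 != (site j k).2.
Proof. by rewrite /site; case: leqP => // _; rewrite eq_sym. Qed.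

Lemma site_diag j : site j j = (j, j).
Proof. by rewrite /site leqnn. Qed.

Lemma model_entry_offdiag j k o : j != k ->
  model_entry j k o = X o + 'i%C * orientation j k * Y o.
Proof. by rewrite /model_entry => /negbTE ->; rewrite addr0. Qed.

Lemma model_entry_conj j k o : j != k ->
  model_entry k j o = X o - 'i%C * orientation j k * Y o.
Proof.
by move=> jk; rewrite model_entry_offdiag 1?eq_sym // orientationC mulrN mulNr.
Qed.

Lemma model_entry_normsq j k o : j != k ->
  model_entry j k o * model_entry k j o = X o ^+ 2 + Y o ^+ 2.
Proof.
move=> jk; rewrite model_entry_offdiag // model_entry_conj //.
have i2 : 'i%C ^+ 2 = -1 :> R[i] by exact: sqr_i.
have := orientation_sqr jk; set e := orientation j k => e2.
transitivity (X o ^+ 2 - 'i%C ^+ 2 * e ^+ 2 * Y o ^+ 2); first by ring.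
by rewrite i2 e2; ring.
Qed.

Definition node (a b : nat) o : R[i] := X o ^+ a * Y o ^+ b.

Lemma local_mix p a b : p.1 != p.2 -> (a < 5)%N -> (b < 5)%N ->
  local_expect wt p (node a b) = (mu a * nu b)%:C%C.
Proof. exact: local_offdiag. Qed.

Lemma local_mixZ p (u : R[i]) a b : p.1 != p.2 -> (a < 5)%N -> (b < 5)%N ->
  local_expect wt p (fun o => u * node a b o) = u * (mu a * nu b)%:C%C.
Proof. by move=> np a5 b5; rewrite local_expectZ local_mix. Qed.

Let mu0 : mu 0 = 1. Proof. exact: moment0. Qed.
Let nu0 : nu 0 = 1. Proof. exact: moment0. Qed.

Let mixE := (local_expectD, local_expectZ).

Lemma local_z j k : j != k -> local_expect wt (site j k) (model_entry j k) = 0.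
Proof.
move=> jk; have ps := site_offdiag jk.
rewrite (@eq_local_expect _ _ (fun o => node 1 0 o
  + 'i%C * orientation j k * node 0 1 o)) => [|o]; last first.
  by rewrite model_entry_offdiag //; rewrite /node; ring.
by rewrite !local_expectD ?local_mixZ // ?local_mix // mu1 nu1 mul0r mulr0 !rmorph0 mulr0 addr0.
Qed.

Lemma local_zz j k : j != k ->
  local_expect wt (site j k) (fun o => model_entry j k o * model_entry j k o)
  = (mu 2 - nu 2)%:C%C.
Proof.
move=> jk; have ps := site_offdiag jk.
have i2 : 'i%C ^+ 2 = -1 :> R[i] by exact: sqr_i.
have := orientation_sqr jk; set e := orientation j k => e2.
rewrite (@eq_local_expect _ _ (fun o => node 2 0 o
  + ((2 * 'i%C * e) * (node 1 1 o)
  + ('i%C ^+ 2 * e ^+ 2) * (node 0 2 o)))) => [|o]; last first.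
  by rewrite model_entry_offdiag // -/e; rewrite /node; ring.
rewrite !local_expectD ?local_mixZ // ?local_mix // mu1 mu0 nu0 i2 e2.
by rewrite mul0r rmorph0 rmorphB mulr1 mul1r mulr0 add0r mulr1 mulN1r.
Qed.

Lemma local_zc j k : j != k ->
  local_expect wt (site j k) (fun o => model_entry j k o * model_entry k j o)
  = (mu 2 + nu 2)%:C%C.
Proof.
move=> jk; have ps := site_offdiag jk.
rewrite (@eq_local_expect _ _ (fun o => node 2 0 o + node 0 2 o)) => [|o].
  by rewrite !local_expectD ?local_mixZ // ?local_mix // mu0 nu0 mulr1 mul1r rmorphD.
by rewrite model_entry_normsq //; rewrite /node; ring.
Qed.

(** The expectation of z (x^2 + y^2) for z = x + i e y, with e the orientation; the mixed terms
    contain a first moment and vanish. *)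
Definition third_moment j k : R[i] := (mu 3)%:C%C + 'i%C * orientation j k * (nu 3)%:C%C.

Lemma local_zzc j k : j != k ->
  local_expect wt (site j k)
    (fun o => model_entry j k o * model_entry j k o * model_entry k j o) = third_moment j k.
Proof.
move=> jk; have ps := site_offdiag jk.
set e := orientation j k.
rewrite (@eq_local_expect _ _ (fun o => node 3 0 o + (node 1 2 o
   + (('i%C * e) * (node 2 1 o) + ('i%C * e) * (node 0 3 o))))) => [|o].
  rewrite !local_expectD ?local_mixZ // ?local_mix // mu0 nu0 mu1 nu1 /third_moment -/e.
  by rewrite mulr1 mul0r mulr0 mul1r !rmorph0 mulr0 !add0r.
by rewrite -mulrA model_entry_normsq // model_entry_offdiag // -/e; rewrite /node; ring.
Qed.

Lemma local_zzcc j k : j != k ->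
  local_expect wt (site j k) (fun o => model_entry j k o * model_entry j k o *
    (model_entry k j o * model_entry k j o)) = (mu 4 + nu 4 + 2 * mu 2 * nu 2)%:C%C.
Proof.
move=> jk; have ps := site_offdiag jk.
rewrite (@eq_local_expect _ _ (fun o => node 4 0 o + (node 0 4 o
   + 2 * (node 2 2 o)))) => [|o].
  rewrite !local_expectD ?local_mixZ // ?local_mix // mu0 nu0 mulr1 mul1r addrA -mulrA.
  by rewrite [in RHS]rmorphD rmorphD [in RHS]rmorphM /= rmorph_nat.
by rewrite mulrACA model_entry_normsq //; rewrite /node; ring.
Qed.

Lemma local_d j : local_expect wt (site j j) (model_entry j j) = c%:C%C.
Proof.
rewrite site_diag (@eq_local_expect _ _ (fun o => X o ^+ 1 + c%:C%C * X o ^+ 0)) => [|o].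
  rewrite !mixE !(local_diag _ _ qdgE) // -/kappa kappa1 /kappa moment0.
  by rewrite rmorph0 add0r rmorph1 mulr1.
by rewrite /model_entry /orientation ltnn eqxx; ring.
Qed.

Lemma local_dd j :
  local_expect wt (site j j) (fun o => model_entry j j o * model_entry j j o)
  = (c ^+ 2 + kappa 2)%:C%C.
Proof.
rewrite site_diag (@eq_local_expect _ _ (fun o => X o ^+ 2 + (2 * c%:C%C * X o ^+ 1
    + c%:C%C ^+ 2 * X o ^+ 0))) => [|o].
  rewrite !mixE !(local_diag _ _ qdgE) // -/kappa kappa1 /kappa moment0.
  by rewrite rmorph0 rmorph1 mulr0 add0r mulr1 addrC rmorphD rmorphXn.
by rewrite /model_entry /orientation ltnn eqxx; ring.
Qed.

(** The real sequences obey the recurrences of the Hermitian model once its local moments are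
    computed, so [expect_det_prod] and [coefs_gf_prefactor] give the same value. *)
Lemma expect_model_det a1 a2 :
  expect wt (fun om => \det (shifted_mx a1 c (@model_var R n om))
      * \det (shifted_mx a2 c (@model_var R n om)))
  = (n`!%:R * coefs (gf_prefactor c (mu 2) (nu 2) (mu 3) a1 a2
       * gf_sqr c (kappa 2) (mu 2) (nu 2) (mu 4) (nu 4)) n)%:C%C.
Proof.
rewrite coefs_gf_prefactor.
have rm := (rmorphD, rmorphN, rmorphM, rmorphXn, rmorph_nat, rmorphMn, rmorph1).
rewrite (@eq_expect _ _ _ _ _ (fun om =>
  \det (model_mx model_entry om + a1%:C%C *: const_mx 1)
  * \det (model_mx model_entry om + a2%:C%C *: const_mx 1))) => [|om]; last first.
  by rewrite !shifted_model.
(* The closed forms live over R, the model over R[i]. *)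
pose cx (x : nat -> R) (k : nat) : R[i] := (x k)%:C%C.
have zsym j k : j != k -> third_moment j k + third_moment k j = (mu 3)%:C%C *+ 2.
  by move=> _; rewrite /third_moment (orientationC j k) mulrN mulNr addrACA subrr addr0 mulr2n.
have inj2 : injective (fun x : R[i] => x *+ 2).
  move=> x y /= e; have n2 : (2%:R : R[i]) != 0 by rewrite pnatr_eq0.
  by apply: (mulIf n2); rewrite !mulr_natr.
pose sf := seq_f c (kappa 2) (mu 2) (nu 2) (mu 4) (nu 4).
pose sU := seq_U c (kappa 2) (mu 2) (nu 2) (mu 4) (nu 4).
pose sM := seq_M c (kappa 2) (mu 2) (nu 2) (mu 4) (nu 4).
pose sN := seq_N c (kappa 2) (mu 2) (nu 2) (mu 4) (nu 4).
pose sR := seq_R c (kappa 2) (mu 2) (nu 2) (mu 4) (nu 4).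
have h0 : cx sf 0%N = 1 by rewrite /cx /sf seq_f0.
have H := @expect_det_prod _ n _ wt model_entry _ _ _ _ _ third_moment
  (sum_model_weight qreE qimE qdgE)
  local_d local_dd local_z local_zz local_zc local_zzc local_zzcc
  (cx sf) (cx sU) (cx sM) (cx sN) (cx sR) h0.
rewrite (H _ _ _ _ _ (mu 3)%:C%C) {H}.
- rewrite /cx -!/(sf _) -!/(sU _) -!/(sM _) -!/(sN _) -!/(sR _).
  by rewrite !rm.
- by move=> m; rewrite /cx /sf seq_fS !rm.
- by move=> m; rewrite /cx /sU seq_US !rm.
- by move=> m; rewrite /cx /sM seq_MS !rm.
- by move=> m; rewrite /cx /sN seq_NS !rm.
- by move=> m; rewrite /cx /sR seq_RS !rm.
- exact: inj2.
- exact: zsym.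
Qed.

End ModelDeterminants.

Theorem corollary11 (R : realType)
    (law_re law_im law_diag : probability R R)
    (d : nat -> measure_display) (T : forall n, measurableType (d n))
    (P : forall n, probability (T n) R)
    (ZRe ZIm : forall n, 'I_n -> 'I_n -> {RV (P n) >-> R})
    (a1 a2 c : R) :
  (forall n, wigner law_re law_im law_diag (ZRe n) (ZIm n)) ->
  finite_moment law_re 4 -> finite_moment law_im 4 -> finite_moment law_diag 2 ->
  moment law_re 1 = 0 -> moment law_im 1 = 0 -> moment law_diag 1 = 0 ->
  let mu := moment law_re in
  let nu := moment law_im in
  let kappa := moment law_diag in
  let t : fps R := fpsX in
  let s : fps R := (mu 2%N + nu 2%N)%:S in
  let D : fps R := 1 - (2 * mu 2%N)%:S * t + (mu 2%N ^+ 2 - nu 2%N ^+ 2)%:S * t ^+ 2 in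
  let Pt : fps R :=
    1 + (a1 + a2)%:S * ((mu 3%N)%:S * t ^+ 2 + c%:S * t / (1 + s * t))
    + (a1 * a2)%:S *
      ((mu 3%N ^+ 2)%:S * t ^+ 4
       + (2 * c * mu 3%N)%:S * t ^+ 3 / (1 + s * t)
       + (c ^+ 2)%:S * t ^+ 2 / (1 + s * t) ^+ 2
       + 2 * t ^+ 2 * ((mu 2%N)%:S - (mu 2%N ^+ 2)%:S * t + (nu 2%N ^+ 2)%:S * t) / D
       + t / (1 - s ^+ 2 * t ^+ 2)) in
  let Qt : fps R :=
    fps_exp (t * (c ^+ 2 + kappa 2%N - 2 * mu 2%N)%:S
             + (2^-1)%:S * t ^+ 2
               * (mu 4%N - 3 * nu 2%N ^+ 2 - 3 * mu 2%N ^+ 2 + nu 4%N)%:S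
             - t ^+ 2 * (c ^+ 2 * (mu 2%N + nu 2%N))%:S / (1 + t * s))
    / (D * fps_sqrt (1 - s ^+ 2 * t ^+ 2)) in
  (forall n, complex_integrable (P n) (det_prod (ZRe n) (ZIm n) a1 a2 c c)) /\
  H2 ZRe ZIm a1 a2 c c = map_fps (fun x : R => (x%:C)%C) (Pt * Qt).
Proof.
move=> wZ fin_re fin_im fin_diag mu1 nu1 kappa1 mu nu kappa t s D Pt Qt.
(* Five nodes reproduce the moments 0 to 4. For the diagonal law the entries 3 and 4 are whatever
   values [moment] takes there; monomials use its moments up to 2 only. *)
have [qre qreE] := quadrature_exists mu 5.
have [qim qimE] := quadrature_exists nu 5.
have [qdg qdgE] := quadrature_exists kappa 5.
have detE n : det_prod (ZRe n) (ZIm n) a1 a2 c c = fun w =>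
    \det (shifted_mx a1 c (fun v => wigner_var (ZRe n) (ZIm n) v w))
    * \det (shifted_mx a2 c (fun v => wigner_var (ZRe n) (ZIm n) v w)).
  by apply/funext => w; rewrite /det_prod (entries_mxE (wZ n)).
have key n := bounded_degree_expectation qreE qimE qdgE (wZ n) fin_re fin_im fin_diag
  (bounded_degree_det_shifted n a1 a2 c).
split=> [n|]; first by rewrite detE; have [] := key n.
apply: fpsP => n /=; rewrite detE; have [_ ->] := key n.
rewrite (expect_model_det _ qreE qimE qdgE) // rmorphM rmorph_nat mulrAC divff ?mul1r //.
Qed.
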